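(* Let $U:\mathbb{R}^d\to\mathbb{R}$ be continuously differentiable with $\int e^{-U}<\infty$, and assume that for some $\beta\in[0,1]$ there exist $L_1,M_1\ge0$ with $\|\nabla U(q)-\nabla U(\tilde q)\|\le L_1\|q-\tilde q\|$ and $\|\nabla U(q)\|\le M_1(1+\|q\|^\beta)$ for all $q,\tilde q\in\mathbb{R}^d$. (a) If $\beta\in[0,1)$, then for all $h>0$ and $T\in\mathbb{N}^*$, the HMC kernel $P_{h,T}$ is irreducible, the Lebesgue measure is an irreducibility measure, and every compact subset of $\mathbb{R}^d$ is small. (b) If $\beta=1$, then for all $T\in\mathbb{N}^*$ there exists $\bar h_T>0$ such that for all $h\in(0,\bar h_T]$, $P_{h,T}$ is irreducible, the Lebesgue measure is an irreducibility measure, and every compact subset of $\mathbb{R}^d$ is small. Moreover, in either case (a) or (b) (for the corresponding $h,T$), $P_{h,T}$ is aperiodic and recurrent, and for $\pi$-almost every $q\in\mathbb{R}^d$, $\lim_{n\to\infty}\|\delta_qP_{h,T}^n-\pi\|_{TV}=0$.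
   Context: $\pi$ is the probability density on $\mathbb{R}^d$ proportional to $e^{-U}$. $H(q,p)=U(q)+\|p\|^2/2$. For $h>0$, the leapfrog map is $\Phi_h=\Psi^{(1)}_h\circ\Psi^{(2)}_h\circ\Psi^{(1)}_h$ with $\Psi^{(1)}_h(q,p)=(q,p-(h/2)\nabla U(q))$, $\Psi^{(2)}_h(q,p)=(q+hp,p)$; $\Phi_h^{\circ T}$ is its $T$-fold composition and $\Phi^{q,T}_h$ the position component of $\Phi_h^{\circ T}$. With $\alpha_H((q,p),(\tilde q,\tilde p))=\min[1,\exp(H(q,p)-H(\tilde q,\tilde p))]$ and $\varphi(p)=(2\pi)^{-d/2}e^{-\|p\|^2/2}$, the HMC kernel is $$P_{h,T}(q,A)=\int 1_A(\Phi^{q,T}_h(q,p))\,\alpha_H((q,p),\Phi_h^{\circ T}(q,p))\varphi(p)\,dp+\delta_q(A)\int[1-\alpha_H((q,p),\Phi_h^{\circ T}(q,p))]\varphi(p)\,dp.$$ A set $C$ is small for $P$ if there exist $m\ge1$ and a nontrivial measure $\mu$ with $P^m(x,A)\ge\mu(A)$ for all $x\in C$ and Borel $A$. $P$ is irreducible with irreducibility measure $\mu$ if every Borel $A$ with $\mu(A)>0$ satisfies $\sum_{m\ge1}P^m(x,A)>0$ for all $x$. Recurrent: every accessible set $A$ satisfies $\mathbb{E}_x[N_A]=\infty$ for $x\in A$, with $N_A$ the number of visits to $A$. *)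

(* Defs.v *)
From HB Require Import structures.
From mathcomp Require Import all_boot all_order all_algebra.
From mathcomp Require Import all_classical all_reals all_analysis.
Set Implicit Arguments. Unset Strict Implicit. Unset Printing Implicit Defensive.
Import Order.TTheory GRing.Theory Num.Theory.
Import numFieldNormedType.Exports.
Local Open Scope classical_set_scope.
Local Open Scope ring_scope.

Section HMC.
Variables (R : realType) (d : nat).
Local Notation V := 'rV[R]_d.

Definition enorm (v : V) : R := Num.sqrt (\sum_(i < d) v ord0 i ^+ 2).

Definition ebasis (i : 'I_d) : V := delta_mx ord0 i.

Definition grad (U : V -> R) (q : V) : V := \row_i derive U q (ebasis i).

Definition borel_d : set (set V) := <<s (@open V) >>.

(* d-dimensional Lebesgue integral of a nonnegative function, defined as the
   iterated (Tonelli) integral over the coordinates d-1, ..., 0 *)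
Fixpoint lint (k : nat) (F : (nat -> R) -> \bar R) (x : nat -> R) : \bar R :=
  match k with
  | 0 => F x
  | k'.+1 => (\int[lebesgue_measure]_t lint k' F (fun j => if j == k' then t else x j))%E
  end.

Definition leb_int (G : V -> \bar R) : \bar R :=
  lint d (fun x => G (\row_i x (nat_of_ord i))) (fun _ => 0).

Definition leb_d (A : set V) : \bar R := leb_int (fun x => (\1_A x)%:E).

Definition ham (U : V -> R) (x : V * V) : R := U x.1 + enorm x.2 ^+ 2 / 2.
Definition gauss (p : V) : R := (Num.sqrt (2 * pi)) ^- d * expR (- (enorm p ^+ 2 / 2)).

Definition Psi1 (U : V -> R) (h : R) (x : V * V) : V * V :=
  (x.1, x.2 - (h / 2) *: grad U x.1).
Definition Psi2 (h : R) (x : V * V) : V * V := (x.1 + h *: x.2, x.2).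
Definition leapfrog (U : V -> R) (h : R) (x : V * V) : V * V :=
  Psi1 U h (Psi2 h (Psi1 U h x)).
Definition leapfrogT (U : V -> R) (h : R) (T : nat) (x : V * V) : V * V :=
  iter T (leapfrog U h) x.

Definition accept (U : V -> R) (x y : V * V) : R :=
  Num.min 1 (expR (ham U x - ham U y)).

(* the HMC kernel acting on nonnegative functions: (P g)(q) = \int g(y) P(q,dy) *)
Definition hmc_op (U : V -> R) (h : R) (T : nat) (g : V -> \bar R) (q : V) : \bar R :=
  (leb_int (fun p => g (leapfrogT U h T (q, p)).1 *
      (accept U (q, p) (leapfrogT U h T (q, p)) * gauss p)%:E)
   + g q * leb_int (fun p =>
      ((1 - accept U (q, p) (leapfrogT U h T (q, p))) * gauss p)%:E))%E.

Definition hmc_kernel_n (U : V -> R) (h : R) (T : nat) (n : nat) (q : V) (A : set V)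
  : \bar R := iter n (hmc_op U h T) (fun y => (\1_A y)%:E) q.

Definition target (U : V -> R) (A : set V) : \bar R :=
  (leb_int (fun x => (\1_A x * expR (- U x))%:E) *
   ((fine (leb_int (fun x => (expR (- U x))%:E)))^-1)%:E)%E.

(* generic Markov-kernel notions, for a kernel given by its n-step transition
   probabilities Pn : nat -> V -> set V -> \bar R *)
Definition is_measure_borel (mu : set V -> \bar R) : Prop :=
  [/\ mu set0 = 0%E,
      (forall A, borel_d A -> (0 <= mu A)%E) &
      (forall F : (set V)^nat, (forall n, borel_d (F n)) -> trivIset setT F ->
         (\sum_(0 <= n <oo) mu (F n))%E = mu (\bigcup_n F n))].

Definition nontrivial (mu : set V -> \bar R) : Prop := (0 < mu setT)%E.

Definition visits (Pn : nat -> V -> set V -> \bar R) (x : V) (A : set V) : \bar R :=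
  (\sum_(1 <= m <oo) Pn m x A)%E.

Definition irreducibility_measure (Pn : nat -> V -> set V -> \bar R)
    (mu : set V -> \bar R) : Prop :=
  forall A, borel_d A -> (0 < mu A)%E -> forall x, (0 < visits Pn x A)%E.

Definition irreducible (Pn : nat -> V -> set V -> \bar R) : Prop :=
  exists mu, [/\ is_measure_borel mu, nontrivial mu & irreducibility_measure Pn mu].

Definition small_set (Pn : nat -> V -> set V -> \bar R) (C : set V) : Prop :=
  exists m, (1 <= m)%N /\ exists mu, [/\ is_measure_borel mu, nontrivial mu &
     forall x A, C x -> borel_d A -> (mu A <= Pn m x A)%E].

(* aperiodicity (Meyn-Tweedie): no k-cycle with k >= 2, the null sets being
   those of the irreducibility measure psi *)
Definition aperiodic (Pn : nat -> V -> set V -> \bar R) (psi : set V -> \bar R) : Prop :=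
  forall k : nat, (2 <= k)%N -> ~ exists D : nat -> set V,
    [/\ forall i, (i < k)%N -> borel_d (D i),
        forall i j, (i < k)%N -> (j < k)%N -> i != j -> D i `&` D j = set0,
        psi (~` \bigcup_(i in [set i | (i < k)%N]) D i) = 0%E &
        forall i x, (i < k)%N -> D i x -> Pn 1%N x (D ((i.+1) %% k)%N) = 1%E].

Definition accessible (Pn : nat -> V -> set V -> \bar R) (A : set V) : Prop :=
  forall x, (0 < visits Pn x A)%E.

Definition recurrent (Pn : nat -> V -> set V -> \bar R) : Prop :=
  forall A, borel_d A -> accessible Pn A -> forall x, A x -> visits Pn x A = +oo%E.

Definition tv_dist (mu nu : set V -> \bar R) : \bar R :=
  ereal_sup [set `|(mu A - nu A)%E|%E | A in borel_d].

End HMC.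

(* Main.v *)
(** The kernel reverses [pi], since the leapfrog map preserves Lebesgue measure and is inverted by
    a momentum flip.  The possible endpoints are all reached: a leapfrog trajectory from [q] to [y]
    is a critical point of the discrete action
    [\sum_k |x_(k+1) - x_k|^2 / 2 - h^2 \sum_k U (x_k)] with fixed endpoints, and the action is
    coercive, hence has a minimiser, as soon as [h^2 U <= eps |x|^2 + K] with [eps] small: for all
    [h] if [beta < 1], for small [h] if [beta = 1].  The end position is thus a Lipschitz and
    surjective function of the initial momentum, and Lipschitz maps increase Lebesgue measure by at
    most a constant factor, whence [P q A >= c leb (A `&` ball 0 rho)] for [|q| < rho].

    For a reversible kernel [P] with such minorizations on balls [C], the decrease of
    [||P^n f||_2^2] bounds the variances of [P^n f] on [C], so that [P^n f] tends to its mean in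
    [L^1], and the invariant mass of the chain not yet regenerated on [C] tends to zero; the renewal
    decomposition turns these facts into convergence in total variation from almost every point.
    Using the minorization once more gives [liminf P^n A x > 0] for every [x] when [pi A > 0],
    hence infinitely many expected visits. *)

Require Import Defs.
From HB Require Import structures.
From mathcomp Require Import all_boot all_order all_algebra.
From mathcomp Require Import all_classical all_reals all_analysis.
From mathcomp Require Import measurable_realfun.
From mathcomp Require Import ring lra zify.
Set Implicit Arguments. Unset Strict Implicit. Unset Printing Implicit Defensive.
Import Order.TTheory GRing.Theory Num.Theory.
Import numFieldNormedType.Exports.
Local Open Scope classical_set_scope.
Local Open Scope ring_scope.

(** Kernels are treated as operators on bounded nonnegative functions, and regeneration is the
    subtraction of [c * 1_C * nu f] from [p f], so no split chain has to be built. Two obstacles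
    shape the argument. Rejections may leave an atom at the starting point at every time, so [L^1]
    convergence says nothing about one fixed [q]: what remains is the probability of not having
    regenerated. Its integral against [P 1_C] tends to zero, and this weight is positive everywhere,
    so the limit vanishes almost everywhere; this is the origin of the exceptional null set.
    Uniformity over the events [A] comes from reversibility: the integral of [P^j 1_A] over [C] is
    that of [P^j 1_C] over [A], so the single sequence [P^j 1_C] controls all [A] at once. On the
    dynamical side the gradient is only Lipschitz and no Jacobian is available: volume preservation
    comes from translations in one variable at a time, and the comparison of volumes from averaging
    over small balls. The admissible [eps] is [1 / (4 T 2^T)], where [2^T] is the cost of bounding
    all points of a path by its start and its energy. *)

Section bounded_measurable.
Context d (T : measurableType d) (R : realType).
Implicit Types f g : T -> R.

Definition bmeas f := measurable_fun setT f /\ exists M, forall x, `|f x| <= M.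

Lemma bmeas_cst a : bmeas (fun=> a).
Proof. by split; [exact: measurable_cst|exists `|a|]. Qed.

Lemma bmeasD f g : bmeas f -> bmeas g -> bmeas (fun x => f x + g x).
Proof.
move=> [mf [M hM]] [mg [N hN]]; split; first exact: measurable_funD.
by exists (M + N) => x; rewrite (le_trans (ler_normD _ _))// lerD.
Qed.

Lemma bmeasN f : bmeas f -> bmeas (fun x => - f x).
Proof.
move=> [mf [M hM]]; split; first exact: measurableT_comp.
by exists M => x; rewrite normrN.
Qed.

Lemma bmeasB f g : bmeas f -> bmeas g -> bmeas (fun x => f x - g x).
Proof. by move=> bf bg; apply: bmeasD => //; exact: bmeasN. Qed.

Lemma bmeasM f g : bmeas f -> bmeas g -> bmeas (fun x => f x * g x).
Proof.
move=> [mf [M hM]] [mg [N hN]]; split; first exact: measurable_funM.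
by exists (M * N) => x; rewrite normrM ler_pM.
Qed.

Lemma bmeasX f n : bmeas f -> bmeas (fun x => f x ^+ n).
Proof.
move=> bf; elim: n => [|n ih]; first exact: bmeas_cst.
by under eq_fun do rewrite exprS; exact: bmeasM.
Qed.

Lemma bmeas_norm f : bmeas f -> bmeas (fun x => `|f x|).
Proof.
move=> [mf [M hM]]; split; first exact: measurableT_comp.
by exists M => x; rewrite normr_id.
Qed.

Lemma bmeas_indic (A : set T) : measurable A -> bmeas (\1_A : T -> R).
Proof.
move=> mA; split; first exact: measurable_indic.
by exists 1 => x; rewrite indicE; case: (_ \in _); rewrite ?normr1// normr0.
Qed.

Lemma indic_ge0 (A : set T) x : 0 <= \1_A x :> R.
Proof. by rewrite indicE ler0n. Qed.

Lemma indic_le1 (A : set T) x : \1_A x <= 1 :> R.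
Proof. by rewrite indicE lern1 leq_b1. Qed.

End bounded_measurable.

#[global] Hint Resolve bmeas_cst bmeasD bmeasN bmeasB bmeasM bmeasX bmeas_norm bmeas_indic : bmeas.
#[global] Hint Resolve indic_ge0 indic_le1 : core.

Section bounded_expectation.
Context d (T : measurableType d) (R : realType) (mu : probability T R).
Implicit Types f g : T -> R.

Local Notation e f := (Rintegral mu setT f).

Let measureT : (mu : {measure set T -> \bar R}) setT = 1%E.
Proof. exact: probability_setT. Qed.

Lemma bmeas_integrable f : bmeas f -> mu.-integrable setT (EFin \o f).
Proof.
move=> [mf [M hM]]; apply: measurable_bounded_integrable => //; first by rewrite measureT ltry.
exists M; split; first exact: num_real.
by move=> N MN x _ /=; rewrite (le_trans (hM x))// ltW.
Qed.

Lemma bexpD f g : bmeas f -> bmeas g -> e (fun x => f x + g x) = e f + e g.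
Proof. by move=> bf bg; rewrite RintegralD//; exact: bmeas_integrable. Qed.

Lemma bexpB f g : bmeas f -> bmeas g -> e (fun x => f x - g x) = e f - e g.
Proof. by move=> bf bg; rewrite RintegralB//; exact: bmeas_integrable. Qed.

Lemma bexpZ a f : bmeas f -> e (fun x => a * f x) = a * e f.
Proof. by move=> bf; rewrite RintegralZl//; exact: bmeas_integrable. Qed.

Lemma bexp_cst a : e (fun=> a) = a.
Proof. by rewrite Rintegral_cst// measureT mulr1. Qed.

Lemma bexp_le f g : bmeas f -> bmeas g -> (forall x, f x <= g x) -> e f <= e g.
Proof. by move=> bf bg fg; apply: le_Rintegral => //; exact: bmeas_integrable. Qed.

Lemma bexp_ge0 f : (forall x, 0 <= f x) -> 0 <= e f.
Proof. by move=> f0; apply: Rintegral_ge0. Qed.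

Lemma bexp_norm f : bmeas f -> `|e f| <= e (fun x => `|f x|).
Proof. by move=> bf; apply: le_normr_Rintegral => //; exact: bmeas_integrable. Qed.

Lemma bexp_indic A : measurable A -> (e (\1_A : T -> R))%:E = mu A.
Proof.
move=> mA; rewrite /Rintegral fineK.
  by rewrite integral_indic// setIT.
by rewrite integral_indic// setIT fin_num_measure.
Qed.

Lemma bexp_EFin f : bmeas f -> (e f)%:E = (\int[mu]_x (f x)%:E)%E.
Proof.
by move=> bf; rewrite /Rintegral fineK// integrable_fin_num//; exact: bmeas_integrable.
Qed.

Lemma bexp_eq0 f : bmeas f -> (forall x, 0 <= f x) -> e f = 0 ->
  mu.-negligible [set x | f x <> 0].
Proof.
move=> bf f0 ef.
have : (\int[mu]_x `|(f x)%:E| = 0)%E.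
  rewrite -[RHS](congr1 EFin ef) bexp_EFin//; apply: eq_integral => x _.
  by rewrite gee0_abs// lee_fin.
move/(ae_eq_integral_abs mu measurableT) => [|N [mN N0 hN]].
  by apply/measurable_EFinP; case: bf.
exists N; split => // x /= fx; apply: hN => /= /(_ I) [].
exact: fx.
Qed.

(* Split [f - t] over [C] and its complement, and use [|u| <= delta + u^2 / delta] on [C]. *)
Lemma bexp_dist_mean_le C f M t delta : measurable C -> bmeas f ->
  (forall x, 0 <= f x <= M) -> 0 <= t <= M -> 0 < delta ->
  e (fun x => `|f x - e f|) <= 2 * (delta
    + e (fun x => \1_C x * (f x - t) ^+ 2) / delta + M * (1 - e (\1_C))).
Proof.
move=> mC bf fM tM d0.
have bC := bmeas_indic R mC.
have h1 : e (fun x => `|f x - e f|) <= 2 * e (fun x => `|f x - t|).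
  have h2 : `|e f - t| <= e (fun x => `|f x - t|).
    have -> : e f - t = e (fun x => f x - t).
      by rewrite bexpB; auto with bmeas; rewrite bexp_cst.
    by apply: bexp_norm; auto with bmeas.
  apply: (@le_trans _ _ (e (fun x => `|f x - t| + `|e f - t|))).
    apply: bexp_le; auto with bmeas => x.
    rewrite (_ : f x - e f = (f x - t) - (e f - t)); last by ring.
    exact: ler_normB.
  by rewrite bexpD; auto with bmeas; rewrite bexp_cst; lra.
apply: (le_trans h1); rewrite ler_pM2l//.
have -> : delta + e (fun x => \1_C x * (f x - t) ^+ 2) / delta + M * (1 - e (\1_C)) =
   e (fun x => delta + delta^-1 * (\1_C x * (f x - t) ^+ 2) + M * (1 - \1_C x)).
  rewrite bexpD; auto 10 with bmeas.
  rewrite bexpD; auto 10 with bmeas.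
  rewrite !bexpZ; auto 10 with bmeas.
  by rewrite bexpB; auto with bmeas; rewrite !bexp_cst mulrC.
apply: bexp_le; [by auto 10 with bmeas..|] => x.
have /andP[t0 tM'] := tM; have /andP[f0 fM'] := fM x.
rewrite indicE; case: (x \in C); last first.
  rewrite mul0r mulr0 addr0 subr0 mulr1 ler_norml.
  by apply/andP; split; lra.
rewrite mul1r subrr mulr0 addr0.
set u := f x - t.
have hu : `|u| * delta <= delta ^+ 2 + u ^+ 2.
  rewrite -[u ^+ 2]real_normK ?num_real//.
  by have := normr_ge0 u; nra.
rewrite -(ler_pM2r d0) (le_trans hu)// mulrDl expr2 lerD2l.
by rewrite mulrAC mulVf ?gt_eqF// mul1r.
Qed.

(** The mean over [C] is the best constant there: in the expansion around it the cross term
    integrates to zero over [C]. *)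
Lemma bexp_var_le C f s : measurable C -> bmeas f -> 0 < e (\1_C) ->
  e (fun x => \1_C x * (f x - e (fun y => \1_C y * f y) / e (\1_C)) ^+ 2) <=
  e (fun x => \1_C x * (f x - s) ^+ 2).
Proof.
move=> mC bf C0; have bC := bmeas_indic R mC.
set t := _ / _.
have -> : (fun x => \1_C x * (f x - s) ^+ 2) =
  (fun x => \1_C x * (f x - t) ^+ 2 +
   ((t - s) * 2 * (\1_C x * f x - t * \1_C x) + (t - s) ^+ 2 * \1_C x)).
  by apply/funext => x; ring.
rewrite bexpD; auto 10 with bmeas; rewrite lerDl.
rewrite bexpD; auto 10 with bmeas.
rewrite !bexpZ; auto 10 with bmeas.
rewrite bexpB; auto 10 with bmeas.
rewrite !bexpZ; auto with bmeas.
rewrite /t divfK ?gt_eqF// subrr mulr0 add0r.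
by rewrite mulr_ge0 ?sqr_ge0// ltW.
Qed.

End bounded_expectation.

(** [a] is nonincreasing and bounded below, so its decrements, which dominate [b], tend to zero. In
    the applications [a] is a squared norm or a surviving mass. *)
Lemma dissipation_small (R : realType) (a b : nat -> R) (eps : R) :
  (forall n, 0 <= a n) -> (forall n, 0 <= b n) ->
  (forall n, a n.+1 + b n <= a n) -> 0 < eps ->
  exists N, forall n, (N <= n)%N -> b n <= eps.
Proof.
move=> a0 b0 ab eps0.
have ca : cvgn a.
  apply: nonincreasing_is_cvgn.
    by apply/nonincreasing_seqP => n; have := ab n; have := b0 n; lra.
  by exists 0 => _ [n _ <-].
have : (fun n => a n - a n.+1) @ \oo --> (0 : R).
  rewrite -(subrr (limn a)); apply: cvgB => //.
  by rewrite (cvg_shiftS a).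
move/cvgrPdist_le => /(_ _ eps0)[N _ hN]; exists N => n Nn.
have := hN n Nn; rewrite sub0r normrN.
move/(le_trans (ler_norm _)); have := ab n; lra.
Qed.

(** * Reversible kernels with local minorizations *)

Section ergodic.
Context d (T : measurableType d) (R : realType) (mu : probability T R).
Implicit Types f g : T -> R.
Local Notation e f := (Rintegral mu setT f).

Definition nnb f := bmeas f /\ forall x, 0 <= f x.

(** A Markov kernel seen through its action on bounded nonnegative functions. [p_sym] is
    reversibility with respect to [mu], and [p_min] bounds one step from [C n] below by a multiple
    of [mu] on [C n], with a constant depending on [n]; the [C n] will be balls. *)
Variable p : (T -> R) -> T -> R.
Hypothesis p_nnb : forall f, nnb f -> nnb (p f).
Hypothesis pD : forall f g x, nnb f -> nnb g -> p (fun y => f y + g y) x = p f x + p g x.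
Hypothesis pZ : forall a f x, 0 <= a -> nnb f -> p (fun y => a * f y) x = a * p f x.
Hypothesis p1 : forall x, p (fun=> 1) x = 1.
Hypothesis p_sym : forall f g, nnb f -> nnb g ->
  e (fun x => p f x * g x) = e (fun x => f x * p g x).
Variable C : nat -> set T.
Hypothesis mC : forall n, measurable (C n).
Hypothesis ndC : forall m n, (m <= n)%N -> C m `<=` C n.
Hypothesis C_cover : forall x, exists n, C n x.
Hypothesis p_min : forall n, exists2 c, 0 < c &
  forall f x, nnb f -> C n x -> c * e (fun y => \1_(C n) y * f y) <= p f x.

Let nnb_bmeas f : nnb f -> bmeas f. Proof. by case. Qed.
Let nnb_cst a : 0 <= a -> nnb (fun=> a). Proof. by split => //; exact: bmeas_cst. Qed.
Let nnb_add f g : nnb f -> nnb g -> nnb (fun x => f x + g x).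
Proof. by move=> [bf f0] [bg g0]; split=> [|x]; auto with bmeas; rewrite addr_ge0. Qed.
Let nnb_mul f g : nnb f -> nnb g -> nnb (fun x => f x * g x).
Proof. by move=> [bf f0] [bg g0]; split=> [|x]; auto with bmeas; rewrite mulr_ge0. Qed.
Let nnb_sqr f : bmeas f -> nnb (fun x => f x ^+ 2).
Proof. by move=> bf; split=> [|x]; auto with bmeas; rewrite sqr_ge0. Qed.
Let nnb_indic A : measurable A -> nnb (\1_A).
Proof. by split => //; exact: bmeas_indic. Qed.
Let nnb_sub f g : nnb f -> nnb g -> (forall x, g x <= f x) -> nnb (fun x => f x - g x).
Proof. by move=> [bf f0] [bg g0] gf; split=> [|x]; auto with bmeas; rewrite subr_ge0. Qed.
Local Hint Resolve nnb_bmeas nnb_cst nnb_add nnb_mul nnb_sqr nnb_indic p_nnb mC ler01 : bmeas.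

Lemma op_le f g x : nnb f -> nnb g -> (forall y, f y <= g y) -> p f x <= p g x.
Proof.
move=> bf bg fg; have bgf := nnb_sub bg bf fg.
have -> : g = (fun y => f y + (g y - f y)) by apply/funext => y; rewrite addrC subrK.
by rewrite pD// lerDl; case: (p_nnb bgf).
Qed.

Lemma op_cst a x : 0 <= a -> p (fun=> a) x = a.
Proof.
move=> a0; rewrite (_ : (fun=> a) = (fun=> a * 1)); last by rewrite mulr1.
by rewrite pZ ?p1 ?mulr1//; exact: nnb_cst.
Qed.

Lemma op_bound f M x : nnb f -> (forall y, f y <= M) -> p f x <= M.
Proof.
move=> bf fM; have M0 : 0 <= M by case: bf => _ /(_ x) /le_trans; apply.
by rewrite -[leRHS](op_cst x M0); apply: op_le => //; exact: nnb_cst.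
Qed.

(** Reversibility tested against the constant 1. *)
Lemma op_invariant f : nnb f -> e (p f) = e f.
Proof.
move=> bf; have := p_sym bf (nnb_cst ler01).
rewrite (_ : (fun x => p f x * 1) = p f); last by apply/funext => x; rewrite mulr1.
rewrite (_ : (fun x => f x * _) = f) //.
by apply/funext => x; rewrite p1 mulr1.
Qed.

Lemma iter_nnb n f : nnb f -> nnb (iter n p f).
Proof. by move=> bf; elim: n => //= n; exact: p_nnb. Qed.

Lemma iter_bound n f M x : nnb f -> (forall y, f y <= M) -> iter n p f x <= M.
Proof.
move=> bf fM; elim: n x => //= n ih x.
by apply: op_bound => //; exact: iter_nnb.
Qed.

Lemma iter_invariant n f : nnb f -> e (iter n p f) = e f.
Proof. by move=> bf; elim: n => //= n <-; rewrite op_invariant//; exact: iter_nnb. Qed.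

Lemma iter_sym n f g : nnb f -> nnb g ->
  e (fun x => iter n p f x * g x) = e (fun x => f x * iter n p g x).
Proof.
elim: n f g => //= n ih f g bf bg.
rewrite p_sym//; last exact: iter_nnb.
by rewrite ih//; [rewrite -iterSr | exact: p_nnb].
Qed.

(* With [s = p f x], the variance of [f] under the step distribution from [x] equals
   [p ((f - s)^2) x]. *)
Lemma op_variance f x : nnb f ->
  p (fun y => f y ^+ 2) x = p f x ^+ 2 + p (fun y => (f y - p f x) ^+ 2) x.
Proof.
move=> bf; set s := p f x.
have s0 : 0 <= s by have [_] := p_nnb bf; exact.
have b1 := nnb_sqr (bmeasB (nnb_bmeas bf) (bmeas_cst _ s)).
have b2 := nnb_sqr (nnb_bmeas bf).
(* [pD] concerns nonnegative functions only, so the cross term stays on the other side: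
   [(f - s)^2 + 2 s f = f^2 + s^2]. *)
have := pD x b1 (nnb_mul (nnb_cst (mulr_ge0 (ler0n R 2) s0)) bf).
rewrite (_ : (fun y => _) = (fun y => f y ^+ 2 + s ^+ 2)); last first.
  by apply/funext => y; ring.
rewrite pD//; last exact/nnb_cst/sqr_ge0.
rewrite op_cst ?sqr_ge0// pZ ?mulr_ge0// -/s.
by move=> h; rewrite -(addrK (s ^+ 2) (p _ _)) h; ring.
Qed.

Let cmu n := e (\1_(C n)).

Lemma cmu_cvg eps : 0 < eps -> exists N, forall n, (N <= n)%N -> 1 - eps <= cmu n.
Proof.
move=> eps0.
have : mu (C n) @[n --> \oo] --> mu (\bigcup_n C n).
  apply: (@nondecreasing_cvg_mu _ _ _ mu) => //; first exact: bigcup_measurable.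
  by move=> m n mn; apply/subsetPset; exact: ndC.
have -> : \bigcup_n C n = setT.
  by apply/seteqP; split => // x _; have [n Cn] := C_cover x; exists n.
rewrite probability_setT => /fine_cvgP[_]; move/cvgrPdist_le => /(_ _ eps0)[N _ hN].
exists N => n /hN /=; rewrite -(bexp_indic mu (mC n)) /= -/(cmu n).
by rewrite ler_norml => /andP[_]; lra.
Qed.

(** By [op_variance] the squared norm of [P^m f] loses in one step the mean of the one-step
    variances. On [C n0] the minorization bounds these below by [c] times the spread [v m] of
    [P^m f] over [C n0], so [v m] tends to zero; the mass outside [C n0] is small by the choice of
    [n0]. *)
Lemma op_ergodic_L1 f eps : nnb f -> 0 < eps ->
  exists N, forall m, (N <= m)%N -> e (fun x => `|iter m p f x - e f|) <= eps.
Proof.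
move=> bf eps0; have [[_ [M hM]] f0] := bf.
have fM x : f x <= M by rewrite (le_trans (ler_norm _)).
(* [bexp_dist_mean_le] produces twice a sum of three terms, each at most [del]. *)
pose del : R := eps / 6; have del0 : 0 < del by rewrite divr_gt0.
pose M' : R := `|M| + 1; have M'0 : 0 < M' by rewrite ltr_wpDl.
have fM' x : f x <= M' by rewrite (le_trans (fM x))// (le_trans (ler_norm _))// lerDl.
have [n0 hn0] : exists n, 0 < cmu n /\ M' * (1 - cmu n) <= del.
  (* The bound [1 / 2] keeps [cmu n0] positive, whatever the size of [del / M']. *)
  have dM0 : 0 < Num.min (del / M') (1 / 2) by rewrite lt_min !divr_gt0.
  have [n /(_ _ (leqnn n)) hn] := cmu_cvg dM0; exists n.
  have : 1 - cmu n <= Num.min (del / M') (1 / 2) by lra.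
  rewrite le_min ler_pdivlMr// mulrC => /andP[-> h]; split => //; lra.
have [cn0 hMC] := hn0.
have [c c0 hc] := p_min n0.
pose fm m := iter m p f.
have bfm m : nnb (fm m) := iter_nnb m bf.
pose t m := e (fun y => \1_(C n0) y * fm m y) / cmu n0.
pose v m := e (fun x => \1_(C n0) x * (fm m x - t m) ^+ 2).
have bC := bmeas_indic R (mC n0).
have v0 m : 0 <= v m.
  by apply: bexp_ge0 => x; rewrite mulr_ge0 ?sqr_ge0.
have [N hN] : exists N, forall m, (N <= m)%N -> c * cmu n0 * v m <= c * cmu n0 * del ^+ 2.
  apply: (@dissipation_small _ (fun m => e (fun x => fm m x ^+ 2))) => [m|m|m|].
  - by apply: bexp_ge0 => x; rewrite sqr_ge0.
  - by rewrite !mulr_ge0// ltW.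
  - have b2 := nnb_sqr (nnb_bmeas (bfm m)).
    rewrite -(op_invariant b2) mulrAC -[X in _ + X]bexpZ; auto with bmeas.
    have bS := nnb_sqr (nnb_bmeas (bfm m.+1)).
    rewrite -bexpD; auto with bmeas.
    apply: bexp_le; [by auto with bmeas..|] => x.
    rewrite [leRHS]op_variance//= lerD2l indicE.
    have bxs := nnb_sqr (bmeasB (nnb_bmeas (bfm m)) (bmeas_cst _ (p (fm m) x))).
    have [/set_mem Cx|_] := boolP (x \in C n0); last first.
      by rewrite mulr0; case: (p_nnb bxs).
    rewrite mulr1; apply: le_trans (hc _ _ bxs Cx).
    (* The one-step variance is centred at [p (fm m) x], which depends on [x]; centring at the mean
       [t m] instead only decreases the integral over [C n0]. *)
    by rewrite ler_pM2l//; apply: bexp_var_le; auto with bmeas.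
  - by rewrite !mulr_gt0.
exists N => m /hN; rewrite ler_pM2l ?mulr_gt0// => vm.
have -> : e f = e (fm m) by rewrite iter_invariant.
have fmM x : fm m x <= M' by exact: iter_bound.
have tM : 0 <= t m <= M'.
  rewrite divr_ge0 ?(ltW cn0)//=; last first.
    apply: bexp_ge0 => x; rewrite mulr_ge0//; by case: (bfm m).
  rewrite ler_pdivrMr// -bexpZ//; apply: bexp_le; auto with bmeas => x.
  by rewrite mulrC ler_wpM2r.
have fm0 x : 0 <= fm m x <= M' by rewrite fmM andbT; case: (bfm m).
apply: (le_trans (bexp_dist_mean_le mu (mC n0) (nnb_bmeas (bfm m)) fm0 tM del0)).
rewrite -/(cmu n0) -/(v m).
have : v m / del <= del by rewrite ler_pdivrMr// -expr2.
by rewrite /del in hMC *; lra.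
Qed.

(** One minorized step from [x] dominates [c] times the integral of [P^m 1_A] over [C n], which is
    close to [e (\1_A) * cmu n] by convergence in [L^1]. The extra step makes the bound valid at
    every point. *)
Lemma op_recurrent A x : measurable A -> 0 < e (\1_A) ->
  exists2 delta, 0 < delta &
    exists N, forall m, (N <= m)%N -> delta <= iter m.+1 p \1_A x.
Proof.
move=> mA A0.
have [n [Cx cn0]] : exists n, C n x /\ 0 < cmu n.
  have [n1 Cx] := C_cover x.
  have [n2 hn2] := @cmu_cvg (1 / 2) (divr_gt0 ltr01 (ltr0n R 2)).
  exists (maxn n1 n2); split; first exact: (ndC (leq_maxl n1 n2)).
  by have := hn2 _ (leq_maxr n1 n2); lra.
have [c c0 hc] := p_min n.
pose eps := cmu n * e (\1_A) / 2.
have eps0 : 0 < eps by rewrite divr_gt0// mulr_gt0.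
exists (c * eps); first exact: mulr_gt0.
have bA : nnb (\1_A : T -> R) := nnb_indic mA.
have [N hN] := op_ergodic_L1 bA eps0.
exists N => m /hN h /=.
have bAm := iter_nnb m bA.
apply: le_trans (hc _ _ bAm Cx); rewrite ler_pM2l//.
have bC := bmeas_indic R (mC n).
apply: (@le_trans _ _ (e (fun y => e (\1_A) * \1_(C n) y - `|iter m p \1_A y - e (\1_A)|))).
  rewrite bexpB; auto 10 with bmeas.
  by rewrite bexpZ// -/(cmu n); rewrite /eps in h *; lra.
apply: bexp_le; [by auto 10 with bmeas..|] => y.
have [h1 h2] : 0 <= iter m p \1_A y /\ 0 <= (\1_(C n) y : R) <= 1.
  by split; [case: bAm|rewrite indic_ge0 indic_le1].
have := ler_norm (e (\1_A) - iter m p \1_A y); rewrite distrC.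
rewrite indicE; case: (y \in C n) => h3; first by rewrite mulr1 mul1r; lra.
by rewrite mulr0 mul0r; have := normr_ge0 (iter m p \1_A y - e (\1_A)); lra.
Qed.

(** As soon as [mu (C n) > 1 - mu A], the set [C n] meets [A] in positive mass. Positivity after
    exactly one step is what excludes cycles later. *)
Lemma op_positive A x : measurable A -> 0 < e (\1_A) -> 0 < p \1_A x.
Proof.
move=> mA A0; have [n1 Cx] := C_cover x.
have [n2 hn2] := cmu_cvg (divr_gt0 A0 (ltr0n R 2)).
pose n := maxn n1 n2; have [c c0 hc] := p_min n.
apply: lt_le_trans (hc _ _ (nnb_indic mA) (ndC (leq_maxl n1 n2) Cx)).
rewrite mulr_gt0//; have bA := bmeas_indic R mA; have bC := bmeas_indic R (mC n).
(* Inclusion-exclusion: [1_A + 1_C - 1 <= 1_C 1_A]. *)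
apply: (@lt_le_trans _ _ (e (fun y => (\1_A y + \1_(C n) y) - 1))).
  rewrite bexpB; auto with bmeas; rewrite bexpD; auto with bmeas.
  by rewrite bexp_cst -/(cmu n); have := hn2 _ (leq_maxr n1 n2); lra.
apply: bexp_le; [by auto 10 with bmeas..|] => y.
by rewrite !indicE; case: (y \in A); case: (y \in C n); rewrite /= ?mulr1 ?mulr0; lra.
Qed.

(** * Regeneration on one minorizing set *)

Section regeneration.
Variables (n0 : nat) (c : R).
Hypothesis (c0 : 0 < c) (cmu0 : 0 < cmu n0).
Hypothesis c_min : forall f x, nnb f -> C n0 x ->
  c * e (fun y => \1_(C n0) y * f y) <= p f x.

Let w : T -> R := \1_(C n0).
(** The regeneration measure, left unnormalised: its mass is [cmu n0], whence the divisions by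
    [cmu n0] below. *)
Let nu f := e (fun y => w y * f y).
Let bw : nnb w := nnb_indic (mC n0).

(* The step of the chain killed at its regenerations, which happen on [C n0]. *)
Definition killed f x := p f x - c * w x * nu f.

Let nu_ge0 f : nnb f -> 0 <= nu f.
Proof. by move=> [bf f0]; apply: bexp_ge0 => x; rewrite mulr_ge0// indic_ge0. Qed.

Lemma killed_nnb f : nnb f -> nnb (killed f).
Proof.
move=> bf; split=> [|x]; first by rewrite /killed; auto 10 with bmeas.
rewrite /killed /w indicE subr_ge0; have [/set_mem Cx|_] := boolP (x \in C n0).
  by rewrite mulr1; exact: c_min.
by rewrite mulr0 mul0r; case: (p_nnb bf).
Qed.

Lemma killedD f g x : nnb f -> nnb g ->
  killed (fun y => f y + g y) x = killed f x + killed g x.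
Proof.
move=> bf bg; rewrite /killed pD// /nu.
under eq_Rintegral do rewrite mulrDr.
by rewrite bexpD; auto with bmeas; ring.
Qed.

Lemma killedZ a f x : 0 <= a -> nnb f -> killed (fun y => a * f y) x = a * killed f x.
Proof.
move=> a0 bf; rewrite /killed pZ// /nu.
under eq_Rintegral do rewrite mulrCA.
by rewrite bexpZ; auto with bmeas; ring.
Qed.

Lemma iter_killed_nnb n f : nnb f -> nnb (iter n killed f).
Proof. by move=> bf; elim: n => //= n; exact: killed_nnb. Qed.

Lemma iter_killedD n f g x : nnb f -> nnb g ->
  iter n killed (fun y => f y + g y) x = iter n killed f x + iter n killed g x.
Proof.
move=> bf bg; elim: n x => //= n ih x.
rewrite -killedD; [|exact: iter_killed_nnb..].
by congr killed; apply/funext.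
Qed.

Lemma iter_killedZ n a f x : 0 <= a -> nnb f ->
  iter n killed (fun y => a * f y) x = a * iter n killed f x.
Proof.
move=> a0 bf; elim: n x => //= n ih x.
rewrite -killedZ//; last exact: iter_killed_nnb.
by congr killed; apply/funext.
Qed.

Lemma iter_killed_le n f g x : nnb f -> nnb g -> (forall y, f y <= g y) ->
  iter n killed f x <= iter n killed g x.
Proof.
move=> bf bg fg; have bgf := nnb_sub bg bf fg.
have -> : g = (fun y => f y + (g y - f y)) by apply/funext => y; rewrite addrC subrK.
rewrite iter_killedD// lerDl.
by have [_] := iter_killed_nnb n bgf; exact.
Qed.

(** Decomposition at the first regeneration, at step [k + 1]: survive [k] steps, be in [C n0],
    regenerate, then run freely from [nu] for the [n - 1 - k] remaining steps. The induction
    replaces [p f] by [killed f + c * nu f * w], whose second part gives the new term [k = n]. *)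
Lemma renewal n f x : nnb f ->
  iter n p f x = iter n killed f x +
    \sum_(k < n) c * iter k killed w x * nu (iter (n.-1 - k) p f).
Proof.
elim: n f => [|n ih] f bf; first by rewrite big_ord0 addr0.
rewrite iterSr ih; last exact: p_nnb.
have -> : p f = (fun y => killed f y + c * nu f * w y).
  by apply/funext => y; rewrite /killed; ring.
have cnu : 0 <= c * nu f by rewrite mulr_ge0 ?nu_ge0// ltW.
rewrite iter_killedD; [|exact: killed_nnb|exact: nnb_mul (nnb_cst cnu) bw].
rewrite iter_killedZ// -iterSr -addrA; congr (_ + _).
rewrite big_ord_recr /= subnn addrC mulrAC; congr (_ + _).
apply: eq_bigr => k _; congr (_ * nu _).
have -> : (fun y => killed f y + c * nu f * w y) = p f.
  by apply/funext => y; rewrite /killed; ring.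
by rewrite -iterSr (_ : (n.-1 - k).+1 = (n - k)%N)//; case: k => k /= kn; lia.
Qed.

(** The probability of [n] steps without regeneration. *)
Definition survival n := iter n killed (fun=> 1).

Lemma survival_nnb n : nnb (survival n).
Proof. exact/iter_killed_nnb/nnb_cst. Qed.

Lemma survivalS n x : survival n.+1 x = p (survival n) x - c * w x * nu (survival n).
Proof. by []. Qed.

Lemma survival_le m n x : (m <= n)%N -> survival n x <= survival m x.
Proof.
move=> /subnK <-; elim: (n - m)%N => // k /(le_trans _); apply.
rewrite addSn /survival iterSr; apply: iter_killed_le.
- exact/killed_nnb/nnb_cst.
- exact: nnb_cst.
- move=> y; rewrite /killed p1 gerBl mulr_ge0 ?nu_ge0//; last exact: nnb_cst.
  by rewrite mulr_ge0 ?indic_ge0// ltW.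
Qed.

(** The renewal identity for the constant 1: the possible times of first regeneration have total
    probability [1 - survival n x]. *)
Lemma survival_renewal n x :
  \sum_(k < n) c * iter k killed w x = (1 - survival n x) / cmu n0.
Proof.
have := renewal n x (nnb_cst ler01).
have it1 k : iter k p (fun=> 1) = (fun=> 1).
  by elim: k => //= k ->; apply/funext => y; rewrite p1.
rewrite it1 -/(survival n x).
have -> : \sum_(k < n) c * iter k killed w x * nu (iter (n.-1 - k) p (fun=> 1)) =
   (\sum_(k < n) c * iter k killed w x) * cmu n0.
  rewrite mulr_suml; apply: eq_bigr => k _; congr (_ * _).
  by rewrite it1 /nu /cmu; congr Rintegral; apply/funext => y; rewrite mulr1.
move=> h; apply: (mulIf (lt0r_neq0 cmu0)); rewrite divfK ?gt_eqF//.
by rewrite h addrC addKr.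
Qed.

(** One step lowers the mean of [survival n] by exactly [c * cmu n0 * nu (survival n)], so
    [nu (survival n)] tends to zero. Reversibility turns the weight [p w] into a step applied to the
    survival function, and on [C n0] this step is expressed by [survival n.+1] and
    [nu (survival n)]. *)
Lemma survival_mass_small eps : 0 < eps ->
  exists n, e (fun x => p w x * survival n x) <= eps.
Proof.
(* The final expression is [nu (survival N.+1) + c * cmu n0 * nu (survival N)], with both values of
   [nu] at most [del]. *)
move=> eps0; pose del := eps / (1 + c * cmu n0) .
have cc0 : 0 < c * cmu n0 by rewrite mulr_gt0.
have del0 : 0 < del by rewrite divr_gt0// addr_gt0.
have [N hN] : exists N, forall n, (N <= n)%N ->
    c * cmu n0 * nu (survival n) <= c * cmu n0 * del.
  apply: (@dissipation_small _ (fun n => e (survival n))) => [n|n|n|].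
  - by apply: bexp_ge0; case: (survival_nnb n).
  - by rewrite !mulr_ge0 ?(ltW c0) ?(ltW cmu0)// nu_ge0//; exact: survival_nnb.
  - rewrite -(op_invariant (survival_nnb n)).
    have bS := survival_nnb n.
    have -> : e (survival n.+1) = e (fun x => p (survival n) x - c * nu (survival n) * w x).
      by congr Rintegral; apply/funext => x; rewrite survivalS; ring.
    rewrite bexpB; auto with bmeas; rewrite bexpZ; auto with bmeas.
    by rewrite -/(cmu n0); lra.
  - exact: mulr_gt0.
exists N; rewrite p_sym//; last exact: survival_nnb.
have bS := survival_nnb N; have bS1 := survival_nnb N.+1.
have -> : (fun x => w x * p (survival N) x) =
  (fun x => w x * survival N.+1 x + c * nu (survival N) * w x).
  apply/funext => x; rewrite survivalS.
  have : w x * w x = w x by rewrite /w indicE -natrM mulnb andbb.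
  by move=> ww; rewrite mulrBr (_ : w x * (c * w x * _) = c * (w x * w x) * nu (survival N));
    [rewrite ww; ring|ring].
rewrite bexpD; auto 10 with bmeas; rewrite bexpZ; auto with bmeas.
have := hN _ (leqnSn N); have := hN _ (leqnn N); rewrite !ler_pM2l// => h1 h2.
have : (1 + c * cmu n0) * del = eps by rewrite /del mulrC divfK// gt_eqF// addr_gt0.
rewrite -/(nu _) -/(cmu n0); nra.
Qed.

(** The weight of [survival_mass_small] is positive at every point, because some [C n] contains both
    [x] and [C n0]. *)
Lemma op_indicator_gt0 x : 0 < p w x.
Proof.
have [n1 Cx] := C_cover x; pose n := maxn n0 n1.
have [c' c'0 hc'] := p_min n.
apply: lt_le_trans (hc' _ _ bw (ndC (leq_maxr n0 n1) Cx)).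
rewrite mulr_gt0// (_ : e _ = cmu n0)//; congr Rintegral; apply/funext => y.
rewrite /w !indicE; have [/set_mem Cy|_] := boolP (y \in C n0); last by rewrite mulr0.
by rewrite (mem_set (ndC (leq_maxl n0 n1) Cy)) mulr1.
Qed.

(** The decreasing limit [G] of [survival] has integral zero against the positive weight [p w],
    hence vanishes outside a null set. *)
Lemma survival_cvg0 : exists N, [/\ measurable N, mu N = 0%E &
  forall x eps, ~ N x -> 0 < eps -> exists n, survival n x <= eps].
Proof.
pose G x := limn (fun n => survival n x).
have cG x : (fun n => survival n x) @ \oo --> G x.
  apply: nonincreasing_is_cvgn; first by move=> m n; exact: survival_le.
  by exists 0 => _ [n _ <-]; case: (survival_nnb n).
have G0 x : 0 <= G x.
  by apply: limr_ge; [exact: cG|apply: nearW => n; case: (survival_nnb n)].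
have Gle n x : G x <= survival n x.
  apply: limr_le; first exact: cG.
  by exists n => // m /= nm; exact: survival_le.
have bG : bmeas G.
  split; first apply: (@measurable_fun_cvg _ _ _ setT (fun n x => survival n x)) => //.
    by move=> n; case: (survival_nnb n) => -[].
  by exists 1 => x; rewrite ger0_norm// (le_trans (Gle 0%N x)).
have bpG : bmeas (fun x => p w x * G x) by auto with bmeas.
have pG0 x : 0 <= p w x * G x by rewrite mulr_ge0// ltW// op_indicator_gt0.
have : e (fun x => p w x * G x) = 0.
  apply/eqP; rewrite eq_le bexp_ge0// andbT.
  apply/ler_addgt0Pl => eps /survival_mass_small[n hn]; rewrite addr0.
  apply: le_trans hn; have bS := survival_nnb n; apply: bexp_le; auto with bmeas.
  by move=> x; rewrite ler_wpM2l// ltW// op_indicator_gt0.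
move=> /(bexp_eq0 bpG pG0)[N [mN N0 hN]].
exists N; split => // x eps Nx eps0.
have [pGx|pGx] := pselect (p w x * G x = 0); last first.
  by exfalso; apply: Nx; exact: hN.
have Gx : G x = 0.
  by move/eqP: pGx; rewrite mulf_eq0 gt_eqF ?op_indicator_gt0//= => /eqP.
have := cG x; rewrite Gx => /cvgrPdist_le /(_ _ eps0)[n _ /(_ _ (leqnn n))].
rewrite sub0r normrN => hn; exists n; exact: le_trans (ler_norm _) hn.
Qed.

(** The renewal formula for [\1_A] is compared with the one for the constant 1, scaled by
    [e (\1_A)]. Symmetry turns [nu (P^j 1_A)] into the integral of [P^j w] over [A], so that the
    bound does not involve [A]. *)
Lemma dist_to_stationary_le A n x : measurable A ->
  `|iter n p \1_A x - e (\1_A)| <= survival n x +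
   \sum_(k < n) c * iter k killed w x * e (fun y => `|iter (n.-1 - k) p w y - e w|).
Proof.
move=> mA; have bA : nnb (\1_A : T -> R) := nnb_indic mA.
rewrite (renewal n x bA).
(* The weights of the renewal formula, multiplied by [cmu n0], sum to 1 together with
   [survival n x]. *)
have eA : e (\1_A) = survival n x * e (\1_A) +
   \sum_(k < n) c * iter k killed w x * (cmu n0 * e (\1_A)).
  rewrite -mulr_suml survival_renewal mulrA divfK ?gt_eqF//; ring.
rewrite [X in _ - X]eA opprD addrACA -sumrB.
have a0 k : 0 <= c * iter k killed w x.
  by rewrite mulr_ge0 ?(ltW c0)//; case: (iter_killed_nnb k bw).
apply: (le_trans (ler_normD _ _)); apply: lerD.
  have [_ /(_ x) h0] := iter_killed_nnb n bA.
  have h1 : iter n killed \1_A x <= survival n x.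
    by apply: iter_killed_le => //; exact: nnb_cst.
  have h2 : 0 <= survival n x by case: (survival_nnb n).
  have h3 : 0 <= e (\1_A) by apply: bexp_ge0 => y; exact: indic_ge0.
  have h4 : e (\1_A) <= 1.
    by rewrite -[leRHS](bexp_cst mu 1); apply: bexp_le; auto with bmeas.
  have h5 : 0 <= survival n x * e (\1_A) <= survival n x by rewrite mulr_ge0//= ler_piMr.
  by rewrite ler_norml; apply/andP; split; lra.
apply: (le_trans (ler_norm_sum _ _ _)); apply: ler_sum => k _.
rewrite -mulrBr normrM (ger0_norm (a0 k)) ler_wpM2l//.
set j := (n.-1 - k)%N; have bj := iter_nnb j bw.
rewrite /nu -(iter_sym j bw bA) -bexpZ; auto with bmeas.
rewrite -bexpB; auto with bmeas.
apply: (le_trans (bexp_norm mu _)); first by auto with bmeas.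
apply: bexp_le; [by auto 10 with bmeas..|] => y.
rewrite -mulrBl normrM [X in _ * X]ger0_norm ?indic_ge0//.
by rewrite ler_piMr//.
Qed.

(** The renewal sum is cut at [n' = n - J]. For [k < n'] at least [J] steps remain and the [L^1]
    distance is small; the weights with [k >= n'] add up to a difference of survival probabilities
    at times at least [m], divided by [cmu n0]. *)
Lemma regeneration_ergodic_TV : exists N, [/\ measurable N, mu N = 0%E &
  forall x eps, ~ N x -> 0 < eps -> exists n1, forall n A, (n1 <= n)%N ->
    measurable A -> `|iter n p \1_A x - e (\1_A)| <= eps].
Proof.
have [N [mN N0 hN]] := survival_cvg0; exists N; split => // x eps Nx eps0.
(* [del] must still be at most [eps / 3] after division by [cmu n0]. *)
pose del := Num.min (eps / 3) (eps / 3 * cmu n0).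
have eps30 : 0 < eps / 3 by rewrite divr_gt0.
have del0 : 0 < del by rewrite lt_min eps30 mulr_gt0.
have [J hJ] := op_ergodic_L1 bw del0.
have [m hm] := hN x del Nx del0.
have a0 k : 0 <= c * iter k killed w x.
  by rewrite mulr_ge0 ?(ltW c0)//; case: (iter_killed_nnb k bw).
have w1 k y : iter k p w y <= 1 by apply: iter_bound => // z; exact: indic_le1.
exists (m + J)%N => n A mn mA.
apply: (le_trans (dist_to_stationary_le n x mA)).
have hS k : (m <= k)%N -> survival k x <= del.
  by move=> /survival_le /le_trans; apply.
have hs1 : survival n x <= eps / 3.
  by apply: (le_trans (hS _ _)); [lia|rewrite ge_min lexx].
pose D j := e (fun y => `|iter j p w y - e w|).
have D1 j : D j <= 1.
  have bj := iter_nnb j bw.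
  rewrite -[leRHS](bexp_cst mu 1); apply: bexp_le; auto with bmeas => y.
  have h0 : 0 <= iter j p w y by case: bj.
  have h1 : 0 <= e w by apply: bexp_ge0; case: bw.
  have h2 : e w <= 1.
    rewrite -[leRHS](bexp_cst mu 1); apply: bexp_le; auto with bmeas.
    by move=> z; exact: indic_le1.
  by have := w1 j y; rewrite ler_norml => h3; apply/andP; split; lra.
have -> : eps = eps / 3 + (eps / 3 + eps / 3) by field.
apply: lerD => //.
pose n' := (n - J)%N.
have n'n : (n' <= n)%N by rewrite leq_subr.
have splitsum (F : nat -> R) : \sum_(k < n) F k = \sum_(k < n') F k + \sum_(n' <= k < n) F k.
  by rewrite -!(big_mkord xpredT) (@big_cat_nat _ _ _ n').
rewrite (splitsum (fun k => c * iter k killed w x * D (n.-1 - k)%N)); apply: lerD.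
  apply: (@le_trans _ _ (\sum_(k < n') c * iter k killed w x * del)).
    apply: ler_sum => k _; rewrite ler_wpM2l//; apply: hJ.
    by have := ltn_ord k; rewrite /n'; lia.
  rewrite -mulr_suml survival_renewal mulrAC ler_pdivrMr//.
  apply: (@le_trans _ _ del); last by rewrite ge_min lexx orbT.
  rewrite ler_piMl ?(ltW del0)// gerBl; by case: (survival_nnb n').
apply: (@le_trans _ _ (\sum_(n' <= k < n) c * iter k killed w x)).
  by apply: ler_sum => k _; rewrite ler_piMr.
have -> : \sum_(n' <= k < n) c * iter k killed w x =
    (1 - survival n x) / cmu n0 - (1 - survival n' x) / cmu n0.
  by rewrite -!survival_renewal (splitsum (fun k => c * iter k killed w x)) addrC addKr.
rewrite -mulrBl ler_pdivrMr//.
have : survival n' x <= eps / 3 * cmu n0.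
  by apply: (le_trans (hS _ _)); [rewrite /n'; lia|rewrite ge_min lexx orbT].
have : 0 <= survival n x by case: (survival_nnb n).
lra.
Qed.

End regeneration.

Theorem op_ergodic_TV : exists N, [/\ measurable N, mu N = 0%E &
  forall x eps, ~ N x -> 0 < eps -> exists n1, forall n A, (n1 <= n)%N ->
    measurable A -> `|iter n p \1_A x - e (\1_A)| <= eps].
Proof.
have [n /(_ _ (leqnn n)) hn] := @cmu_cvg (1 / 2) (divr_gt0 ltr01 (ltr0n R 2)).
have [c c0 hc] := p_min n.
by apply: (regeneration_ergodic_TV c0 _ hc); lra.
Qed.

End ergodic.

(** * Lebesgue measure on row vectors *)

Section integral_functional.
Local Open Scope ereal_scope.
Context d (T : measurableType d) (R : realType) (m : {measure set T -> \bar R}).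
Variable J : (T -> \bar R) -> \bar R.
Let nnm (f : T -> \bar R) := measurable_fun setT f /\ forall x, 0 <= f x.
Hypothesis J0 : J (cst 0) = 0.
Hypothesis JD : forall f g, nnm f -> nnm g -> J (fun x => f x + g x) = J f + J g.
Hypothesis JZ : forall (a : R) f, (0 <= a)%R -> nnm f -> J (fun x => a%:E * f x) = a%:E * J f.
Hypothesis Jlim : forall g : (T -> \bar R)^nat, (forall n, nnm (g n)) ->
  (forall x, nondecreasing_seq (g ^~ x)) ->
  J (fun x => limn (g ^~ x)) = limn (fun n => J (g n)).
Hypothesis J_indic : forall A, measurable A -> J (fun x => (\1_A x)%:E) = m A.

Let J_sum (I : choiceType) (s : seq I) (F : I -> T -> \bar R) : (forall i, nnm (F i)) ->
  J (fun x => \sum_(i <- s) F i x) = \sum_(i <- s) J (F i).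
Proof.
move=> hF; elim: s => [|i s ih].
  by rewrite big_nil -J0; congr J; apply/funext => x; rewrite big_nil.
rewrite big_cons -ih -JD//.
  by congr J; apply/funext => x; rewrite big_cons.
split=> [|x]; first by apply: emeasurable_sum => j; case: (hF j).
by apply: sume_ge0 => j _; case: (hF j).
Qed.

Import HBNNSimple.

(** Additivity, homogeneity and monotone continuity determine [J] from its values on indicators,
    through simple functions and increasing limits. This identifies iterated integrals, integrals
    against a density and integrals against image measures. *)
Lemma integral_functional f : measurable_fun setT f -> (forall x, 0 <= f x) ->
  \int[m]_x f x = J f.
Proof.
move=> mf f0; pose g := nnsfun_approx measurableT mf.
have ndg x : nondecreasing_seq (fun n => (g n x)%:E).
  by move=> p q pq; rewrite lee_fin; exact/lefP/nd_nnsfun_approx.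
have nng n : nnm (EFin \o g n).
  by split=> [|x]; [exact/measurable_EFinP|rewrite lee_fin].
have limg x : limn (fun n => (g n x)%:E) = f x.
  by apply/cvg_lim => //; exact: cvg_nnsfun_approx.
transitivity (\int[m]_x limn (fun n => (EFin \o g n) x)).
  by apply: eq_integral => x _; rewrite /= limg.
rewrite monotone_convergence//; [|by move=> n; have [] := nng n
  |by move=> n x _; rewrite lee_fin|by move=> x _ p q; exact: ndg].
transitivity (limn (fun n => J (EFin \o g n))); last first.
  by rewrite -Jlim//; congr J; apply/funext.
congr (limn _); apply/funext => n.
pose F (r : R) (x : T) := r%:E * (\1_(g n @^-1` [set r]) x)%:E.
have mFr r : measurable_fun setT (fun x => (\1_(g n @^-1` [set r]) x : R)%:E).
  by apply/measurable_EFinP; exact: measurable_indic.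
have gE x : (EFin \o g n) x = \sum_(r <- finmap.enum_fset (fset_set (range (g n)))) F r x.
  by rewrite /= fimfunE -fsumEFin// fsbig_finite.
have F0 r x : 0 <= F r x.
  by rewrite /F -EFinM nnfun_muleindic_ge0.
have mF r : measurable_fun setT (F r).
  by apply: emeasurable_funM => //; exact: measurable_cst.
transitivity (\int[m]_x \sum_(r <- finmap.enum_fset (fset_set (range (g n)))) F r x).
  by apply: eq_integral => x _; rewrite gE.
rewrite ge0_integral_sum//.
rewrite (_ : EFin \o g n = fun x =>
  \sum_(r <- finmap.enum_fset (fset_set (range (g n)))) F r x); last exact/funext.
rewrite J_sum; last by [].
apply: eq_big_seq => r; rewrite in_fset_set// => /set_mem[x _ xr].
have r0 : (0 <= r)%R by rewrite -xr.
rewrite /F JZ//.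
have mgr : measurable (g n @^-1` [set r]) by [].
rewrite J_indic// ge0_integralZl_EFin//.
by rewrite integral_indic// setIT.
Qed.

End integral_functional.

(** * Iterated integrals over finitely many coordinates *)

Section iterated_integral.
Local Open Scope ereal_scope.
Context (R : realType).
Implicit Types (F G : (nat -> R) -> \bar R) (x : nat -> R).

(* Joint measurability in the coordinates, tested along measurable families of points. *)
Definition cmeas F := forall d (S : measurableType d) (phi : S -> nat -> R),
  (forall i, measurable_fun setT (fun s => phi s i)) ->
  measurable_fun setT (fun s => F (phi s)).

Definition upd x k (t : R) : nat -> R := fun j => if j == k then t else x j.

Lemma lintS k F x :
  lint k.+1 F x = \int[lebesgue_measure]_t lint k F (upd x k t).
Proof. by []. Qed.

Lemma lint_ge0 k F x : (forall y, 0 <= F y) -> 0 <= lint k F x.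
Proof. by move=> F0; elim: k x => //= k ih x; apply: integral_ge0 => t _. Qed.

(** Each integration enlarges the parameter space to [S * R], and Tonelli gives back measurability
    in [S]; this is why [cmeas] ranges over all parameter spaces. *)
Lemma lint_cmeas k F : cmeas F -> (forall x, 0 <= F x) -> cmeas (lint k F).
Proof.
move=> mF F0; elim: k => //= k ih d S phi mphi.
pose H (z : S * measurableTypeR R) := lint k F (upd (phi z.1) k z.2).
have mH : measurable_fun setT H.
  apply: (ih _ _ (fun z : S * measurableTypeR R => upd (phi z.1) k z.2)) => i.
  rewrite /upd; case: (i == k); first exact: measurable_snd.
  exact: measurableT_comp (mphi i) measurable_fst.
apply: (measurable_fun_fubini_tonelli_F (m2 := lebesgue_measure) H mH) => z.
exact: lint_ge0.
Qed.

Lemma cmeas_upd F x k : cmeas F -> measurable_fun setT (fun t : measurableTypeR R => F (upd x k t)).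
Proof.
move=> mF; apply: (mF _ _ (fun t : measurableTypeR R => upd x k t)) => i.
by rewrite /upd; case: (i == k); [exact: measurable_id|exact: measurable_cst].
Qed.

Lemma lint_eq k F G x : (forall y, F y = G y) -> lint k F x = lint k G x.
Proof. by move=> FG; congr lint; exact/funext. Qed.

Lemma lint_cst0 k x : lint k (cst 0) x = 0 :> \bar R.
Proof.
elim: k x => //= k ih x; rewrite (eq_integral (cst 0)) ?integral0// => t _.
exact: ih.
Qed.

Lemma lintD k F G x : cmeas F -> cmeas G -> (forall y, 0 <= F y) -> (forall y, 0 <= G y) ->
  lint k (fun y => F y + G y) x = lint k F x + lint k G x.
Proof.
move=> mF mG F0 G0; elim: k x => //= k ih x.
rewrite -ge0_integralD//.
- by apply: eq_integral => t _; exact: ih.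
- by move=> t _; exact: lint_ge0.
- by apply: cmeas_upd; exact: lint_cmeas.
- by move=> t _; exact: lint_ge0.
- by apply: cmeas_upd; exact: lint_cmeas.
Qed.

Lemma lintZ k (a : R) F x : (0 <= a)%R -> cmeas F -> (forall y, 0 <= F y) ->
  lint k (fun y => a%:E * F y) x = a%:E * lint k F x.
Proof.
move=> a0 mF F0; elim: k x => //= k ih x.
rewrite -ge0_integralZl_EFin//.
- by apply: eq_integral => t _; exact: ih.
- by move=> t _; exact: lint_ge0.
- by apply: cmeas_upd; exact: lint_cmeas.
Qed.

Lemma lint_le k F G x : cmeas F -> cmeas G -> (forall y, 0 <= F y) -> (forall y, F y <= G y) ->
  lint k F x <= lint k G x.
Proof.
move=> mF mG F0 FG; have G0 y : 0 <= G y by exact: le_trans (FG y).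
elim: k x => //= k ih x; apply: ge0_le_integral => //.
- by move=> t _; exact: lint_ge0.
- by apply: cmeas_upd; exact: lint_cmeas.
- by apply: cmeas_upd; exact: lint_cmeas.
Qed.

Lemma lint_lim k (F : nat -> (nat -> R) -> \bar R) x : (forall n, cmeas (F n)) ->
  (forall n y, 0 <= F n y) -> (forall y, nondecreasing_seq (F ^~ y)) ->
  lint k (fun y => limn (F ^~ y)) x = limn (fun n => lint k (F n) x).
Proof.
move=> mF F0 ndF; elim: k x => //= k ih x.
rewrite -monotone_convergence//.
- by apply: eq_integral => t _; exact: ih.
- by move=> n; apply: cmeas_upd; exact: lint_cmeas.
- by move=> n t _; exact: lint_ge0.
- by move=> t _ p q pq; apply: lint_le => // y; exact: ndF.
Qed.

End iterated_integral.

(** * Translations and reflection of the line *)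

Section lebesgue_1d.
Local Open Scope ereal_scope.
Context (R : realType).
Local Notation leb := (@lebesgue_measure R).

Lemma measurable_shift (a : R) :
  measurable_fun setT (fun t : measurableTypeR R => (t + a)%R : measurableTypeR R).
Proof. by apply: measurable_funD; [exact: measurable_id|exact: measurable_cst]. Qed.

Lemma lebesgue_measure_shift (a : R) (A : set R) : measurable A ->
  pushforward leb (fun t : measurableTypeR R => (t + a)%R : measurableTypeR R) A = leb A.
Proof.
move=> mA; apply/esym/lebesgue_measure_unique => //=; first exact: measurable_shift.
move=> _ _ [[x y]] _ <-.
rewrite /pushforward.
have -> : (fun t : R => t + a)%R @^-1` `]x, y]%classic = `](x - a)%R, (y - a)%R]%classic.
  by apply/seteqP; split => t /=; rewrite !in_itv/= ltrBlDr lerBrDr.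
rewrite !lebesgue_measure_itv/= !lte_fin ltrD2r.
by case: ifP => // _; rewrite -!EFinB; congr EFin; ring.
Qed.

Lemma ge0_integral_shift (a : R) (f : R -> \bar R) : measurable_fun setT f ->
  (forall t, 0 <= f t) -> \int[leb]_t f (t + a)%R = \int[leb]_t f t.
Proof.
move=> mf f0.
rewrite -[LHS](ge0_integral_pushforward
  (phi := fun t : measurableTypeR R => (t + a)%R : measurableTypeR R) (measurable_shift a) leb
  (D := setT) (f := f))//.
apply: eq_measure_integral => [|mh A mA _]; [exact: measurable_shift|exact: lebesgue_measure_shift].
Qed.

Lemma ge0_integral_oppr (f : R -> \bar R) : measurable_fun setT f ->
  (forall t, 0 <= f t) -> \int[leb]_t f (- t)%R = \int[leb]_t f t.
Proof.
move=> mf f0.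
have mN : measurable_fun setT (fun t : measurableTypeR R => (- t)%R : measurableTypeR R).
  exact: oppr_measurable.
rewrite -[LHS](ge0_integral_pushforward
  (phi := fun t : measurableTypeR R => (- t)%R : measurableTypeR R) mN leb (D := setT) (f := f))//.
by apply: eq_measure_integral => A mA _; exact: lebesgue_measureN.
Qed.

End lebesgue_1d.

Section borel_rV.
Context (R : realType) (d : nat).
Local Notation V := 'rV[R]_d.
Local Notation B := (g_sigma_algebraType (@open V)).

Lemma continuous_measurable_rV (f : V -> R) : continuous f ->
  measurable_fun (setT : set B) f.
Proof.
move=> cf; apply: (measurability _ (RGenOInfty.measurableE R)).
move=> _ [_ [a ->] <-]; rewrite setTI; apply: sub_sigma_algebra.
by apply: open_comp => // x _; exact: cf.
Qed.

Lemma measurable_coord (i : 'I_d) : measurable_fun (setT : set B) (fun v : V => v ord0 i).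
Proof. by apply: continuous_measurable_rV; exact: coord_continuous. Qed.

(** An open set is a countable union of boxes with rational centres and radii [1 / (n + 1)], and the
    preimage of a box is a finite intersection of preimages under the coordinates. *)
Lemma measurable_rV d' (S : measurableType d') (f : S -> V) :
  (forall i, measurable_fun setT (fun s => f s ord0 i)) ->
  measurable_fun setT (f : S -> B).
Proof.
move=> mf; apply: (@measurability _ _ S B setT f (@open V) erefl).
move=> _ [W oW <-]; rewrite setTI.
pose box (an : 'rV[rat]_d * nat) : set V :=
  [set v | forall i, `|v ord0 i - ratr (an.1 ord0 i)| < an.2.+1%:R^-1].
have mbox an : measurable (f @^-1` box an).
  have -> : f @^-1` box an = \bigcap_(i in [set: 'I_d])
      ((fun s => f s ord0 i) @^-1` ball (ratr (an.1 ord0 i) : R) an.2.+1%:R^-1).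
    apply/seteqP; split => s /=.
      by move=> h i _ /=; rewrite /ball/= distrC; exact: h.
    by move=> h i; have := h i I; rewrite /ball/= distrC.
  apply: fin_bigcap_measurable; first exact: finite_finset.
  move=> i _; rewrite -[_ @^-1` _]setTI; apply: (mf i) => //.
  exact: measurable_ball.
have -> : f @^-1` W = \bigcup_(an : 'rV[rat]_d * nat)
   (if `[< box an `<=` W >] then f @^-1` box an else set0).
  apply/seteqP; split=> s /=; last first.
    by move=> [an _]; case: asboolP => // h; exact: h.
  move=> Ws; have /nbhs_ballP[e /= e0 he] : nbhs (f s) W by exact: open_nbhs_nbhs.
  (* The rational centre is chosen within [1 / (n + 1)] of [f s], so the box lies within
     [2 / (n + 1)] of [f s]. *)
  have [n ne] : exists n, 2 * n.+1%:R^-1 < e.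
    exists (Num.truncn (2 / e)); rewrite ltr_pdivrMr// mulrC -ltr_pdivrMr//.
    exact: truncnS_gt.
  have n0 : 0 < n.+1%:R^-1 :> R by [].
  have ex i : exists q : rat, `|f s ord0 i - ratr q| < n.+1%:R^-1.
    have [|q] := @rat_in_itvoo R (f s ord0 i - n.+1%:R^-1) (f s ord0 i + n.+1%:R^-1).
    by rewrite ltrBlDr -addrA ltrDl addr_gt0.
    by rewrite in_itv/= -ltr_distlC => h; exists q.
  pose a : 'rV[rat]_d := \row_i projT1 (cid (ex i)).
  have ha i : `|f s ord0 i - ratr (a ord0 i)| < n.+1%:R^-1.
    by rewrite mxE; case: cid.
  exists (a, n) => //; case: asboolP => [_ i|]; first exact: ha.
  case=> v hv; apply: he; split => // i j; rewrite ord1 /ball/=.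
  apply: le_lt_trans (ler_distD (ratr (a ord0 j)) _ _) _.
  apply: lt_trans ne; rewrite mulr_natl mulr2n ltrD//.
  by rewrite distrC; exact: hv.
apply: countable_bigcupT_measurable => [|an]; first exact: countableP.
by case: asboolP => // _; exact: measurable0.
Qed.

End borel_rV.

(** * Translations, reflection and products under iterated integrals *)

Section lint_transform.
Local Open Scope ereal_scope.
Context (R : realType).
Implicit Types (F G : (nat -> R) -> \bar R) (x : nat -> R).

(** Coordinates below [k] are overwritten by the integration variables. *)
Lemma lint_ext k F x y : (forall j, (k <= j)%N -> x j = y j) -> lint k F x = lint k F y.
Proof.
elim: k x y => [|k ih] x y xy; first by congr F; apply/funext => j; exact: xy.
rewrite !lintS; apply: eq_integral => t _; apply: ih => j kj; rewrite /upd.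
by case: eqP => // /eqP jk; apply: xy; rewrite ltn_neqAle eq_sym jk.
Qed.

Lemma lint_shift k F (a : nat -> R) x : cmeas F -> (forall y, 0 <= F y) ->
  lint k (fun y => F (fun j => y j + a j)%R) x = lint k F (fun j => x j + a j)%R.
Proof.
move=> mF F0; elim: k x => // k ih x.
have mk := cmeas_upd (fun j => x j + a j)%R k (lint_cmeas k mF F0).
rewrite !lintS -(ge0_integral_shift (a k) mk); last by move=> t; exact: lint_ge0.
apply: eq_integral => t _; rewrite ih; congr lint; apply/funext => j.
by rewrite /upd; case: eqP => // ->.
Qed.

Lemma lint_opp k F x : cmeas F -> (forall y, 0 <= F y) ->
  lint k (fun y => F (fun j => - y j)%R) x = lint k F (fun j => - x j)%R.
Proof.
move=> mF F0; elim: k x => // k ih x.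
have mk := cmeas_upd (fun j => - x j)%R k (lint_cmeas k mF F0).
rewrite !lintS -(ge0_integral_oppr mk); last by move=> t; exact: lint_ge0.
apply: eq_integral => t _; rewrite ih; congr lint; apply/funext => j.
by rewrite /upd; case: eqP.
Qed.

(** The coordinates from [k] on are kept as parameters, which makes the induction on [k]
    possible. *)
Lemma lint_prod n k (f : nat -> R -> R) (c : nat -> R) x : (k <= n)%N ->
  (forall i, measurable_fun setT (f i)) -> (forall i t, 0 <= f i t)%R ->
  (forall i, \int[lebesgue_measure]_t (f i t)%:E = (c i)%:E) ->
  lint k (fun y => (\prod_(0 <= i < n) f i (y i))%:E) x =
  (\prod_(0 <= i < k) c i * \prod_(k <= i < n) f i (x i))%:E.
Proof.
move=> + mf f0 fc; elim: k x => [|k ih] x kn.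
  by rewrite big_geq// mul1r.
rewrite lintS.
have c0 i : (0 <= c i)%R.
  by rewrite -lee_fin -fc; apply: integral_ge0 => t _; rewrite lee_fin.
set A := (\prod_(0 <= i < k) c i)%R; set D := (\prod_(k.+1 <= i < n) f i (x i))%R.
transitivity (\int[lebesgue_measure]_t ((A * D)%:E * (f k t)%:E)).
  apply: eq_integral => t _.
  rewrite (ih _ (ltnW kn)) -EFinM; congr EFin.
  rewrite (@big_ltn _ _ _ k n)// {1}/upd eqxx -/A mulrA mulrAC; congr (_ * _ * _)%R.
  by apply: eq_big_nat => i /andP[ki _]; rewrite /upd gtn_eqF.
rewrite ge0_integralZl_EFin//.
- by rewrite fc -EFinM big_nat_recr//= -/A; congr EFin; ring.
- by move=> t _; rewrite lee_fin.
- apply/measurable_EFinP; exact: mf.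
- by rewrite mulr_ge0// prodr_ge0.
Qed.

End lint_transform.

Notation borelV R d := (g_sigma_algebraType (@open 'rV[R]_d)).

Section lebesgue_rV.
Local Open Scope ereal_scope.
Context (R : realType) (d : nat).
Local Notation V := 'rV[R]_d.
Local Notation B := (borelV R d).
Implicit Types G : V -> \bar R.

Let row (x : nat -> R) : V := (\row_i x (nat_of_ord i))%R.

Lemma cmeas_row G : measurable_fun (setT : set B) G -> cmeas (fun x => G (row x)).
Proof.
move=> mG d' S phi mphi.
have mrow : measurable_fun setT (fun s => row (phi s) : B).
  by apply: measurable_rV => i; under eq_fun do rewrite mxE; exact: mphi.
exact: (measurableT_comp mG mrow).
Qed.

Lemma leb_int_ge0 G : (forall x, 0 <= G x) -> 0 <= leb_int G.
Proof. by move=> G0; exact: lint_ge0. Qed.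

(** [leb_d] on the type that carries the Borel sigma-algebra, so that it can receive a measure
    structure. *)
Definition lebV (A : set B) : \bar R := leb_d A.

Let lebV0 : lebV set0 = 0.
Proof.
rewrite /lebV /leb_d /leb_int -[RHS](@lint_cst0 R d (fun=> 0%R)).
by apply: lint_eq => x; rewrite indic0.
Qed.

Let lebV_ge0 A : 0 <= lebV A.
Proof. by apply: leb_int_ge0 => x; rewrite lee_fin. Qed.

Let leb_int_lim (g : (V -> \bar R)^nat) : (forall n, measurable_fun (setT : set B) (g n)) ->
  (forall n x, 0 <= g n x) -> (forall x, nondecreasing_seq (g ^~ x)) ->
  leb_int (fun x => limn (g ^~ x)) = limn (fun n => leb_int (g n)).
Proof.
move=> mg g0 ndg; rewrite /leb_int.
by rewrite (lint_lim d (F := fun n x => g n (row x)))// => n; exact: cmeas_row.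
Qed.

Let leb_int0 : leb_int (cst 0 : V -> \bar R) = 0.
Proof. exact: lint_cst0. Qed.

Let leb_intD (f g : V -> \bar R) :
  measurable_fun (setT : set B) f -> (forall x, 0 <= f x) ->
  measurable_fun (setT : set B) g -> (forall x, 0 <= g x) ->
  leb_int (fun x => f x + g x) = leb_int f + leb_int g.
Proof.
move=> mf f0 mg g0.
by apply: (lintD d (F := fun x => f (row x)) (G := fun x => g (row x))) => //; exact: cmeas_row.
Qed.

Let leb_int_sum (I : Type) (s : seq I) (F : I -> V -> \bar R) :
  (forall i, measurable_fun (setT : set B) (F i)) -> (forall i x, 0 <= F i x) ->
  leb_int (fun x => \sum_(i <- s) F i x) = \sum_(i <- s) leb_int (F i).
Proof.
move=> mF F0; elim: s => [|i s ih].
  by rewrite big_nil -leb_int0; congr leb_int; apply/funext => x; rewrite big_nil.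
rewrite big_cons -ih -leb_intD//.
- by congr leb_int; apply/funext => x; rewrite big_cons.
- by apply: emeasurable_sum => j.
- by move=> x; apply: sume_ge0.
Qed.

Let lebV_sigma_additive : semi_sigma_additive lebV.
Proof.
move=> F mF tF mUF; rewrite [X in _ --> X](_ : _ =
    limn (fun n => \sum_(0 <= i < n) lebV (F i))).
  by apply: is_cvg_ereal_nneg_natsum => n _; exact: lebV_ge0.
have mI n : measurable_fun (setT : set B) (fun x : V => (\1_(F n) x : R)%:E).
  by apply/measurable_EFinP; exact: measurable_indic.
transitivity (leb_int (fun x : V => limn (fun n => \sum_(0 <= i < n) (\1_(F i) x : R)%:E))).
  congr leb_int; apply/funext => x; rewrite indic_bigcup//.
rewrite (@leb_int_lim (fun n x => \sum_(0 <= i < n) (\1_(F i) x : R)%:E)).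
- by congr (limn _); apply/funext => n; rewrite leb_int_sum// => i x; rewrite lee_fin.
- by move=> n; exact: emeasurable_sum.
- by move=> n x; apply: sume_ge0 => i _; rewrite lee_fin.
- by move=> x m n mn; apply: lee_sum_nneg_natr => // i _ _; rewrite lee_fin.
Qed.

HB.instance Definition _ := isMeasure.Build _ B R lebV lebV0 lebV_ge0 lebV_sigma_additive.

Lemma integral_lebV G : measurable_fun (setT : set B) G -> (forall x, 0 <= G x) ->
  \int[lebV]_x G x = leb_int G.
Proof.
move=> mG G0.
apply: (@integral_functional _ B R lebV (@leb_int R d : (B -> \bar R) -> \bar R)) => //.
- by move=> f g [mf f0] [mg g0]; exact: leb_intD.
- move=> a f a0 [mf f0]; apply: (lintZ d (F := fun x => f (row x))) => //.
  exact: cmeas_row.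
- by move=> g hg; apply: leb_int_lim => n; case: (hg n).
Qed.

Lemma leb_int_shift G (a : V) : measurable_fun (setT : set B) G -> (forall x, 0 <= G x) ->
  leb_int (fun x => G (x + a)%R) = leb_int G.
Proof.
move=> mG G0.
(* Iterated integrals act on infinite sequences, so [a] is extended by zero. *)
pose a' (j : nat) : R := if insub j is Some i then a ord0 i else 0%R.
rewrite /leb_int.
transitivity (lint d (fun x => G (row x)) (fun j => 0 + a' j)%R).
  rewrite -(lint_shift d (F := fun x => G (row x)))//; last exact: cmeas_row.
  apply: lint_eq => x; congr G; apply/rowP => i; rewrite !mxE /a'.
  by rewrite (insubT (fun j => j < d)%N (ltn_ord i))/=; congr (_ + a _ _)%R; exact/val_inj.
apply: lint_ext => j dj; rewrite add0r /a' insubF//.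
by apply/negbTE; rewrite -leqNgt.
Qed.

Lemma leb_int_opp G : measurable_fun (setT : set B) G -> (forall x, 0 <= G x) ->
  leb_int (fun x => G (- x)%R) = leb_int G.
Proof.
move=> mG G0; rewrite /leb_int.
transitivity (lint d (fun x => G (row x)) (fun j => - 0)%R).
  rewrite -(lint_opp d (F := fun x => G (row x)))//; last exact: cmeas_row.
  by apply: lint_eq => x; congr G; apply/rowP => i; rewrite !mxE.
by congr lint; apply/funext => j; rewrite oppr0.
Qed.

Lemma leb_int_prod (f : 'I_d -> R -> R) (c : 'I_d -> R) :
  (forall i, measurable_fun setT (f i)) -> (forall i t, 0 <= f i t)%R ->
  (forall i, \int[lebesgue_measure]_t (f i t)%:E = (c i)%:E) ->
  leb_int (fun x : V => (\prod_i f i (x ord0 i))%:E) = (\prod_i c i)%:E.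
Proof.
move=> mf f0 fc.
(* The default factor is zero with integral zero, so that the hypotheses also hold for indices from
   [d] on. *)
pose f' (j : nat) : R -> R := if insub j is Some i then f i else cst 0%R.
pose c' (j : nat) : R := if insub j is Some i then c i else 0%R.
have fE (i : 'I_d) : f' i = f i.
  by rewrite /f' (insubT (fun j => j < d)%N (ltn_ord i))/=; congr f; exact/val_inj.
have cE (i : 'I_d) : c' i = c i.
  by rewrite /c' (insubT (fun j => j < d)%N (ltn_ord i))/=; congr c; exact/val_inj.
have := @lint_prod R d d f' c' (fun=> 0%R) (leqnn d).
rewrite [X in (_ * X)%R]big_geq// mulr1 !big_mkord.
rewrite (eq_bigr c) => [h|i _]; last exact: cE.
rewrite /leb_int -h.
- apply: lint_eq => x; congr EFin; rewrite big_mkord; apply: eq_bigr => i _.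
  by rewrite mxE fE.
- by move=> i; rewrite /f'; case: insub => // ; exact: measurable_cst.
- by move=> i t; rewrite /f'; case: insub => // ; exact: f0.
- move=> i; rewrite /f' /c'; case: insub => [j|]; first exact: fc.
  by rewrite integral0.
Qed.

End lebesgue_rV.

Section lebesgue_boxes.
Local Open Scope ereal_scope.
Context (R : realType) (d : nat).
Local Notation V := 'rV[R]_d.
Local Notation B := (borelV R d).

Lemma ball_rVP (x y : V) (r : R) : (0 < r)%R ->
  ball x r y <-> forall i, (`|x ord0 i - y ord0 i| < r)%R.
Proof.
move=> r0; split => [[_ h] i|h]; first exact: h.
by split => // i j; rewrite ord1; exact: h.
Qed.

Lemma measurable_ball_rV (x : V) r : measurable (ball x r : set B).
Proof. by apply: sub_sigma_algebra; exact: ball_open. Qed.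

(** [ball] belongs to the maximum norm, hence is a cube, and its indicator is a product over the
    coordinates. *)
Lemma lebV_ball (x : V) (r : R) : (0 < r)%R -> lebV (ball x r : set B) = ((2 * r) ^+ d)%:E.
Proof.
move=> r0.
have -> : ((2 * r) ^+ d = \prod_(i < d) (2 * r))%R by rewrite prodr_const card_ord.
rewrite -(@leb_int_prod _ _ (fun i => \1_(ball (x ord0 i : R) r)) (fun=> 2 * r)%R).
- rewrite /lebV /leb_d; congr leb_int; apply/funext => y; congr EFin.
  have [/set_mem yx|yx] := boolP (y \in (ball x r : set V)).
    rewrite indicE mem_set// big1// => i _; rewrite indicE mem_set//.
    by move/(ball_rVP _ _ r0) : yx; exact.
  rewrite indicE (negbTE yx); apply/esym/eqP; rewrite prodf_seq_eq0.
  apply/hasP; apply: contrapT => h; move/negP : yx; apply; rewrite inE.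
  apply/(ball_rVP _ _ r0) => i; apply: contrapT => hi; apply: h.
  exists i; first by rewrite mem_index_enum.
  by rewrite /= indicE memNset.
- by move=> i; apply: measurable_indic; exact: measurable_ball.
- by [].
- move=> i; rewrite integral_indic//; last exact: measurable_ball.
  by rewrite setIT mulr_natl; exact: lebesgue_measure_ball (ltW r0).
Qed.

Let lebV_sigma_finite : sigma_finite setT (@lebV R d).
Proof.
exists (fun n => ball (0%R : V) n.+1%:R) => [|n].
  apply/seteqP; split => // x _; exists (Num.truncn `|x|) => //.
  by rewrite -ball_normE /= sub0r normrN truncnS_gt.
by split; [exact: measurable_ball_rV|rewrite lebV_ball// ltry].
Qed.

HB.instance Definition _ := @Measure_isSigmaFinite.Build _ B R (@lebV R d) lebV_sigma_finite.

Lemma enorm2 (p : V) : (enorm p ^+ 2 = \sum_i p ord0 i ^+ 2)%R.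
Proof. by rewrite sqr_sqrtr// sumr_ge0// => i _; rewrite sqr_ge0. Qed.

Lemma gaussE (p : V) : (gauss p = \prod_i normal_pdf 0 1 (p ord0 i))%R.
Proof.
rewrite /gauss enorm2.
under eq_bigr do rewrite normal_pdfE ?oner_eq0//.
rewrite big_split/= prodr_const card_ord; congr (_ * _)%R.
  by rewrite /normal_peak expr1n mul1r mulr_natl exprVn.
rewrite -expR_sum; congr expR; rewrite mulr_suml -sumrN; apply: eq_bigr => i _.
by rewrite subr0 expr1n -mulNr.
Qed.

Lemma leb_int_gauss : leb_int (fun p : V => (gauss p)%:E) = 1.
Proof.
under eq_fun do rewrite gaussE.
rewrite (@leb_int_prod _ _ (fun=> normal_pdf 0 1)%R (fun=> 1%R)) ?big1//.
- by move=> i; exact: measurable_normal_pdf.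
- by move=> i t; exact: normal_pdf_ge0.
- by move=> i; rewrite integral_normal_pdf// oner_eq0.
Qed.

End lebesgue_boxes.

(** * Measures with a density *)

Section density.
Local Open Scope ereal_scope.
Context d (T : measurableType d) (R : realType) (mu : {measure set T -> \bar R}).
Variable g : T -> R.
Hypothesis mg : measurable_fun setT g.
Hypothesis g0 : forall x, (0 <= g x)%R.

Definition mdensity (A : set T) : \bar R := \int[mu]_(x in A) (g x)%:E.

Let mdensity0 : mdensity set0 = 0.
Proof. by rewrite /mdensity integral_set0. Qed.

Let mdensity_ge0 A : 0 <= mdensity A.
Proof. by apply: integral_ge0 => x _; rewrite lee_fin. Qed.

Let mdensity_sigma_additive : semi_sigma_additive mdensity.
Proof.
move=> F mF tF mUF; rewrite /mdensity ge0_integral_bigcup//.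
- by apply: is_cvg_ereal_nneg_natsum => n _; exact: mdensity_ge0.
- by apply/measurable_EFinP; exact: measurable_funTS.
- by move=> x _; rewrite lee_fin.
Qed.

HB.instance Definition _ := isMeasure.Build _ T R mdensity
  mdensity0 mdensity_ge0 mdensity_sigma_additive.

Lemma integral_mdensity (f : T -> \bar R) : measurable_fun setT f -> (forall x, 0 <= f x) ->
  \int[mdensity]_x f x = \int[mu]_x (f x * (g x)%:E).
Proof.
have mgE : measurable_fun setT (EFin \o g) by apply/measurable_EFinP.
have gE0 x : 0 <= (g x)%:E by rewrite lee_fin.
apply: (integral_functional (J := fun f => \int[mu]_x (f x * (g x)%:E))).
- by under eq_integral do rewrite mul0e; rewrite integral0.
- move=> f1 f2 [m1 p1] [m2 p2]; rewrite -ge0_integralD//.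
  + by apply: eq_integral => x _; rewrite muleDl// ge0_adde_def ?inE.
  + by move=> x _; rewrite mule_ge0.
  + exact: emeasurable_funM.
  + by move=> x _; rewrite mule_ge0.
  + exact: emeasurable_funM.
- move=> a f1 a0 [m1 p1]; rewrite -ge0_integralZl_EFin//.
  + by apply: eq_integral => x _; rewrite muleA.
  + by move=> x _; rewrite mule_ge0.
  + exact: emeasurable_funM.
- move=> h hh ndh; rewrite -monotone_convergence//.
  + apply: eq_integral => x _; rewrite muleC -limeMl//.
      by congr (limn _); apply/funext => n; rewrite muleC.
    by apply: ereal_nondecreasing_is_cvgn; exact: ndh.
  + by move=> n; apply: emeasurable_funM => //; case: (hh n).
  + by move=> n x _; rewrite mule_ge0//; case: (hh n).
  + by move=> x _ m n mn; rewrite lee_wpmul2r//; exact: ndh.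
- move=> A mA; rewrite /mdensity [RHS]integral_mkcond; apply: eq_integral => x _.
  by rewrite patchE indicE; case: ifPn => _; rewrite ?mul1e ?mul0e.
Qed.

Hypothesis g1 : \int[mu]_x (g x)%:E = 1.

HB.instance Definition _ := @Measure_isProbability.Build _ T R mdensity g1.

Definition density_prob : probability T R := mdensity.

Lemma integral_density_prob (f : T -> \bar R) : measurable_fun setT f -> (forall x, 0 <= f x) ->
  \int[density_prob]_x f x = \int[mu]_x (f x * (g x)%:E).
Proof. exact: integral_mdensity. Qed.

Lemma density_probE A : density_prob A = \int[mu]_(x in A) (g x)%:E.
Proof. by []. Qed.

End density.

(** * Volume preservation and reversibility *)

Section phase_space.
Local Open Scope ereal_scope.
Context (R : realType) (d : nat).
Local Notation V := 'rV[R]_d.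
Local Notation B := (borelV R d).
Local Notation BB := (B * B)%type.
Local Notation leb := (@lebV R d).

Definition phase_int (F : V * V -> \bar R) : \bar R :=
  \int[leb]_q \int[leb]_p F (q, p).

Lemma measurable_linV d' (S : measurableType d') (f g : S -> V) (a : R) :
  measurable_fun setT (f : S -> B) -> measurable_fun setT (g : S -> B) ->
  measurable_fun setT ((fun s => f s + a *: g s)%R : S -> B).
Proof.
move=> mf mg; apply: measurable_rV => i; under eq_fun do rewrite !mxE.
apply: measurable_funD; first exact: (measurableT_comp (measurable_coord i) mf).
apply: measurable_funM; first exact: measurable_cst.
exact: (measurableT_comp (measurable_coord i) mg).
Qed.

Lemma continuous_measurable_V (f : V -> V) : continuous f ->
  measurable_fun setT (f : B -> B).
Proof.
move=> cf; apply: measurable_rV => i; apply: continuous_measurable_rV => x.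
by apply: (@continuous_comp _ _ _ f (fun v : V => v ord0 i)); [exact: cf|exact: coord_continuous].
Qed.

Lemma measurable_slicel (F : V * V -> \bar R) (q : V) :
  measurable_fun (setT : set BB) F -> measurable_fun (setT : set B) (fun p => F (q, p)).
Proof.
move=> mF; have mp : measurable_fun setT ((fun p => (q, p)) : B -> BB).
  exact: pair1_measurable.
exact: (measurableT_comp mF mp).
Qed.

Lemma measurable_slicer (F : V * V -> \bar R) (p : V) :
  measurable_fun (setT : set BB) F -> measurable_fun (setT : set B) (fun q => F (q, p)).
Proof.
move=> mF; have mp : measurable_fun setT ((fun q => (q, p)) : B -> BB).
  exact: pair2_measurable.
exact: (measurableT_comp mF mp).
Qed.

Lemma phase_intC (F : V * V -> \bar R) :
  measurable_fun (setT : set BB) F -> (forall z, 0 <= F z) ->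
  phase_int F = \int[leb]_p \int[leb]_q F (q, p).
Proof.
move=> mF F0.
exact: (fubini_tonelli (m1 := @lebV R d) (m2 := @lebV R d) (F : BB -> \bar R) mF F0).
Qed.

Lemma measurable_phase_inner (F : V * V -> \bar R) :
  measurable_fun (setT : set BB) F -> (forall z, 0 <= F z) ->
  measurable_fun (setT : set B) (fun q => \int[leb]_p F (q, p)).
Proof.
move=> mF F0.
exact: (measurable_fun_fubini_tonelli_F (m2 := @lebV R d) (F : BB -> \bar R) mF F0).
Qed.

Lemma integral_lebV_shift (G : V -> \bar R) (a : V) :
  measurable_fun (setT : set B) G -> (forall x, 0 <= G x) ->
  \int[leb]_x G (x + a)%R = \int[leb]_x G x.
Proof.
move=> mG G0.
have ma : measurable_fun setT ((fun x : V => x + a)%R : B -> B).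
  apply: measurable_rV => i; under eq_fun do rewrite mxE.
  by apply: measurable_funD; [exact: measurable_coord|exact: measurable_cst].
rewrite !integral_lebV//; first exact: leb_int_shift.
exact: (measurableT_comp mG ma).
Qed.

Lemma integral_lebV_opp (G : V -> \bar R) :
  measurable_fun (setT : set B) G -> (forall x, 0 <= G x) ->
  \int[leb]_x G (- x)%R = \int[leb]_x G x.
Proof.
move=> mG G0.
have mN : measurable_fun setT ((fun x : V => - x)%R : B -> B).
  apply: measurable_rV => i; under eq_fun do rewrite mxE.
  by apply: measurable_funN; exact: measurable_coord.
rewrite !integral_lebV//; first exact: leb_int_opp.
exact: (measurableT_comp mG mN).
Qed.

Definition flip (z : V * V) : V * V := (z.1, - z.2)%R.

Lemma measurable_flip : measurable_fun setT (flip : BB -> BB).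
Proof.
apply: measurable_fun_pair; first exact: measurable_fst.
apply: measurable_rV => i; under eq_fun do rewrite mxE.
apply: measurable_funN; exact: (measurableT_comp (measurable_coord i) measurable_snd).
Qed.

Lemma phase_int_flip (F : V * V -> \bar R) :
  measurable_fun (setT : set BB) F -> (forall z, 0 <= F z) ->
  phase_int (F \o flip) = phase_int F.
Proof.
move=> mF F0; apply: eq_integral => q _.
exact: (integral_lebV_opp (measurable_slicel q mF) (fun p => F0 (q, p))).
Qed.

Lemma measurable_Psi2 (h : R) : measurable_fun setT (Psi2 h : BB -> BB).
Proof.
apply: measurable_fun_pair; last exact: measurable_snd.
by apply: measurable_linV; [exact: measurable_fst|exact: measurable_snd].
Qed.

(** For fixed momentum this is a translation of the position, so the integrals are exchanged first.
    [Psi1] translates the momentum for fixed position. *)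
Lemma phase_int_Psi2 (h : R) (F : V * V -> \bar R) :
  measurable_fun (setT : set BB) F -> (forall z, 0 <= F z) ->
  phase_int (F \o Psi2 h) = phase_int F.
Proof.
move=> mF F0; have mFP := measurableT_comp mF (measurable_Psi2 h).
rewrite (phase_intC mFP) => [|z]; last exact: F0.
rewrite (phase_intC mF F0).
apply: eq_integral => p _.
exact: (integral_lebV_shift (h *: p)%R (measurable_slicer p mF) (fun q => F0 (q, p))).
Qed.

Section leapfrog.
Variables (U : V -> R) (h : R).
Hypothesis cgU : continuous (grad U).

Lemma measurable_Psi1 : measurable_fun setT (Psi1 U h : BB -> BB).
Proof.
apply: measurable_fun_pair; first exact: measurable_fst.
have mg : measurable_fun setT ((fun z => grad U z.1) : BB -> B).
  exact: (measurableT_comp (continuous_measurable_V cgU) measurable_fst).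
have m2 : measurable_fun setT (snd : BB -> B) := measurable_snd.
have := measurable_linV (- (h / 2)) m2 mg.
by under eq_fun do rewrite scaleNr.
Qed.

Lemma phase_int_Psi1 (F : V * V -> \bar R) :
  measurable_fun (setT : set BB) F -> (forall z, 0 <= F z) ->
  phase_int (F \o Psi1 U h) = phase_int F.
Proof.
move=> mF F0; apply: eq_integral => q _.
exact: (integral_lebV_shift (- ((h / 2) *: grad U q))%R (measurable_slicel q mF)
  (fun p => F0 (q, p))).
Qed.

Lemma measurable_leapfrog : measurable_fun setT (leapfrog U h : BB -> BB).
Proof.
apply: (measurableT_comp measurable_Psi1).
exact: (measurableT_comp (measurable_Psi2 h) measurable_Psi1).
Qed.

Lemma measurable_leapfrogT n : measurable_fun setT (leapfrogT U h n : BB -> BB).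
Proof.
elim: n => [|n ih]; first exact: measurable_id.
exact: (measurableT_comp measurable_leapfrog ih).
Qed.

Lemma phase_int_leapfrogT n (F : V * V -> \bar R) :
  measurable_fun (setT : set BB) F -> (forall z, 0 <= F z) ->
  phase_int (F \o leapfrogT U h n) = phase_int F.
Proof.
elim: n F => [//|n ih] F mF F0.
have m1 := measurableT_comp mF measurable_Psi1.
have m2 := measurableT_comp m1 (measurable_Psi2 h).
have m3 := measurableT_comp m2 measurable_Psi1.
have e0 : phase_int (F \o leapfrogT U h n.+1) =
    phase_int ((F \o Psi1 U h \o Psi2 h \o Psi1 U h) \o leapfrogT U h n) by [].
rewrite e0 (ih _ m3) => [|z]; last exact: F0.
rewrite (phase_int_Psi1 m2) => [|z]; last exact: F0.
rewrite (phase_int_Psi2 h m1) => [|z]; last exact: F0.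
exact: (phase_int_Psi1 mF F0).
Qed.

(** Each substep is inverted by conjugation with [flip], and the composition [Psi1], [Psi2], [Psi1]
    is a palindrome. *)
Lemma leapfrogT_flipK n z : leapfrogT U h n (flip (leapfrogT U h n z)) = flip z.
Proof.
have k1 y : Psi1 U h (flip (Psi1 U h y)) = flip y.
  by rewrite /Psi1 /flip/= opprB addrAC subrr add0r.
have k2 y : Psi2 h (flip (Psi2 h y)) = flip y.
  by rewrite /Psi2 /flip/= scalerN addrK.
have k3 y : leapfrog U h (flip (leapfrog U h y)) = flip y.
  by rewrite /leapfrog k1 k2 k1.
elim: n z => [|n ih] z; first by [].
by rewrite /leapfrogT iterSr [in X in flip X]iterS k3 -[RHS]ih.
Qed.

Lemma ham_flip z : ham U (flip z) = ham U z.
Proof.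
rewrite /ham /flip/=; congr (_ + _ ^+ 2 / _)%R; rewrite /enorm; congr Num.sqrt.
by apply: eq_bigr => i _; rewrite mxE sqrrN.
Qed.

End leapfrog.

End phase_space.

Section gaussian.
Local Open Scope ereal_scope.
Context (R : realType) (d : nat).
Local Notation V := 'rV[R]_d.
Local Notation B := (borelV R d).
Local Notation leb := (@lebV R d).

Lemma gauss_gt0 (p : V) : (0 < gauss p)%R.
Proof.
rewrite /gauss mulr_gt0 ?expR_gt0// invr_gt0 exprn_gt0// sqrtr_gt0 mulr_gt0//.
exact: pi_gt0.
Qed.

Lemma gauss_ge0 (p : V) : (0 <= gauss p)%R.
Proof. exact/ltW/gauss_gt0. Qed.

Lemma measurable_enorm2 : measurable_fun (setT : set B) (fun p : V => enorm p ^+ 2)%R.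
Proof.
under eq_fun do rewrite enorm2.
apply: measurable_sum => i; apply: measurable_funX; exact: measurable_coord.
Qed.

Lemma measurable_gauss : measurable_fun (setT : set B) (@gauss R d).
Proof.
apply: measurable_funM; first exact: measurable_cst.
apply: measurableT_comp => //; apply: measurable_funN.
by apply: measurable_funM; [exact: measurable_enorm2|exact: measurable_cst].
Qed.

Lemma integral_gauss : \int[leb]_p (gauss p)%:E = 1.
Proof.
rewrite integral_lebV ?leb_int_gauss//; last by move=> p; rewrite lee_fin gauss_ge0.
by apply/measurable_EFinP; exact: measurable_gauss.
Qed.

Definition gaussV : probability B R := density_prob measurable_gauss gauss_ge0 integral_gauss.

Lemma bexp_gaussV (f : V -> R) : nnb (f : B -> R) ->
  (Rintegral gaussV setT f)%:E = leb_int (fun p => (f p * gauss p)%:E).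
Proof.
move=> [bf f0]; rewrite bexp_EFin// integral_density_prob//.
- rewrite integral_lebV//.
  + apply: emeasurable_funM; apply/measurable_EFinP; first by case: bf.
    exact: measurable_gauss.
  + by move=> p; rewrite -EFinM lee_fin mulr_ge0// gauss_ge0.
- by apply/measurable_EFinP; case: bf.
Qed.

End gaussian.

(** * The HMC kernel as a real operator, and its reversibility *)

Section hmc.
Context (R : realType) (d : nat).
Local Notation V := 'rV[R]_d.
Local Notation B := (borelV R d).
Local Notation BB := (B * B)%type.
Local Notation leb := (@lebV R d).
Local Notation gaussV := (@gaussV R d).
Variables (U : V -> R) (h : R) (T : nat).
Hypothesis cU : continuous U.
Hypothesis cgU : continuous (grad U).

Let Phi := leapfrogT U h T.
Let acc z := accept U z (Phi z).

Let mPhi : measurable_fun setT (Phi : BB -> BB) := measurable_leapfrogT h cgU T.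
Let mU : measurable_fun (setT : set B) U := continuous_measurable_rV cU.

Lemma measurable_ham : measurable_fun (setT : set BB) (ham U).
Proof.
apply: measurable_funD; first exact: (measurableT_comp mU measurable_fst).
apply: measurable_funM; last exact: measurable_cst.
exact: (measurableT_comp (@measurable_enorm2 R d) measurable_snd).
Qed.

Lemma measurable_acc : measurable_fun (setT : set BB) acc.
Proof.
apply: measurable_minr; first exact: measurable_cst.
apply: measurableT_comp => //; apply: measurable_funB; first exact: measurable_ham.
exact: (measurableT_comp measurable_ham mPhi).
Qed.

Lemma acc_gt0 z : 0 < acc z.
Proof. by rewrite lt_min ltr01 expR_gt0. Qed.

Lemma acc_le1 z : acc z <= 1.
Proof. by rewrite ge_min lexx. Qed.

Let acc_ge0 z : 0 <= acc z := ltW (acc_gt0 z).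

(** The mean of [f] after the accept or reject decision, given position and momentum. *)
Definition hmc_step (f : V -> R) (z : V * V) : R :=
  f (Phi z).1 * acc z + f z.1 * (1 - acc z).

Lemma bmeas_hmc_step (f : V -> R) : bmeas (f : B -> R) -> bmeas (hmc_step f : BB -> R).
Proof.
move=> bf; have comp (k : BB -> B) : measurable_fun setT k -> bmeas (fun z => f (k z)).
  move=> mk; case: bf => mf [M hM]; split; first exact: (measurableT_comp mf mk).
  by exists M => z.
have bacc : bmeas (acc : BB -> R).
  split; first exact: measurable_acc.
  by exists 1 => z; rewrite ger0_norm ?acc_le1.
apply: bmeasD; first apply: bmeasM => //.
  exact: (comp (fun z => (Phi z).1) (measurableT_comp measurable_fst mPhi)).
by apply: bmeasM; [exact: (comp fst measurable_fst)|exact: (bmeasB (bmeas_cst _ 1) bacc)].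
Qed.

Lemma nnb_hmc_step (f : V -> R) : nnb (f : B -> R) -> nnb (hmc_step f : BB -> R).
Proof.
move=> [bf f0]; split; first exact: bmeas_hmc_step.
by move=> z; rewrite addr_ge0// mulr_ge0// subr_ge0 acc_le1.
Qed.

Lemma nnb_section (F : V * V -> R) q : nnb (F : BB -> R) -> nnb ((fun p => F (q, p)) : B -> R).
Proof.
move=> [[mF [M hM]] F0]; split => //; split; last by exists M.
have mp : measurable_fun setT ((fun p => (q, p)) : B -> BB) by exact: pair1_measurable.
exact: (measurableT_comp mF mp).
Qed.

Definition hmc (f : V -> R) (q : V) : R := Rintegral gaussV setT (fun p => hmc_step f (q, p)).

Lemma hmc_phase (f : V -> R) q : nnb (f : B -> R) ->
  (hmc f q)%:E = (\int[leb]_p (hmc_step f (q, p) * gauss p)%:E)%E.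
Proof.
move=> bf; have bs := nnb_section q (nnb_hmc_step bf).
have [[ms _] s0] := bs.
rewrite bexp_gaussV// integral_lebV//.
- apply/measurable_EFinP; apply: measurable_funM; [exact: ms|exact: measurable_gauss].
- by move=> p; rewrite lee_fin mulr_ge0 ?gauss_ge0//; exact: s0.
Qed.

(** Passage from the extended-real operator of the theorem to the real-valued [hmc], to which the
    abstract results apply. *)
Lemma hmc_opE (f : V -> R) q : nnb (f : B -> R) ->
  hmc_op U h T (EFin \o f) q = (hmc f q)%:E.
Proof.
move=> bf; rewrite hmc_phase// /hmc_op -/Phi.
have [[mf _] f0] := bf.
have macc : measurable_fun (setT : set B) (fun p => acc (q, p)).
  have mp : measurable_fun setT ((fun p => (q, p)) : B -> BB) by exact: pair1_measurable.
  exact: (measurableT_comp measurable_acc mp).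
have mfP : measurable_fun (setT : set B) (fun p => f (Phi (q, p)).1).
  have mp : measurable_fun setT ((fun p => (Phi (q, p)).1) : B -> B).
    have mp : measurable_fun setT ((fun p => (q, p)) : B -> BB) by exact: pair1_measurable.
    exact: (measurableT_comp measurable_fst (measurableT_comp mPhi mp)).
  exact: (measurableT_comp mf mp).
have m1 : measurable_fun (setT : set B)
    (fun p => (f (Phi (q, p)).1 * (acc (q, p) * gauss p))%:E).
  apply/measurable_EFinP; apply: measurable_funM => //.
  by apply: measurable_funM => //; exact: measurable_gauss.
have m2 : measurable_fun (setT : set B) (fun p => ((1 - acc (q, p)) * gauss p)%:E).
  apply/measurable_EFinP; apply: measurable_funM; last exact: measurable_gauss.
  by apply: measurable_funB => //; exact: measurable_cst.
have p1 p : (0 <= (f (Phi (q, p)).1 * (acc (q, p) * gauss p))%:E)%E.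
  by rewrite lee_fin mulr_ge0// mulr_ge0// gauss_ge0.
have p2 p : (0 <= ((1 - acc (q, p)) * gauss p)%:E)%E.
  by rewrite lee_fin mulr_ge0 ?gauss_ge0// subr_ge0 acc_le1.
rewrite -!integral_lebV// -ge0_integralZl_EFin//.
rewrite -ge0_integralD//.
- by apply: eq_integral => p _; rewrite -!EFinM -EFinD; congr EFin; rewrite /hmc_step /acc; ring.
- by move=> p _; exact: p1.
- by move=> p _; apply: mule_ge0; [rewrite lee_fin|exact: p2].
- by apply: emeasurable_funM => //; exact: m2.
- by move=> p _; exact: p2.
Qed.

Lemma hmc_nnb (f : V -> R) : nnb (f : B -> R) -> nnb (hmc f : B -> R).
Proof.
move=> bf; have [bs s0] := nnb_hmc_step bf.
split; last first.
  by move=> q; apply: bexp_ge0 => p; exact: s0.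
split; last first.
  have [M hM] := bs.2; exists M => q.
  have [b1 b10] := nnb_section q (nnb_hmc_step bf).
  apply: (le_trans (bexp_norm _ b1)); rewrite -[leRHS](bexp_cst gaussV M).
  by apply: bexp_le; [exact: bmeas_norm|exact: bmeas_cst|move=> p; exact: hM].
apply/measurable_EFinP.
rewrite (_ : EFin \o hmc f = fun q => (\int[leb]_p (hmc_step f (q, p) * gauss p)%:E)%E); last first.
  by apply/funext => q; rewrite -hmc_phase.
apply: (measurable_phase_inner (F := fun z => (hmc_step f z * gauss z.2)%:E)).
- apply/measurable_EFinP; apply: measurable_funM; first by case: bs.
  exact: (measurableT_comp (@measurable_gauss R d) measurable_snd).
- by move=> z; rewrite lee_fin mulr_ge0// gauss_ge0.
Qed.

Lemma hmcD (f g : V -> R) q : nnb (f : B -> R) -> nnb (g : B -> R) ->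
  hmc (fun y => f y + g y) q = hmc f q + hmc g q.
Proof.
move=> bf bg.
have [b1 _] := nnb_section q (nnb_hmc_step bf).
have [b2 _] := nnb_section q (nnb_hmc_step bg).
rewrite /hmc -bexpD//; congr Rintegral; apply/funext => p.
by rewrite /hmc_step /=; ring.
Qed.

Lemma hmcZ a (f : V -> R) q : 0 <= a -> nnb (f : B -> R) ->
  hmc (fun y => a * f y) q = a * hmc f q.
Proof.
move=> a0 bf; have [b1 _] := nnb_section q (nnb_hmc_step bf).
rewrite /hmc -bexpZ//; congr Rintegral; apply/funext => p.
by rewrite /hmc_step /=; ring.
Qed.

Lemma hmc1 q : hmc (fun=> 1) q = 1.
Proof.
rewrite /hmc -[RHS](bexp_cst gaussV 1); congr Rintegral; apply/funext => p.
by rewrite /hmc_step !mul1r subrKC.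
Qed.

Section reversible.
Variable Z : R.
Hypothesis Z0 : 0 < Z.
Hypothesis ZE : leb_int (fun q => (expR (- U q))%:E) = Z%:E.

Let dens q := expR (- U q) / Z.

Let mexpU : measurable_fun (setT : set B) (fun q : V => expR (- U q)).
Proof. by apply: measurableT_comp => //; exact: measurable_funN. Qed.

Let mdens : measurable_fun (setT : set B) dens.
Proof. by apply: measurable_funM => //; exact: measurable_cst. Qed.

Let dens_ge0 q : 0 <= dens q.
Proof. by rewrite divr_ge0 ?expR_ge0// ltW. Qed.

Let dens1 : (\int[leb]_q (dens q)%:E = 1)%E.
Proof.
under eq_integral do rewrite /dens mulrC EFinM.
rewrite ge0_integralZl_EFin//.
- rewrite integral_lebV.
  + by rewrite ZE -EFinM mulVf// gt_eqF.
  + exact/measurable_EFinP.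
  + by move=> q; rewrite lee_fin expR_ge0.
- exact/measurable_EFinP.
- by rewrite invr_ge0 ltW.
Qed.

Definition gibbs : probability B R := density_prob mdens dens_ge0 dens1.

Lemma gibbsE (A : set V) : measurable (A : set B) -> gibbs A = target U A.
Proof.
move=> mA; rewrite density_probE /target ZE/= integral_mkcond.
rewrite muleC -integral_lebV//.
- rewrite -ge0_integralZl_EFin//.
  + apply: eq_integral => q _; rewrite patchE indicE; case: ifPn => _.
      by rewrite mul1r -EFinM /dens mulrC.
    by rewrite mul0r mule0.
  + apply/measurable_EFinP; apply: measurable_funM => //; exact: measurable_indic.
  + by rewrite invr_ge0 ltW.
- by apply/measurable_EFinP; apply: measurable_funM => //; exact: measurable_indic.
Qed.

Lemma bexp_gibbs (f : V -> R) : nnb (f : B -> R) ->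
  (Rintegral gibbs setT f)%:E = (\int[leb]_q (f q * dens q)%:E)%E.
Proof.
move=> [bf f0]; rewrite bexp_EFin// integral_density_prob//.
by apply/measurable_EFinP; case: bf.
Qed.

(** The joint density of position and momentum, proportional to [expR (- ham U z)]. *)
Let weight (z : V * V) : R := gauss z.2 * dens z.1.

Let weight_ge0 z : 0 <= weight z.
Proof. by rewrite mulr_ge0 ?gauss_ge0. Qed.

Let mweight : measurable_fun (setT : set BB) weight.
Proof.
apply: measurable_funM; first exact: (measurableT_comp (@measurable_gauss R d) measurable_snd).
exact: (measurableT_comp mdens measurable_fst).
Qed.

Let weightE z : weight z = Num.sqrt (2 * pi) ^- d / Z * expR (- ham U z).
Proof.
rewrite /weight /gauss /dens /ham opprD expRD.
by ring.
Qed.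

(* The proposal followed by a momentum flip is an involution exchanging [ham z] and
   [ham (Phi z)]. *)
Let acc_weight_flip z : acc (flip (Phi z)) * weight (flip (Phi z)) = acc z * weight z.
Proof.
have hK : Phi (flip (Phi z)) = flip z := leapfrogT_flipK U h T z.
have sub (a b : R) : a - b - a = - b by rewrite addrAC subrr add0r.
rewrite !weightE /acc /accept hK !ham_flip.
rewrite [LHS]mulrCA [RHS]mulrCA; congr (_ * _).
by rewrite !minr_pMl ?expR_ge0// !mul1r -!expRD !sub minC.
Qed.

(** The rejected part is symmetric in [f] and [g] as it stands. In the accepted part the
    substitution [z -> flip (Phi z)] preserves volume, exchanges the two end positions and keeps the
    factor [acc z * weight z]. *)
Lemma hmc_sym (f g : V -> R) : nnb (f : B -> R) -> nnb (g : B -> R) ->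
  Rintegral gibbs setT (fun q => hmc f q * g q) = Rintegral gibbs setT (fun q => f q * hmc g q).
Proof.
suff main f' g' : nnb (f' : B -> R) -> nnb (g' : B -> R) ->
   (Rintegral gibbs setT (fun q => hmc f' q * g' q))%:E =
   (phase_int (fun z => (f' (Phi z).1 * g' z.1 * (acc z * weight z))%:E) +
    phase_int (fun z => (f' z.1 * g' z.1 * ((1 - acc z) * weight z))%:E))%E.
  move=> bf bg; apply: EFin_inj.
  have [[mf _] f0] := bf; have [[mg _] g0] := bg.
  pose F z := (g (Phi z).1 * f z.1 * (acc z * weight z))%:E.
  have mF : measurable_fun (setT : set BB) F.
    apply/measurable_EFinP; apply: measurable_funM.
      apply: measurable_funM; last exact: (measurableT_comp mf measurable_fst).
      exact: (measurableT_comp mg (measurableT_comp measurable_fst mPhi)).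
    by apply: measurable_funM; [exact: measurable_acc|exact: mweight].
  have F0 z : (0 <= F z)%E by rewrite lee_fin mulr_ge0// mulr_ge0.
  have e1 : phase_int (fun z => (f (Phi z).1 * g z.1 * (acc z * weight z))%:E) = phase_int F.
    transitivity (phase_int ((F \o @flip R d) \o Phi)).
      congr phase_int; apply/funext => z; rewrite /F /= acc_weight_flip.
      have -> : Phi (flip (Phi z)) = flip z := leapfrogT_flipK U h T z.
      by rewrite /= [f _ * _]mulrC.
    rewrite (phase_int_leapfrogT h cgU T (measurableT_comp mF (@measurable_flip R d))).
      exact: phase_int_flip.
    by move=> z; exact: F0.
  have e2 : phase_int (fun z => (f z.1 * g z.1 * ((1 - acc z) * weight z))%:E) =
      phase_int (fun z => (g z.1 * f z.1 * ((1 - acc z) * weight z))%:E).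
    by congr phase_int; apply/funext => z; rewrite [f _ * _]mulrC.
  have e3 : (fun q => f q * hmc g q) = (fun q => hmc g q * f q).
    by apply/funext => q; rewrite mulrC.
  by rewrite (main _ _ bf bg) e1 e2 e3 (main _ _ bg bf).
move=> bf bg; have bh := hmc_nnb bf.
have [[mf _] f0] := bf; have [[mg _] g0] := bg.
rewrite bexp_gibbs; last first.
  by split=> [|q]; [apply: bmeasM; [case: bh|case: bg]|rewrite mulr_ge0//; case: bh].
have m1 : measurable_fun (setT : set BB) (fun z => (f' (Phi z).1 * g' z.1 * (acc z * weight z))%:E).
  apply/measurable_EFinP; apply: measurable_funM.
    apply: measurable_funM; last exact: (measurableT_comp mg measurable_fst).
    exact: (measurableT_comp mf (measurableT_comp measurable_fst mPhi)).
  by apply: measurable_funM; [exact: measurable_acc|exact: mweight].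
have m2 : measurable_fun (setT : set BB) (fun z => (f' z.1 * g' z.1 * ((1 - acc z) * weight z))%:E).
  apply/measurable_EFinP; apply: measurable_funM.
    by apply: measurable_funM; [exact: (measurableT_comp mf measurable_fst)|
      exact: (measurableT_comp mg measurable_fst)].
  apply: measurable_funM; last exact: mweight.
  by apply: measurable_funB; [exact: measurable_cst|exact: measurable_acc].
have p1 z : (0 <= (f' (Phi z).1 * g' z.1 * (acc z * weight z))%:E)%E.
  by rewrite lee_fin; apply: mulr_ge0; [apply: mulr_ge0; [exact: f0|exact: g0]|exact: mulr_ge0].
have p2 z : (0 <= (f' z.1 * g' z.1 * ((1 - acc z) * weight z))%:E)%E.
  have a1 : 0 <= 1 - acc z by rewrite subr_ge0 acc_le1.
  by rewrite lee_fin; apply: mulr_ge0; [apply: mulr_ge0; [exact: f0|exact: g0]|exact: mulr_ge0].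
rewrite /phase_int -ge0_integralD//; last 4 first.
- by move=> q _; apply: integral_ge0 => p _; exact: p1.
- exact: measurable_phase_inner m1 p1.
- by move=> q _; apply: integral_ge0 => p _; exact: p2.
- exact: measurable_phase_inner m2 p2.
apply: eq_integral => q _.
rewrite -ge0_integralD//; [|exact: (measurable_slicel q m1)|exact: (measurable_slicel q m2)].
rewrite (_ : hmc f' q * g' q * dens q = (g' q * dens q) * hmc f' q); last by ring.
rewrite EFinM hmc_phase// -ge0_integralZl_EFin//.
- apply: eq_integral => p _; rewrite -EFinM -EFinD; congr EFin.
  by rewrite /hmc_step /weight /=; ring.
- by move=> p _; rewrite lee_fin mulr_ge0 ?gauss_ge0//; case: (nnb_hmc_step bf).
- apply/measurable_EFinP; apply: measurable_funM; last exact: measurable_gauss.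
  by have [[]] := nnb_section q (nnb_hmc_step bf).
- by rewrite mulr_ge0.
Qed.

End reversible.

End hmc.

(** * Surjectivity of the leapfrog map in the momentum *)

Section euclid.
Context (R : realType) (d : nat).
Local Notation V := 'rV[R]_d.

Definition sq (v : V) : R := \sum_i v ord0 i ^+ 2.

Lemma sq_ge0 v : 0 <= sq v.
Proof. by apply: sumr_ge0 => i _; rewrite sqr_ge0. Qed.

Lemma sq0 : sq 0 = 0.
Proof. by apply: big1 => i _; rewrite mxE expr0n. Qed.

Lemma sqN v : sq (- v) = sq v.
Proof. by apply: eq_bigr => i _; rewrite mxE sqrrN. Qed.

Lemma sqZ a v : sq (a *: v) = a ^+ 2 * sq v.
Proof. by rewrite mulr_sumr; apply: eq_bigr => i _; rewrite mxE exprMn. Qed.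

Lemma sqD_le u v : sq (u + v) <= 2 * sq u + 2 * sq v.
Proof.
rewrite !mulr_sumr -big_split/=; apply: ler_sum => i _; rewrite mxE.
by rewrite -subr_ge0 (_ : _ - _ = (u ord0 i - v ord0 i) ^+ 2) ?sqr_ge0//; ring.
Qed.

Lemma sqB_le u v : sq (u - v) <= 2 * sq u + 2 * sq v.
Proof. by rewrite -(sqN v); exact: sqD_le. Qed.

Lemma sq_add_ebasis (v : V) (t : R) j :
  sq (v + t *: ebasis R j) = sq v + 2 * t * v ord0 j + t ^+ 2.
Proof.
rewrite /sq (bigD1 j)//= [in RHS](bigD1 j)//= !mxE !eqxx /= mulr1.
rewrite (eq_bigr (fun i => v ord0 i ^+ 2)); first by ring.
by move=> i ij; rewrite !mxE /= (negbTE ij) mulr0 addr0.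
Qed.

Lemma coord_le_sq (v : V) r i : 0 <= r -> sq v <= r ^+ 2 -> `|v ord0 i| <= r.
Proof.
move=> r0 vr; rewrite -(ler_pXn2r (n := 2))// ?nnegrE// real_normK ?num_real//.
apply: le_trans vr; rewrite /sq (bigD1 i)//= lerDl.
by apply: sumr_ge0 => j _; rewrite sqr_ge0.
Qed.

Lemma rV_norm_le (v : V) r : 0 <= r -> (forall i, `|v ord0 i| <= r) -> `|v| <= r.
Proof.
move=> r0 h; rewrite [leLHS]/Num.norm/= mx_normrE; apply: bigmax_le => // -[i j] _.
by rewrite /= ord1.
Qed.

Lemma coord_le_norm (v : V) i : `|v ord0 i| <= `|v|.
Proof.
rewrite [leRHS]/Num.norm/= mx_normrE; apply/bigmax_geP; right.
by exists (ord0, i).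
Qed.

Lemma sq_le_norm (v : V) : sq v <= d%:R * `|v| ^+ 2.
Proof.
rewrite mulr_natl -[X in _ *+ X]card_ord -sumr_const; apply: ler_sum => i _.
by rewrite -[leLHS]real_normK ?num_real// ler_pXn2r ?nnegrE// coord_le_norm.
Qed.

Lemma norm_le_sq (v : V) r : 0 <= r -> sq v <= r ^+ 2 -> `|v| <= r.
Proof. by move=> r0 vr; apply: rV_norm_le => // i; exact: coord_le_sq. Qed.

Lemma continuous_rV (X : topologicalType) (f : X -> V) :
  (forall i, continuous (fun x => f x ord0 i)) -> continuous f.
Proof.
move=> cf x; apply/cvgrPdist_lt => e e0.
have : \forall y \near x, forall i, `|f x ord0 i - f y ord0 i| < e.
  by apply: filter_forall => i; have /cvgrPdist_lt := cf i x; apply.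
apply: filterS => y h; have := (ball_rVP (f x) (f y) e0).2 h.
by rewrite -ball_normE.
Qed.

Lemma continuous_sq : continuous sq.
Proof.
have -> : sq = fun v : V => \sum_(i <- index_enum 'I_d) v ord0 i ^+ 2 by [].
elim: (index_enum _) => [|i s ih].
  by under eq_fun do rewrite big_nil; exact: cst_continuous.
under eq_fun do rewrite big_cons.
move=> v; apply: (@cvgD _ _ _ _ (nbhs_filter v) (fun v : V => v ord0 i ^+ 2)); [|exact: ih].
rewrite (_ : (fun v : V => v ord0 i ^+ 2) = (fun v : V => v ord0 i * v ord0 i)) ?expr2//.
by apply: cvgM; exact: coord_continuous.
Qed.

End euclid.

(* First order condition at a minimum, for the displacement [t] of one coordinate. *)
Lemma critical_of_min (R : realType) (phi : R -> R) (a c D : R) :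
  (fun t => t^-1 * phi t) @ 0^' --> D ->
  (forall t, 0 <= t * a + t ^+ 2 - c * phi t) -> a = c * D.
Proof.
move=> phiD h.
have lim : (fun t => a + t - c * (t^-1 * phi t)) @ 0^' --> a - c * D.
  apply: cvgB; last exact: cvgMr.
  rewrite -[X in _ --> X]addr0; apply: cvgD; first exact: cvg_cst.
  exact: cvg_within.
have sgn t : t != 0 -> 0 <= t * (a + t - c * (t^-1 * phi t)).
  move=> t0; rewrite (_ : _ * _ = t * a + t ^+ 2 - c * phi t)//.
  by field.
have close e : 0 < e -> `|a - c * D| <= e.
  move=> e0; have /cvgrPdist_lt/(_ _ e0) := lim.
  move/nbhs_ballP => [r /= r0 hr].
  have hball t : `|t| < r -> t != 0 -> `|a - c * D - (a + t - c * (t^-1 * phi t))| < e.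
    by move=> tr t0; apply: hr => //; rewrite -ball_normE /= sub0r normrN.
  have r20 : 0 < r / 2 by rewrite divr_gt0.
  have h1 := hball (r / 2) _ (lt0r_neq0 r20).
  have h2 := hball (- (r / 2)) _ _.
  have s1 := sgn (r / 2) (lt0r_neq0 r20).
  have s2 := sgn (- (r / 2)) _.
  rewrite pmulr_rge0// in s1; rewrite oppr_eq0 (lt0r_neq0 r20) nmulr_rge0 ?oppr_lt0// in s2.
  rewrite normrN gtr0_norm// oppr_eq0 (lt0r_neq0 r20) in h2; rewrite gtr0_norm// in h1.
  have rr : r / 2 < r by lra.
  have {}h1 := h1 rr; have {}h2 := h2 rr isT; have {}s2 := s2 isT.
  move: h1 h2; rewrite !ltr_norml => /andP[h1 _] /andP[_ h2].
  by rewrite ler_norml; apply/andP; split; lra.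
apply/eqP; rewrite -subr_eq0 -normr_le0; apply/ler_addgt0Pl => e e0.
by rewrite addr0; exact: close.
Qed.

(** Meant for the kinetic sum: a displacement of the point [m] of a path is seen by the increments
    [m - 1] and [m]. *)
Lemma sum_two_terms (R : ringType) (T m : nat) (F G : nat -> R) : (0 < m < T)%N ->
  (forall k, k != m -> k != m.-1 -> F k = G k) ->
  \sum_(0 <= k < T) F k - \sum_(0 <= k < T) G k = (F m.-1 - G m.-1) + (F m - G m).
Proof.
move=> /andP[m0 mT] FG; rewrite -sumrB big_mkord.
have m1T : (m.-1 < T)%N by lia.
rewrite (bigD1 (Ordinal m1T))//= (bigD1 (Ordinal mT))/=; last first.
  by rewrite -val_eqE /=; lia.
rewrite big1 ?addr0// => i /andP[]; rewrite -!val_eqE /= => i1 i2.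
by rewrite FG ?subrr.
Qed.

Lemma sum_one_term (R : ringType) (T m : nat) (F G : nat -> R) : (0 < m < T)%N ->
  (forall k, k != m -> F k = G k) ->
  \sum_(1 <= k < T) F k - \sum_(1 <= k < T) G k = F m - G m.
Proof.
move=> /andP[m0 mT] FG; rewrite -sumrB (big_cat_nat _ (n := m))//=; last exact: ltnW.
rewrite big_nat big1 ?add0r; last by move=> k hk; rewrite FG ?subrr//; lia.
rewrite big_ltn// big_nat big1 ?addr0// => k hk; rewrite FG ?subrr//; lia.
Qed.

Section action.
Context (R : realType) (d : nat).
Local Notation V := 'rV[R]_d.
Variables (U : V -> R) (h : R) (T : nat).
Hypothesis T0 : (0 < T)%N.
Hypothesis h0 : 0 < h.
Hypothesis dU : forall q, differentiable U q.

Implicit Types x : nat -> V.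

Definition energy x := \sum_(0 <= k < T) sq (x k.+1 - x k).

(* Leapfrog trajectories are the critical points of this discrete action. *)
Definition action x := energy x / 2 - h ^+ 2 * \sum_(1 <= k < T) U (x k).

Definition move x m (v : V) k := if k == m then x k + v else x k.

Lemma action_move x m (t : R) (j : 'I_d) : (0 < m < T)%N ->
  action (move x m (t *: ebasis R j)) - action x =
  t * (2 * x m ord0 j - x m.-1 ord0 j - x m.+1 ord0 j) + t ^+ 2
  - h ^+ 2 * (U (x m + t *: ebasis R j) - U (x m)).
Proof.
move=> mT; set y := move _ _ _.
have m_gt0 : (0 < m)%N by case/andP: mT.
have yE k : k != m -> y k = x k by rewrite /y /move => /negbTE ->.
have ym : y m = x m + t *: ebasis R j by rewrite /y /move eqxx.
have -> : action y - action x = (energy y - energy x) / 2 -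
    h ^+ 2 * (\sum_(1 <= k < T) U (y k) - \sum_(1 <= k < T) U (x k)).
  by rewrite /action; ring.
rewrite (sum_one_term (F := U \o y) (G := U \o x) mT) => [|k km]; last by rewrite /= yE.
rewrite /energy (sum_two_terms (F := fun k => sq (y k.+1 - y k))
  (G := fun k => sq (x k.+1 - x k)) mT); last first.
  by move=> k km km1; rewrite !yE//; lia.
rewrite /= prednK// ym !yE; try lia.
rewrite (_ : x m + t *: ebasis R j - x m.-1 = (x m - x m.-1) + t *: ebasis R j); last first.
  by rewrite addrAC.
rewrite (_ : x m.+1 - (x m + t *: ebasis R j) = (x m.+1 - x m) + (- t) *: ebasis R j); last first.
  by rewrite opprD addrA scaleNr.
rewrite !sq_add_ebasis !mxE; by field.
Qed.

Lemma grad_limit (q : V) (j : 'I_d) :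
  (fun t => t^-1 * (U (q + t *: ebasis R j) - U q)) @ 0^' --> grad U q ord0 j.
Proof.
rewrite mxE; have : derivable U q (ebasis R j) by exact: diff_derivable.
move=> cU.
rewrite (_ : (fun t => _) = fun t => t^-1 *: ((U \o shift q) (t *: ebasis R j) - U q)).
  exact: cU.
by apply/funext => t; rewrite /= (addrC q).
Qed.

Lemma euler_lagrange x m : (0 < m < T)%N ->
  (forall t j, action x <= action (move x m (t *: ebasis R j))) ->
  2%:R *: x m - x m.-1 - x m.+1 = h ^+ 2 *: grad U (x m).
Proof.
move=> mT hmin; apply/rowP => j; rewrite [RHS]mxE.
rewrite -(critical_of_min (@grad_limit (x m) j)
  (a := 2 * x m ord0 j - x m.-1 ord0 j - x m.+1 ord0 j) (c := h ^+ 2)).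
  by rewrite !mxE.
by move=> t; rewrite -action_move// subr_ge0.
Qed.

(** Eliminating the momentum from the leapfrog recursion gives the Euler-Lagrange equation: at an
    interior point two half kicks of size [h / 2] add up. *)
Lemma leapfrog_of_euler_lagrange x :
  (forall m, (0 < m < T)%N -> 2%:R *: x m - x m.-1 - x m.+1 = h ^+ 2 *: grad U (x m)) ->
  let p := h^-1 *: (x 1%N - x 0%N) + (h / 2) *: grad U (x 0%N) in
  (leapfrogT U h T (x 0%N, p)).1 = x T.
Proof.
move=> EL p; pose mom k := h^-1 *: (x k.+1 - x k) + (h / 2) *: grad U (x k).
have step k : leapfrog U h (x k, mom k) =
    (x k.+1, h^-1 *: (x k.+1 - x k) - (h / 2) *: grad U (x k.+1)).
  rewrite /leapfrog /Psi1 /Psi2 /mom /= addrK scalerA mulfV ?gt_eqF// scale1r.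
  by rewrite (addrC (x k)) subrK.
have traj k : (k < T)%N -> leapfrogT U h k (x 0%N, p) = (x k, mom k).
  elim: k => [//|k ih] kT; rewrite /leapfrogT iterS -/(leapfrogT U h k _) ih ?(ltnW kT)//.
  rewrite step; congr pair; have := EL k.+1 kT => /= el.
  apply/rowP => j; move/rowP/(_ j): el; rewrite !mxE => el.
  have hn0 : h != 0 by rewrite gt_eqF.
  apply: (mulfI hn0); rewrite /GRing.exp /= in el.
  have -> : h * (h^-1 * (x k.+1 ord0 j - x k ord0 j) - h / 2 * 'D_(ebasis R j) U (x k.+1)) =
    x k.+1 ord0 j - x k ord0 j - (h * h * 'D_(ebasis R j) U (x k.+1)) / 2 by field.
  have -> : h * (h^-1 * (x k.+2 ord0 j - x k.+1 ord0 j) + h / 2 * 'D_(ebasis R j) U (x k.+1)) =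
    x k.+2 ord0 j - x k.+1 ord0 j + (h * h * 'D_(ebasis R j) U (x k.+1)) / 2 by field.
  by rewrite -el; field.
(* [mom T] would involve [x T.+1], so the trajectory formula stops at [T - 1] and the last step is
   read on the position only. *)
rewrite -(prednK T0) /leapfrogT iterS -/(leapfrogT U h _ _) traj ?prednK//.
by rewrite step /= prednK.
Qed.

Section coercivity.
Variable K : R.
Hypothesis U_le : forall q, h ^+ 2 * U q <= (4 * T%:R * 2 ^+ T)^-1 * sq q + K.
Hypothesis K0 : 0 <= K.

(** Each increment costs a factor 2 through [sqD_le], hence the power of 2. *)
Lemma sq_path_le x k : (k <= T)%N -> sq (x k) <= 2 ^+ T * (sq (x 0%N) + energy x).
Proof.
move=> kT.
have h1 n : sq (x n) <= 2 ^+ n * (sq (x 0%N) + \sum_(0 <= j < n) sq (x j.+1 - x j)).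
  elim: n => [|n ih]; first by rewrite big_geq// addr0 mul1r.
  rewrite big_nat_recr//= -{1}(subrK (x n) (x n.+1)).
  apply: (le_trans (sqD_le _ _)).
  have e1 : 1 <= 2 ^+ n :> R by rewrite exprn_ege1// ler1n.
  have e2 : sq (x n.+1 - x n) <= 2 ^+ n * sq (x n.+1 - x n) by rewrite ler_peMl// sq_ge0.
  rewrite exprS addrA -[leRHS]mulrA mulrDr.
  by rewrite [leRHS]mulrDr [leLHS]addrC; apply: lerD; rewrite ler_pM2l.
apply: (le_trans (h1 k)); apply: ler_pM => //.
- by rewrite addr_ge0 ?sq_ge0// sumr_ge0// => j _; rewrite sq_ge0.
- by rewrite ler_eXn2l// ltr1n.
- rewrite lerD2l /energy [leRHS](@big_cat_nat _ _ _ k)//= lerDl.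
  by apply: sumr_ge0 => j _; rewrite sq_ge0.
Qed.

Lemma energy_ge0 x : 0 <= energy x.
Proof. by apply: sumr_ge0 => j _; rewrite sq_ge0. Qed.

(** With the constant of [U_le], each potential term is at most [(sq (x 0) + energy x) / (4 T) + K];
    together they take at most half of the kinetic part [energy x / 2]. *)
Lemma action_ge x : energy x / 4 - sq (x 0%N) / 4 - T%:R * K <= action x.
Proof.
have T0' : 0 < T%:R :> R by rewrite ltr0n.
have e0 : 0 < 2 ^+ T :> R by rewrite exprn_gt0.
set B := sq (x 0%N) + energy x.
have B0 : 0 <= B by rewrite addr_ge0 ?sq_ge0// energy_ge0.
have : h ^+ 2 * \sum_(1 <= k < T) U (x k) <= \sum_(1 <= k < T) ((4 * T%:R)^-1 * B + K).
  rewrite mulr_sumr big_nat [leRHS]big_nat; apply: ler_sum => k /andP[k0 kT].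
  apply: (le_trans (U_le _)); rewrite lerD2r.
  rewrite !invfM -!mulrA !ler_pM2l ?invr_gt0// mulrC ler_pdivrMr// mulrC.
  exact/sq_path_le/ltnW.
rewrite sumr_const_nat -mulr_natr => h1.
have h2 : ((4 * T%:R)^-1 * B + K) * (T - 1)%:R <= B / 4 + T%:R * K.
  apply: (@le_trans _ _ (((4 * T%:R)^-1 * B + K) * T%:R)).
    rewrite ler_wpM2l ?ler_nat ?leq_subr// addr_ge0// mulr_ge0// invr_ge0 mulr_ge0//.
  have Tn0 : T%:R != 0 :> R by rewrite gt_eqF.
  by rewrite (_ : _ * T%:R = B / 4 + T%:R * K)//; field.
by rewrite /action; rewrite /B in h1 h2 *; lra.
Qed.

End coercivity.

End action.

Lemma continuous_sum_nat (R : realType) (X : topologicalType) (a b : nat) (F : nat -> X -> R) :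
  (forall k, continuous (F k)) -> continuous (fun x => \sum_(a <= k < b) F k x).
Proof.
move=> cF; elim: (index_iota a b) => [|k s ih].
  by under eq_fun do rewrite big_nil; exact: cst_continuous.
under eq_fun do rewrite big_cons.
by move=> x; apply: (@cvgD _ _ _ _ (nbhs_filter x) (F k)); [exact: cF|exact: ih].
Qed.

Lemma compact_norm_le (R : realType) n (r : R) : 0 < r ->
  compact [set w : 'rV[R]_n | `|w| <= r].
Proof.
move=> r0; rewrite (_ : [set w | _] = closed_ball (0 : 'rV[R]_n) r); last first.
  by rewrite closed_ballE//; apply/seteqP; split => w /=; rewrite /closed_ball_/= sub0r normrN.
apply: bounded_closed_compact; last exact: closed_ball_closed.
exists r; split; first exact: num_real.
move=> M rM w; rewrite closed_ballE// /closed_ball_/= sub0r normrN => wr.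
exact/ltW/(le_lt_trans wr).
Qed.

Section surjectivity.
Context (R : realType) (d : nat).
Local Notation V := 'rV[R]_d.
Variables (U : V -> R) (h : R) (T : nat).
Hypothesis T0 : (0 < T)%N.
Hypothesis h0 : 0 < h.
Hypothesis dU : forall q, differentiable U q.
Variable K : R.
Hypothesis U_le : forall q, h ^+ 2 * U q <= (4 * T%:R * 2 ^+ T)^-1 * sq q + K.
Hypothesis K0 : 0 <= K.
Hypothesis gradU_bounded : forall r, exists G, forall q, sq q <= r -> sq (grad U q) <= G.

Local Notation n := T.-1.
Local Notation W := 'rV[R]_(n * d).

(* The position sequences with endpoints [q] and [y], parametrised by the intermediate points. *)
Definition bridge (q y : V) (w : W) (k : nat) : V :=
  if k is k'.+1 then (if insub k' is Some i then row i (vec_mx w) else y) else q.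

Lemma bridge_end q y w : bridge q y w T = y.
Proof. by rewrite -(prednK T0) /= insubF// ltnn. Qed.

Lemma bridge_mid q y w (i : 'I_n) : bridge q y w i.+1 = row i (vec_mx w).
Proof. by rewrite /= valK. Qed.

Lemma continuous_bridge q y k : continuous (fun w => bridge q y w k).
Proof.
case: k => [|k]; first exact: cst_continuous.
rewrite /bridge; case: insub => [i|]; last exact: cst_continuous.
apply: continuous_rV => j; rewrite (_ : (fun w => _) = (fun w : W => w ord0 (mxvec_index i j))).
  exact: coord_continuous.
by apply/funext => w; rewrite !mxE.
Qed.

(** Varying one coordinate of the parameter displaces one intermediate point, so minimality in [w]
    yields the hypothesis of [euler_lagrange]. *)
Lemma bridge_move q y w (i : 'I_n) (j : 'I_d) t k :
  bridge q y (w + t *: delta_mx ord0 (mxvec_index i j)) k =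
  move (bridge q y w) i.+1 (t *: ebasis R j) k.
Proof.
rewrite /move; case: k => [|k] //; rewrite /= eqSS.
case: insubP => [i' ki' <-|ki].
  apply/rowP => l; rewrite linearD linearZ /= vec_mx_delta !mxE.
  rewrite (_ : (val i' == i)%N = (i' == i))//; case: eqP => _; rewrite ?mxE ?eqxx//=.
  by rewrite mulr0 addr0.
by case: eqP => // ki'; rewrite ki' ltn_ord in ki.
Qed.

Lemma continuous_action q y : continuous (fun w => action U h T (bridge q y w)).
Proof.
have cb k : continuous (fun w => bridge q y w k) := @continuous_bridge q y k.
have cE : continuous (fun w => energy T (bridge q y w)).
  apply: continuous_sum_nat => k w.
  apply: (@continuous_comp _ _ _ (fun w => bridge q y w k.+1 - bridge q y w k) (@sq R d)).
    by apply: (@cvgB _ _ _ _ (nbhs_filter w)); exact: cb.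
  exact: continuous_sq.
have cS : continuous (fun w => \sum_(1 <= k < T) U (bridge q y w k)).
  apply: continuous_sum_nat => k w.
  apply: (@continuous_comp _ _ _ (fun w => bridge q y w k) U); first exact: cb.
  exact/differentiable_continuous/dU.
move=> w; apply: (@cvgB _ _ _ _ (nbhs_filter w)).
  by apply: cvgM; [exact: cE|exact: cvg_cst].
by apply: cvgM; [exact: cvg_cst|exact: cS].
Qed.

(** The path with all intermediate points at the origin is the competitor that bounds the minimal
    action uniformly in the endpoints. *)
Lemma action_bridge0_le q y r : sq q <= r -> sq y <= r ->
  action U h T (bridge q y 0) <= 2 * T%:R * r + h ^+ 2 * (T%:R * `|U 0|).
Proof.
move=> qr yr; have r0 : 0 <= r := le_trans (sq_ge0 q) qr.
have b0 k : (0 < k < T)%N -> bridge q y 0 k = 0.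
  case: k => // k /andP[_ kT]; have kn : (k < n)%N by lia.
  rewrite -[k]/(val (Ordinal kn)) bridge_mid.
  by apply/rowP => j; rewrite !mxE.
have bk k : (k <= T)%N -> sq (bridge q y 0 k) <= r.
  case: k => [//|k] kT; have [kT'|kT'] := ltnP k.+1 T.
    by rewrite b0 ?sq0//.
  by rewrite (_ : k.+1 = T) ?bridge_end//; apply/eqP; rewrite eqn_leq kT.
rewrite /action; apply: lerD.
  rewrite ler_pdivrMr// /energy.
  apply: (@le_trans _ _ (\sum_(0 <= k < T) (4 * r))).
    rewrite big_nat [leRHS]big_nat; apply: ler_sum => k /andP[_ kT].
    apply: (le_trans (sqB_le _ _)).
    by have := bk _ kT; have := bk _ (ltnW kT); lra.
  by rewrite sumr_const_nat subn0 -mulr_natr; lra.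
rewrite -mulrN ler_wpM2l ?sqr_ge0// -sumrN.
apply: (@le_trans _ _ (\sum_(1 <= k < T) `|U 0|)).
  rewrite big_nat [leRHS]big_nat; apply: ler_sum => k kT; rewrite b0//.
  by rewrite -normrN ler_norm.
by rewrite sumr_const_nat -[leLHS]mulr_natl ler_wpM2r// ler_nat leq_subr.
Qed.

(** Coercivity: [action_ge] bounds the energy, and [sq_path_le] then bounds every intermediate
    point, hence [w]. *)
Lemma bridge_sublevel q y w r C : sq q <= r -> action U h T (bridge q y w) <= C ->
  energy T (bridge q y w) <= 4 * (C + r / 4 + T%:R * K) /\
  `|w| <= Num.sqrt (2 ^+ T * (r + 4 * (C + r / 4 + T%:R * K))).
Proof.
move=> qr aC.
have E : energy T (bridge q y w) <= 4 * (C + r / 4 + T%:R * K).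
  have := action_ge T0 U_le K0 (bridge q y w); rewrite [bridge q y w 0]/= => h1.
  by move: h1 aC qr; lra.
split => //; set rho := 2 ^+ T * _.
have sq_le k : (k <= T)%N -> sq (bridge q y w k) <= rho.
  move=> kT; apply: (le_trans (sq_path_le _ kT)); rewrite ler_wpM2l ?exprn_ge0//.
  exact: lerD.
have rho0 : 0 <= rho := le_trans (sq_ge0 _) (sq_le _ (leqnn T)).
apply: rV_norm_le => [|k]; first exact: sqrtr_ge0.
case/mxvec_indexP: k => i j.
have := sq_le i.+1; rewrite bridge_mid => h1.
have := @coord_le_sq _ _ (row i (vec_mx w)) (Num.sqrt rho) j (sqrtr_ge0 _).
rewrite !mxE sqr_sqrtr//; apply; apply: h1.
by have := ltn_ord i; lia.
Qed.

(** The parameter [0] has action [C], so a minimiser over a compact ball containing [0] and the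
    sublevel set of [C] is a global one. *)
Lemma bridge_minimizer q y : exists w, forall w',
  action U h T (bridge q y w) <= action U h T (bridge q y w').
Proof.
set r := sq q; set C := action U h T (bridge q y 0).
have sub w : action U h T (bridge q y w) <= C -> `|w| <= _ :=
  fun h => (bridge_sublevel (lexx (sq q)) h).2.
set rho := Num.sqrt _ in sub.
have rho0 : 0 < rho + 1 by rewrite ltr_wpDl// sqrtr_ge0.
have [w _ hw] : exists2 w, w \in [set w : W | `|w| <= rho + 1] &
  forall w', w' \in [set w : W | `|w| <= rho + 1] ->
    action U h T (bridge q y w) <= action U h T (bridge q y w').
  apply: compact_EVT_min.
  - by exists 0; rewrite /= normr0 ltW.
  - exact: compact_norm_le.
  - by apply: continuous_subspaceT; exact: continuous_action.
exists w => w'; have [h1|h1] := leP (action U h T (bridge q y w')) C.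
  by apply: hw; rewrite inE /=; apply: (le_trans (sub _ h1)); rewrite lerDl.
apply: le_trans (ltW h1); apply: hw; rewrite inE /= normr0; exact: ltW.
Qed.

(** The initial momentum is read off the first increment of the minimising path, and the energy
    bound controls it. The uniformity of [rho] in the endpoints is what yields a uniform
    minorization. *)
Theorem leapfrogT_surjective r : exists rho, forall q y, sq q <= r -> sq y <= r ->
  exists2 p, sq p <= rho & (leapfrogT U h T (q, p)).1 = y.
Proof.
have [G hG] := gradU_bounded r.
set C := 2 * T%:R * r + h ^+ 2 * (T%:R * `|U 0|).
exists (2 * (h^-1 ^+ 2 * (4 * (C + r / 4 + T%:R * K))) + 2 * ((h / 2) ^+ 2 * G)) => q y qr yr.
have [w hw] := bridge_minimizer q y.
have wC : action U h T (bridge q y w) <= C.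
  exact: le_trans (hw 0) (action_bridge0_le qr yr).
have [E _] := bridge_sublevel qr wC.
have EL m : (0 < m < T)%N -> 2%:R *: bridge q y w m - bridge q y w m.-1 - bridge q y w m.+1 =
    h ^+ 2 *: grad U (bridge q y w m).
  move=> mT; apply: (euler_lagrange T0 h0 dU (x := bridge q y w) mT) => t j.
  have mn : (m.-1 < n)%N by lia.
  have := hw (w + t *: delta_mx ord0 (mxvec_index (Ordinal mn) j)).
  rewrite (_ : bridge q y (w + _) = move (bridge q y w) m (t *: ebasis R j))//.
  apply/funext => k; rewrite bridge_move /= prednK//; by case/andP: mT.
have := leapfrog_of_euler_lagrange T0 h0 EL; rewrite bridge_end.
set p := (_ + _) => hp; exists p => //.
apply: (le_trans (sqD_le _ _)); rewrite !sqZ; apply: lerD; rewrite ler_pM2l//.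
  rewrite ler_wpM2l ?sqr_ge0//; apply: le_trans E.
  rewrite /energy big_ltn// lerDl; apply: sumr_ge0 => k _; exact: sq_ge0.
by rewrite ler_wpM2l ?sqr_ge0//; exact: hG.
Qed.

End surjectivity.

(** * Images of Lebesgue measure under Lipschitz surjections *)

Section regularity.
Local Open Scope ereal_scope.
Context (R : realType) (d : nat).
Local Notation V := 'rV[R]_d.
Local Notation B := (borelV R d).

(** The inner parallel set: closed for any [A], and for open [A] it increases to [A] as [s]
    decreases to zero. *)
Definition erode (A : set V) (s : R) : set V := [set x | ball x s `<=` A].

Lemma closed_erode A s : closed (erode A s).
Proof.
rewrite (_ : erode A s = ~` \bigcup_(y in ~` A) ball y s).
  by apply: open_closedC; apply: bigcup_open => y _; exact: ball_open.
apply/seteqP; split => x /= h.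
  by move=> [y Ay] xy; apply: Ay; apply: h; exact: ball_sym.
by move=> y xy; apply: contrapT => Ay; apply: h; exists y => //; exact: ball_sym.
Qed.

Lemma open_measurableV (A : set V) : open A -> measurable (A : set B).
Proof. by move=> oA; exact: sub_sigma_algebra. Qed.

Lemma closed_measurableV (A : set V) : closed A -> measurable (A : set B).
Proof.
move=> cA; rewrite -(setCK A); apply: measurableC; apply: open_measurableV.
exact: closed_openC.
Qed.

Lemma nondecreasing_erode (A : set V) (m n : nat) : (m <= n)%N ->
  erode A m.+1%:R^-1 `<=` erode A n.+1%:R^-1.
Proof.
move=> mn x h y xy; apply: h; apply: le_ball xy.
by rewrite lef_pV2 ?posrE// ler_nat.
Qed.

Lemma bigcup_erode (A : set V) : open A -> \bigcup_n erode A n.+1%:R^-1 = A.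
Proof.
move=> oA; apply/seteqP; split => x.
  by move=> [n _]; apply; exact: ballxx.
move=> Ax; have /nbhs_ballP[e /= e0 he] : nbhs x A by exact: open_nbhs_nbhs.
exists (Num.truncn e^-1) => // y xy; apply: he; apply: le_ball xy.
by rewrite invf_ple ?posrE//; exact/ltW/truncnS_gt.
Qed.

Variable nu : {finite_measure set B -> \bar R}.

(** The sets that can be squeezed in this way form a sigma-algebra containing the open sets, hence
    include all Borel sets. *)
Let approx (A : set V) := forall e : R, (0 < e)%R -> exists F W : set V,
  [/\ closed F, open W, F `<=` A, A `<=` W & nu (W `\` F) <= e%:E].

Let mD (F W : set V) : closed F -> open W -> measurable (W `\` F : set B).
Proof.
by move=> cF oW; apply: measurableD; [exact: open_measurableV|exact: closed_measurableV].
Qed.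

Let approx_open A : open A -> approx A.
Proof.
move=> oA e e0; pose F n := erode A n.+1%:R^-1.
have : nu (A `\` F n) @[n --> \oo] --> nu (\bigcap_n (A `\` F n)).
  apply: (@nonincreasing_cvg_mu _ _ _ nu (fun n => (A `\` F n : set B))).
  - by rewrite -ge0_fin_numE// fin_num_measure//; apply: mD => //; exact: closed_erode.
  - by move=> n; apply: mD => //; exact: closed_erode.
  - by apply: bigcap_measurableType => n _; apply: mD => //; exact: closed_erode.
  - move=> m n mn; apply/subsetPset => x [Ax Fx]; split => // /(nondecreasing_erode mn).
    exact: Fx.
rewrite (_ : \bigcap_n _ = set0); last first.
  apply/seteqP; split => // x h.
  have Ax : A x by case: (h 0%N I).
  move: (Ax); rewrite -(bigcup_erode oA) => -[n _ Fnx].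
  by case: (h n I).
rewrite measure0 => /fine_cvgP[_]; move/cvgrPdist_le => /(_ _ e0)[n _ /(_ n (leqnn n))].
rewrite /= sub0r normrN => hn; exists (F n), A; split => //.
- exact: closed_erode.
- by move=> x; apply; exact: ballxx.
- rewrite -[leLHS]fineK; last by rewrite fin_num_measure//; apply: mD => //; exact: closed_erode.
  by rewrite lee_fin; exact: le_trans (ler_norm _) hn.
Qed.

Let approxC A : approx A -> approx (~` A).
Proof.
move=> hA e e0; have [F [W [cF oW FA AW nuWF]]] := hA _ e0.
exists (~` W), (~` F); split.
- exact: open_closedC.
- exact: closed_openC.
- exact: subsetC.
- exact: subsetC.
- by rewrite setDE setCK setIC -setDE.
Qed.

(** The open sets are united with errors [e / 2^(n + 2)]. A countable union of closed sets need not
    be closed, so finitely many are kept, at the cost of another [e / 2] by continuity from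
    above. *)
Let approx_bigcup (A : (set V)^nat) : (forall n, approx (A n)) -> approx (\bigcup_n A n).
Proof.
move=> hA e e0.
have e2 n : (0 < e / 2 / (2 ^ n.+1)%:R)%R by rewrite !divr_gt0// ltr0n expn_gt0.
have /choice[F /choice[W hFW]] := fun n => hA n _ (e2 n).
have cF n : closed (F n) by case: (hFW n).
have oW n : open (W n) by case: (hFW n).
pose W' := \bigcup_n W n; pose F' n := \bigcup_(k in `I_n) F k.
have cF' n : closed (F' n).
  rewrite /F' bigcup_mkord; elim/big_ind : _ => //.
  - exact: closed0.
  - by move=> X Y; exact: closedU.
have oW' : open W' by exact: bigcup_open.
have mF' n : measurable (F' n : set B) by exact: closed_measurableV.
have nu1 : nu (W' `\` \bigcup_n F n) <= (e / 2)%:E.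
  apply: (@le_trans _ _ (\sum_(0 <= n <oo) nu (W n `\` F n))).
    apply: (@measure_sigma_subadditive _ _ _ nu (W' `\` \bigcup_n F n : set B)
        (fun n => W n `\` F n : set B)).
    - by move=> n; exact: mD.
    - apply: measurableD; first exact: open_measurableV.
      by apply: bigcup_measurable => n _; exact: closed_measurableV.
    - by move=> x [[n _ Wx] Fx]; exists n => //; split => // Fnx; apply: Fx; exists n.
  apply: (@le_trans _ _ (\sum_(0 <= n <oo) (e / 2 / (2 ^ n.+1)%:R)%:E)).
    apply: lee_nneseries => n _ //; by case: (hFW n).
  by apply: epsilon_trick0; rewrite divr_ge0// ltW.
have mWF : measurable (W' `\` \bigcup_n F n : set B).
  apply: measurableD; first exact: open_measurableV.
  by apply: bigcup_measurable => n _; exact: closed_measurableV.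
have capE : \bigcap_n (W' `\` F' n) = W' `\` \bigcup_n F n.
  apply/seteqP; split => x h.
    split; first by case: (h 0%N I).
    by move=> [n _ Fx]; case: (h n.+1 I) => _; apply; exists n => /=.
  by move=> n _; split; [case: h|move=> [k _ Fx]; case: h => _; apply; exists k].
have : nu (W' `\` F' n) @[n --> \oo] --> nu (\bigcap_n (W' `\` F' n)).
  apply: (@nonincreasing_cvg_mu _ _ _ nu (fun n => (W' `\` F' n : set B))).
  - by rewrite -ge0_fin_numE// fin_num_measure//; exact: mD.
  - by move=> n; exact: mD.
  - by rewrite capE.
  - move=> m n mn; apply/subsetPset => x [Wx Fx]; split => // -[k /= km Fk].
    by apply: Fx; exists k => //=; exact: leq_trans mn.
have e20 : (0 < e / 2)%R by rewrite divr_gt0.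
rewrite capE -[X in _ --> X]fineK ?fin_num_measure// => /fine_cvgP[_].
move/cvgrPdist_le => /(_ _ e20)[n _ /(_ n (leqnn n))] /= hn.
exists (F' n), W'; split => //.
- by move=> x [k _ Fk]; exists k => //; have [_ _ h _ _] := hFW k; exact: h.
- by move=> x [k _ Ak]; exists k => //; have [_ _ _ h _] := hFW k; exact: h.
have mWn := mD (cF' n) oW'.
rewrite -[leLHS]fineK ?fin_num_measure// lee_fin.
move: nu1; rewrite -[leLHS]fineK ?fin_num_measure// lee_fin => nu1.
by move: hn; rewrite distrC => /(le_trans (ler_norm _)); lra.
Qed.

Lemma outer_regular (A : set V) (e : R) : measurable (A : set B) -> (0 < e)%R ->
  exists W : set V, [/\ open W, A `<=` W & nu (W `\` A) <= e%:E].
Proof.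
move=> mA e0.
have : (measurable : set (set B)) `<=` approx.
  apply: smallest_sub; last exact: approx_open.
  split => [|X|F].
  - by apply: approx_open; exact: open0.
  - by rewrite setTD; exact: approxC.
  - exact: approx_bigcup.
move=> /(_ _ mA _ e0)[F [W [cF oW FA AW h]]]; exists W; split => //.
apply: le_trans h; apply: le_measure; rewrite ?inE.
- by apply: measurableD => //; exact: open_measurableV.
- exact: mD.
- by move=> x [Wx Ax]; split => // /FA.
Qed.

End regularity.

Section lipschitz_surjection.
Local Open Scope ereal_scope.
Context (R : realType) (d : nat).
Local Notation V := 'rV[R]_d.
Local Notation B := (borelV R d).
Local Notation BB := (B * B)%type.
Local Notation leb := (@lebV R d).
Variables (f : V -> V) (L r rho : R).
Hypothesis mf : measurable_fun setT (f : B -> B).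
Hypothesis L0 : (0 < L)%R.
Hypothesis rho0 : (0 <= rho)%R.
Hypothesis f_lip : forall p p', (`|f p - f p'| <= L * `|p - p'|)%R.
Hypothesis f_surj : forall x, (`|x| < r)%R -> exists2 p, (`|p| <= rho)%R & f p = x.

(** The margin 1 leaves room for balls of radius [s / L <= 1] around preimages of norm at most
    [rho]. *)
Let D : set V := ball 0%R (rho + 1)%R.
Let rho1 : (0 < rho + 1)%R. Proof. by rewrite ltr_wpDl. Qed.

Definition image_leb (A : set B) : \bar R := leb (D `&` f @^-1` A).

Let mpre (A : set B) : measurable A -> measurable (D `&` f @^-1` A : set B).
Proof.
move=> mA; apply: measurableI; first exact: measurable_ball_rV.
by rewrite -[_ @^-1` _]setTI; exact: mf.
Qed.

Let image_leb0 : image_leb set0 = 0.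
Proof. by rewrite /image_leb preimage_set0 setI0 measure0. Qed.

Let image_leb_ge0 A : 0 <= image_leb A.
Proof. exact: measure_ge0. Qed.

Let image_leb_sigma_additive : semi_sigma_additive image_leb.
Proof.
move=> F mF tF mUF; rewrite /image_leb preimage_bigcup setI_bigcupr.
apply: (@measure_semi_sigma_additive _ _ _ leb (fun n => D `&` f @^-1` F n : set B)).
- by move=> n; exact: mpre.
- apply/trivIsetP => i j _ _ ij; move/trivIsetP : tF => /(_ i j I I ij) h.
  by rewrite setIACA setIid -preimage_setI h preimage_set0 setI0.
- by apply: bigcup_measurable => n _; exact: mpre.
Qed.

HB.instance Definition _ := isMeasure.Build _ B R image_leb
  image_leb0 image_leb_ge0 image_leb_sigma_additive.

Let image_leb_fin : fin_num_fun image_leb.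
Proof.
move=> A mA; rewrite ge0_fin_numE//; apply: (@le_lt_trans _ _ (leb D)).
  apply: le_measure; rewrite ?inE; [exact: mpre|exact: measurable_ball_rV|].
  by move=> x [].
by rewrite lebV_ball// ltry.
Qed.

HB.instance Definition _ := @Measure_isFinite.Build _ B R image_leb image_leb_fin.

(* Mollification: average over [x] the mass of [{p | f p \in ball x s}], which contains the ball of
   radius [s / L] around a preimage of [x], and integrate first in [x], then in [p]. *)
Lemma erode_leb_le (W : set V) (s : R) : open W -> (0 < s)%R -> (s <= L)%R ->
  leb (ball 0%R r `&` erode W s) <= (L ^+ d)%:E * image_leb W.
Proof.
move=> oW s0 sL; pose E : set V := ball 0%R r `&` erode W s.
have mE : measurable (E : set B).
  apply: measurableI; first exact: measurable_ball_rV.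
  by apply: closed_measurableV; exact: closed_erode.
pose G : set (V * V) := (E `*` D) `&` [set z | ball 0%R s (f z.2 - z.1)%R].
have mG : measurable (G : set BB).
  apply: measurableI; first by apply: measurableX => //; exact: measurable_ball_rV.
  have mfx : measurable_fun setT ((fun z => f z.2 - z.1)%R : BB -> B).
    have m1 : measurable_fun setT ((fun z => f z.2) : BB -> B).
      exact: (measurableT_comp mf measurable_snd).
    have m2 : measurable_fun setT (fst : BB -> B) := measurable_fst.
    have := measurable_linV (-1)%R m1 m2.
    by under eq_fun do rewrite scaleN1r.
  by rewrite -[X in measurable X]setTI; apply: mfx => //; exact: measurable_ball_rV.
pose F z := (\1_G z : R)%:E.
have mF : measurable_fun (setT : set BB) F.
  by apply/measurable_EFinP; exact: measurable_indic.
have F0 z : 0 <= F z by rewrite lee_fin.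
have slice1 x : measurable ([set p | G (x, p)] : set B).
  have mp : measurable_fun setT ((fun p => (x, p)) : B -> BB) by exact: pair1_measurable.
  by rewrite -[X in measurable X]setTI; exact: (mp measurableT _ mG).
have slice2 p : measurable ([set x | G (x, p)] : set B).
  have mp : measurable_fun setT ((fun x => (x, p)) : B -> BB) by exact: pair2_measurable.
  by rewrite -[X in measurable X]setTI; exact: (mp measurableT _ mG).
have sL0 : (0 < s / L)%R by rewrite divr_gt0.
have lower : ((2 * (s / L)) ^+ d)%:E * leb E <= phase_int F.
  have -> : leb E = \int[leb]_x (\1_E x : R)%:E by rewrite integral_indic// setIT.
  have mE1 : measurable_fun (setT : set B) (fun x => (\1_E x : R)%:E).
    by apply/measurable_EFinP; exact: measurable_indic.
  have c0 : (0 <= (2 * (s / L)) ^+ d)%R by rewrite exprn_ge0// mulr_ge0// ltW.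
  rewrite -ge0_integralZl_EFin//.
  apply: ge0_le_integral => //.
  - by move=> x _; rewrite -EFinM lee_fin mulr_ge0// exprn_ge0// mulr_ge0// ltW.
  - apply: emeasurable_funM; first exact: measurable_cst.
    by apply/measurable_EFinP; exact: measurable_indic.
  - exact: measurable_phase_inner.
  - move=> x _; rewrite (_ : (fun p => F (x, p)) = fun p => (\1_[set p | G (x, p)] p : R)%:E) //.
    rewrite integral_indic// setIT indicE.
    have [/set_mem Ex|_] := boolP (x \in E); last by rewrite mule0.
    rewrite mule1.
    have xr : (`|x| < r)%R by case: Ex => + _; rewrite -ball_normE /= sub0r normrN.
    have [p0 p0rho fp0] := f_surj xr.
    rewrite -(lebV_ball p0 sL0); apply: le_measure; rewrite ?inE//.
      exact: measurable_ball_rV.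
    move=> p; rewrite -ball_normE /= => pp0.
    have pp0' : (`|p - p0| < s / L)%R by rewrite distrC.
    split; first split => //=.
    + rewrite /D -ball_normE /= sub0r normrN.
      have sL1 : (s / L <= 1)%R by rewrite ler_pdivrMr// mul1r.
      by have := ler_normD (p - p0)%R p0; rewrite subrK; lra.
    + rewrite -ball_normE /= sub0r normrN -fp0.
      apply: (le_lt_trans (f_lip _ _)).
      by rewrite mulrC -ltr_pdivlMr.
have upper : phase_int F <= ((2 * s) ^+ d)%:E * image_leb W.
  have c0 : (0 <= (2 * s) ^+ d)%R := exprn_ge0 d (mulr_ge0 (ler0n R 2) (ltW s0)).
  have mDW : measurable (D `&` f @^-1` W : set B) by apply: mpre; exact: open_measurableV.
  rewrite phase_intC// (_ : image_leb W = \int[leb]_p (\1_(D `&` f @^-1` W) p : R)%:E); last first.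
    by rewrite integral_indic// setIT.
  have mDW1 : measurable_fun (setT : set B) (fun x => (\1_(D `&` f @^-1` W) x : R)%:E).
    by apply/measurable_EFinP; exact: measurable_indic.
  rewrite -ge0_integralZl_EFin//.
  apply: ge0_le_integral => //.
  - by move=> p _; apply: integral_ge0 => x _.
  - exact: (measurable_fun_fubini_tonelli_G (m1 := leb) (F : BB -> \bar R) mF F0).
  - apply: emeasurable_funM; first exact: measurable_cst.
    by apply/measurable_EFinP; exact: measurable_indic.
  - move=> p _; rewrite (_ : (fun x => F (x, p)) = fun x => (\1_[set x | G (x, p)] x : R)%:E) //.
    rewrite integral_indic// setIT indicE.
    have [_|/negP pW] := boolP (p \in D `&` f @^-1` W).
      rewrite mule1 -(lebV_ball (f p) s0); apply: le_measure; rewrite ?inE//.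
        exact: measurable_ball_rV.
      by move=> x [_ /=]; rewrite -!ball_normE /= sub0r normrN.
    rewrite mule0 (_ : [set x | _] = set0) ?measure0//.
    apply/seteqP; split => // x [[[_ Ex] Dp]] /= fpx; apply: pW; rewrite inE; split => //.
    by apply: Ex; move: fpx; rewrite -!ball_normE /= sub0r normrN distrC.
have s2 : (0 < (2 * (s / L)) ^+ d)%R by rewrite exprn_gt0// mulr_gt0.
have := le_trans lower upper.
rewrite (_ : (2 * s) ^+ d = (2 * (s / L)) ^+ d * L ^+ d)%R; last first.
  by rewrite -exprMn -mulrA divfK// gt_eqF.
by rewrite EFinM -muleA lee_pmul2l// lte_fin.
Qed.

(** [erode_leb_le] with [s = 1 / (n + 1)], and continuity from below as [n] grows. *)
Lemma open_leb_le (W : set V) : open W ->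
  leb (ball 0%R r `&` W) <= (L ^+ d)%:E * image_leb W.
Proof.
move=> oW; pose F n := ball 0%R r `&` erode W n.+1%:R^-1 : set V.
have mF n : measurable (F n : set B).
  apply: measurableI; first exact: measurable_ball_rV.
  by apply: closed_measurableV; exact: closed_erode.
have FE : \bigcup_n F n = ball 0%R r `&` W by rewrite -setI_bigcupr bigcup_erode.
have : leb (F n) @[n --> \oo] --> leb (\bigcup_n F n).
  apply: (@nondecreasing_cvg_mu _ _ _ leb (fun n => F n : set B)) => //.
    rewrite FE; apply: measurableI; first exact: measurable_ball_rV.
    exact: open_measurableV.
  by move=> m n mn; apply/subsetPset => x [xr ex]; split => //; exact: (nondecreasing_erode mn ex).
rewrite FE => h; rewrite -(cvg_lim _ h)//; apply: lime_le.
  by apply/cvg_ex; exists (leb (ball 0%R r `&` W)).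
exists (Num.truncn L^-1) => // n /= hn; apply: erode_leb_le => //.
rewrite invf_ple ?posrE//; apply/ltW/(lt_le_trans (truncnS_gt _)).
by rewrite ler_nat.
Qed.

(** Passage from open to Borel sets by outer regularity of [image_leb], a finite measure since [D]
    is bounded. *)
Lemma leb_le_image_leb (A : set V) : measurable (A : set B) ->
  leb (ball 0%R r `&` A) <= (L ^+ d)%:E * image_leb A.
Proof.
move=> mA; have Ld : (0 < L ^+ d)%R by rewrite exprn_gt0.
apply/lee_addgt0Pr => e e0.
have eL : (0 < e / L ^+ d)%R by rewrite divr_gt0.
have [W [oW AW hW]] := outer_regular image_leb mA eL.
have mW := open_measurableV oW.
apply: (@le_trans _ _ (leb (ball 0%R r `&` W))).
  apply: le_measure; rewrite ?inE.
  - by apply: measurableI => //; exact: measurable_ball_rV.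
  - by apply: measurableI => //; exact: measurable_ball_rV.
  - exact: setIS.
apply: (le_trans (open_leb_le oW)).
have -> : image_leb W = image_leb A + image_leb (W `\` A).
  rewrite -measureU//; [|exact: measurableD|by rewrite setDE setICA setICr setI0].
  by rewrite setDUK.
rewrite ge0_muleDr// leeD2l//.
apply: (@le_trans _ _ ((L ^+ d)%:E * (e / L ^+ d)%:E)); first by rewrite lee_pmul2l// lte_fin.
by rewrite -EFinM mulrC divfK// gt_eqF.
Qed.

(** The inequality between measures passes to integrals once both sides are recognised as integrals
    against [image_leb] and the restriction of [leb]. *)
Lemma integral_leb_le_image (g : V -> \bar R) : measurable_fun (setT : set B) g ->
  (forall x, 0 <= g x) ->
  \int[leb]_(x in ball 0%R r) g x <= (L ^+ d)%:E * \int[leb]_(p in D) g (f p).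
Proof.
move=> mg g0.
have mr : measurable (ball 0%R r : set B) := measurable_ball_rV _ _.
have mDD : measurable (D : set B) := measurable_ball_rV _ _.
have Ld0 : (0 <= L ^+ d)%R by rewrite exprn_ge0// ltW.
have image_int : \int[image_leb]_x g x = \int[leb]_(p in D) g (f p).
  apply: (@integral_functional _ B R image_leb
    (fun g : B -> \bar R => \int[leb]_(p in D) g (f p))) => //.
  - by rewrite integral0.
  - move=> g1 g2 [m1 p1] [m2 p2]; rewrite ge0_integralD//.
    + by apply: measurable_funTS; exact: (measurableT_comp m1 mf).
    + by apply: measurable_funTS; exact: (measurableT_comp m2 mf).
  - move=> a g1 a0 [m1 p1]; rewrite ge0_integralZl_EFin//.
    by apply: measurable_funTS; exact: (measurableT_comp m1 mf).
  - move=> u hu ndu; rewrite monotone_convergence//.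
    + by move=> n; apply: measurable_funTS; case: (hu n) => m1 _; exact: (measurableT_comp m1 mf).
    + by move=> n x _; case: (hu n).
  - move=> A mA; rewrite (_ : (fun p => (\1_A (f p))%:E) = fun p => (\1_(f @^-1` A) p)%:E)//.
    rewrite integral_indic//; last by rewrite -[_ @^-1` _]setTI; exact: mf.
    by rewrite setIC.
have ball_int : \int[leb]_(x in ball 0%R r) g x = \int[mrestr leb mr]_x g x.
  apply/esym; apply: (@integral_functional _ B R (mrestr leb mr)
    (fun g : B -> \bar R => \int[leb]_(x in ball 0%R r) g x)) => //.
  - by rewrite integral0.
  - move=> g1 g2 [m1 p1] [m2 p2]; rewrite ge0_integralD//; exact: measurable_funTS.
  - by move=> a g1 a0 [m1 p1]; rewrite ge0_integralZl_EFin//; exact: measurable_funTS.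
  - move=> u hu ndu; rewrite monotone_convergence//.
    + by move=> n; apply: measurable_funTS; case: (hu n).
    + by move=> n x _; case: (hu n).
  - by move=> A mA; rewrite integral_indic.
rewrite ball_int -image_int -(ge0_integral_mscale image_leb measurableT (NngNum Ld0))//.
apply: ge0_le_measure_integral => // A mA.
by have := leb_le_image_leb mA; rewrite setIC; exact.
Qed.

End lipschitz_surjection.

(** * Growth estimates *)

Section growth.
Context (R : realType) (d : nat).
Local Notation V := 'rV[R]_d.
Variables (U : V -> R) (beta L1 M1 : R).
Hypothesis dU : forall q, differentiable U q.
Hypothesis beta01 : 0 <= beta <= 1.
Hypothesis L10 : 0 <= L1.
Hypothesis M10 : 0 <= M1.
Hypothesis grad_lip : forall q q', enorm (grad U q - grad U q') <= L1 * enorm (q - q').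
Hypothesis grad_growth : forall q, enorm (grad U q) <= M1 * (1 + enorm q `^ beta).

Lemma enorm_ge0 (v : V) : 0 <= enorm v.
Proof. exact: sqrtr_ge0. Qed.

Lemma enorm_sq (v : V) : enorm v ^+ 2 = sq v.
Proof. exact: enorm2. Qed.

Lemma coord_le_enorm (v : V) i : `|v ord0 i| <= enorm v.
Proof. by apply: coord_le_sq; rewrite ?enorm_ge0// enorm_sq. Qed.

Lemma enorm_le_norm (v : V) : enorm v <= d%:R * `|v|.
Proof.
rewrite -(ler_pXn2r (n := 2))// ?nnegrE ?enorm_ge0 ?mulr_ge0// enorm_sq exprMn.
apply: (le_trans (sq_le_norm v)); rewrite ler_wpM2r ?sqr_ge0//.
by rewrite -natrX ler_nat; case: (d) => // n; rewrite leq_pmulr.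
Qed.

Lemma norm_le_enorm (v : V) : `|v| <= enorm v.
Proof. by apply: norm_le_sq; rewrite ?enorm_ge0// enorm_sq. Qed.

Lemma powR_le_1D (r : R) : 0 <= r -> r `^ beta <= 1 + r.
Proof.
move=> r0; have /andP[b0 b1] := beta01.
have [r1|r1] := leP r 1.
  apply: (@le_trans _ _ (1 `^ beta)); last by rewrite powR1 lerDl.
  by apply: ge0_ler_powR; rewrite ?nnegrE.
apply: (@le_trans _ _ (r `^ 1)); last by rewrite powRr1// lerDr.
by rewrite ler_powR// ltW.
Qed.

Lemma grad_norm_lip q q' : `|grad U q - grad U q'| <= L1 * d%:R * `|q - q'|.
Proof.
apply: (le_trans (norm_le_enorm _)); apply: (le_trans (grad_lip _ _)).
by rewrite -mulrA ler_wpM2l// enorm_le_norm.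
Qed.

Lemma gradU_bounded r : exists G, forall q, sq q <= r -> sq (grad U q) <= G.
Proof.
exists (2 * (L1 ^+ 2 * r) + 2 * sq (grad U 0)) => q qr.
rewrite -(subrK (grad U 0) (grad U q)); apply: (le_trans (sqD_le _ _)).
rewrite lerD2r ler_pM2l//; apply: (@le_trans _ _ (L1 ^+ 2 * sq q)); last first.
  by rewrite ler_wpM2l ?sqr_ge0.
have := grad_lip q 0; rewrite subr0 => h.
by rewrite -!enorm_sq -exprMn ler_pXn2r// ?nnegrE ?mulr_ge0 ?enorm_ge0.
Qed.

Lemma deriveE_grad (a v : V) : 'D_v U a = \sum_i v ord0 i * grad U a ord0 i.
Proof.
rewrite deriveE// {1}[v]row_sum_delta linear_sum; apply: eq_bigr => i _.
by rewrite linearZ /= mxE deriveE.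
Qed.

Lemma mean_value (x : V) : exists2 s, 0 <= s <= 1 &
  U x - U 0 = \sum_i x ord0 i * grad U (s *: x) ord0 i.
Proof.
pose phi (t : R) := U (t *: x).
have dphi (t : R) : is_derive t (1 : R) phi ('D_x U (t *: x)).
  have E : (fun h : R => h^-1 *: ((phi \o shift t) (h *: (1 : R)) - phi t)) =
           (fun h : R => h^-1 *: ((U \o shift (t *: x)) (h *: x) - U (t *: x))).
    by apply/funext => k; rewrite /phi /= scalerDl -scalerA scale1r.
  have dUx : derivable U (t *: x) x by exact: diff_derivable.
  by apply: DeriveDef; [rewrite /derivable E|rewrite /derive E].
have [|s] := @MVT R phi (fun t => 'D_x U (t *: x)) 0 1 ltr01.
  by apply: derivable_within_continuous => t _; case: (dphi t).
rewrite in_itv/= => /andP[s0 s1]; rewrite /phi scale1r scale0r subr0 mulr1 => ->.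
by exists s; [rewrite !ltW|exact: deriveE_grad].
Qed.

Lemma U_increment_le x :
  `|U x - U 0| <= d%:R * enorm x * (M1 * (1 + enorm x `^ beta)).
Proof.
have [s /andP[s0 s1] ->] := mean_value x.
apply: (le_trans (ler_norm_sum _ _ _)).
have := enorm_ge0 x => x0; have /andP[b0 b1] := beta01.
have sx : enorm (s *: x) <= enorm x.
  rewrite -(ler_pXn2r (n := 2))// ?nnegrE ?enorm_ge0// !enorm_sq sqZ ler_piMl ?sq_ge0//.
  by rewrite exprn_ile1.
rewrite -mulrA mulr_natl -[X in _ *+ X]card_ord -sumr_const; apply: ler_sum => i _.
rewrite normrM; apply: ler_pM => //; first exact: coord_le_enorm.
apply: (le_trans (coord_le_enorm _ _)); apply: (le_trans (grad_growth _)).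
rewrite ler_wpM2l// lerD2l; apply: ge0_ler_powR => //; rewrite nnegrE//.
exact: enorm_ge0.
Qed.

Lemma U_bounded r : exists M, forall x, `|x| <= r -> `|U x| <= M.
Proof.
pose e := d%:R * r.
exists (`|U 0| + d%:R * e * (M1 * (1 + (1 + e)))) => x xr.
rewrite -(subrK (U 0) (U x)) addrC; apply: (le_trans (ler_normD _ _)); rewrite lerD2l.
apply: (le_trans (U_increment_le x)).
have x0 := enorm_ge0 x.
have xe : enorm x <= e by apply: (le_trans (enorm_le_norm x)); rewrite ler_wpM2l.
have p0 : 0 <= enorm x `^ beta by exact: powR_ge0.
apply: ler_pM; rewrite ?mulr_ge0 ?addr_ge0//.
  by rewrite ler_wpM2l.
rewrite ler_wpM2l// lerD2l; apply: (le_trans (powR_le_1D x0)).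
by rewrite lerD2l.
Qed.

Lemma powR_sublinear eta : beta < 1 -> 0 < eta ->
  exists2 C, 0 <= C & forall r, 0 <= r -> 1 + r `^ beta <= eta * r + C.
Proof.
move=> b1 e0; have b0 : 0 < 1 - beta by rewrite subr_gt0.
(* The threshold where [r ^ beta = eta * r]. Below it [powR_le_1D] is enough. *)
pose r0 := eta^-1 `^ (1 - beta)^-1.
have r00 : 0 < r0 by rewrite powR_gt0// invr_gt0.
exists (1 + (1 + r0)) => [|r rge0]; first by rewrite !addr_ge0// ltW.
have [rr|rr] := leP r r0.
  have := powR_le_1D rge0; have : 0 <= eta * r by rewrite mulr_ge0// ltW.
  by lra.
have rgt0 : 0 < r := lt_trans r00 rr.
suff : r `^ beta <= eta * r by lra.
have -> : r `^ beta = r * (r `^ (1 - beta))^-1.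
  rewrite -powRN -{2}(powRr1 (ltW rgt0)) -powRD; last by rewrite (gt_eqF rgt0) implybT.
  by congr powR; ring.
rewrite mulrC ler_wpM2r//.
rewrite invf_ple ?posrE ?powR_gt0//.
have -> : eta^-1 = r0 `^ (1 - beta) by rewrite -powRrM mulVf ?gt_eqF// powRr1// invr_ge0 ltW.
by apply: ge0_ler_powR; rewrite ?nnegrE ?ltW.
Qed.

Lemma U_le_sublinear h eps : beta < 1 -> 0 < eps ->
  exists2 K, 0 <= K & forall q, h ^+ 2 * U q <= eps * sq q + K.
Proof.
move=> b1 e0; pose c := h ^+ 2 * (d%:R * M1).
have c0 : 0 <= c by rewrite mulr_ge0 ?sqr_ge0// mulr_ge0.
have c10 : 0 < c + 1 by rewrite ltr_wpDl.
(* This [eta] leaves at most [eps / 2] for the quadratic term, the linear term taking the other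
   half; [c + 1] avoids a division by zero. *)
have eta0 : 0 < eps / (2 * (c + 1)) by rewrite divr_gt0// mulr_gt0.
have [C C0 hC] := powR_sublinear b1 eta0.
exists (h ^+ 2 * `|U 0| + (c * C) ^+ 2 / (2 * eps)) => [|q].
  apply: addr_ge0; first by rewrite mulr_ge0 ?sqr_ge0.
  by rewrite divr_ge0 ?sqr_ge0// mulr_ge0// ltW.
have U_le : h ^+ 2 * U q <= h ^+ 2 * `|U 0| + c * (enorm q * (1 + enorm q `^ beta)).
  have -> : c * (enorm q * (1 + enorm q `^ beta)) =
    h ^+ 2 * (d%:R * enorm q * (M1 * (1 + enorm q `^ beta))) by rewrite /c; ring.
  rewrite -mulrDr ler_wpM2l ?sqr_ge0//.
  have := U_increment_le q; have := ler_norm (U q - U 0); have := ler_norm (U 0); lra.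
apply: (le_trans U_le); rewrite addrCA lerD2l.
set r := enorm q; have r0 : 0 <= r := enorm_ge0 q.
apply: (@le_trans _ _ (c * (r * (eps / (2 * (c + 1)) * r + C)))).
  by rewrite ler_wpM2l// ler_wpM2l// hC.
rewrite -enorm_sq -/r.
have -> : c * (r * (eps / (2 * (c + 1)) * r + C)) =
   (c / (c + 1)) * (eps / 2 * r ^+ 2) + c * C * r.
  by field; rewrite gt_eqF.
have h1 : c / (c + 1) * (eps / 2 * r ^+ 2) <= eps / 2 * r ^+ 2.
  apply: ler_piMl; last by rewrite ler_pdivrMr// mul1r lerDl.
  by rewrite mulr_ge0 ?sqr_ge0// divr_ge0// ltW.
have h2 : c * C * r <= eps / 2 * r ^+ 2 + (c * C) ^+ 2 / (2 * eps).
  (* Young's inequality as a completed square. *)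
  rewrite -subr_ge0 (_ : _ - _ = (eps * r - c * C) ^+ 2 / (2 * eps)).
    by rewrite divr_ge0 ?sqr_ge0// mulr_ge0// ltW.
  by field; rewrite gt_eqF.
by apply: (le_trans (lerD h1 h2)); lra.
Qed.

Lemma U_le_linear eps : beta = 1 -> 0 < eps -> exists2 hbar, 0 < hbar &
  forall h, 0 < h <= hbar ->
    exists2 K, 0 <= K & forall q, h ^+ 2 * U q <= eps * sq q + K.
Proof.
move=> b1 e0; pose c := d%:R * M1; have c0 : 0 <= c by rewrite mulr_ge0.
have c10 : 0 < 2 * c + 1 by rewrite ltr_wpDl// mulr_ge0.
(* From [h <= 1] follows [h^2 <= h], and the second bound gives [2 * c * h <= eps]. *)
exists (Num.min 1 (eps / (2 * c + 1))); first by rewrite lt_min ltr01 divr_gt0.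
move=> h /andP[h0]; rewrite le_min => /andP[h1]; rewrite ler_pdivlMr// => he.
exists (h ^+ 2 * (`|U 0| + c)) => [|q]; first by rewrite mulr_ge0 ?sqr_ge0// addr_ge0.
set r := enorm q; have r0 : 0 <= r := enorm_ge0 q.
have := U_increment_le q; rewrite b1 powRr1// -/r => hU.
have U_le : U q <= `|U 0| + c + 2 * c * r ^+ 2.
  have : d%:R * r * (M1 * (1 + r)) <= c + 2 * c * r ^+ 2.
    rewrite (_ : d%:R * r * (M1 * (1 + r)) = c * (r + r ^+ 2)); last by rewrite /c; ring.
    rewrite (_ : c + 2 * c * r ^+ 2 = c * (1 + 2 * r ^+ 2)); last by ring.
    by rewrite ler_wpM2l//; nra.
  by have := ler_norm (U q - U 0); have := ler_norm (U 0); lra.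
have hh : h ^+ 2 * (2 * c) <= eps.
  have h2 : h ^+ 2 <= h by rewrite expr2 ler_piMr// ltW.
  have c2 : 0 <= 2 * c by rewrite mulr_ge0.
  by apply: (le_trans (ler_wpM2r c2 h2)); lra.
rewrite -enorm_sq -/r.
apply: (@le_trans _ _ (h ^+ 2 * (`|U 0| + c + 2 * c * r ^+ 2))).
  by rewrite ler_wpM2l ?sqr_ge0.
rewrite mulrDr addrC lerD2r mulrA ler_wpM2r ?sqr_ge0//.
Qed.

Section lipschitz.
Variables (h : R) (T : nat).
Hypothesis h0 : 0 < h.

(** A common bound [delta] for position and momentum makes the estimate compose through the
    substeps. *)
Lemma leapfrogT_lipschitz : exists2 L, 0 < L & forall z z' delta,
  `|z.1 - z'.1| <= delta -> `|z.2 - z'.2| <= delta ->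
  `|(leapfrogT U h T z).1 - (leapfrogT U h T z').1| <= L * delta /\
  `|(leapfrogT U h T z).2 - (leapfrogT U h T z').2| <= L * delta.
Proof.
pose a := 1 + h / 2 * (L1 * d%:R).
have hL0 : 0 <= h / 2 * (L1 * d%:R) by rewrite !mulr_ge0// ltW.
have a1 : 1 <= a by rewrite lerDl.
have b1 : 1 <= 1 + h by rewrite lerDl ltW.
have step1 (z z' : V * V) (delta : R) : `|z.1 - z'.1| <= delta -> `|z.2 - z'.2| <= delta ->
    `|(Psi1 U h z).1 - (Psi1 U h z').1| <= a * delta /\
    `|(Psi1 U h z).2 - (Psi1 U h z').2| <= a * delta.
  move=> d1 d2; have de0 : 0 <= delta by exact: le_trans d1.
  split; first by apply: (le_trans d1); rewrite ler_peMl.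
  rewrite /Psi1 /=.
  have -> : z.2 - (h / 2) *: grad U z.1 - (z'.2 - (h / 2) *: grad U z'.1) =
     (z.2 - z'.2) - (h / 2) *: (grad U z.1 - grad U z'.1).
    by rewrite scalerBr !opprB addrACA [RHS]addrACA; congr (_ + _); rewrite addrC.
  apply: (le_trans (ler_normB _ _)); rewrite normrZ gtr0_norm ?divr_gt0//.
  rewrite /a mulrDl mul1r; apply: lerD => //.
  rewrite -mulrA ler_pM2l ?divr_gt0//; apply: (le_trans (grad_norm_lip _ _)).
  by rewrite ler_wpM2l// mulr_ge0.
have step2 (z z' : V * V) (delta : R) : `|z.1 - z'.1| <= delta -> `|z.2 - z'.2| <= delta ->
    `|(Psi2 h z).1 - (Psi2 h z').1| <= (1 + h) * delta /\
    `|(Psi2 h z).2 - (Psi2 h z').2| <= (1 + h) * delta.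
  move=> d1 d2; have de0 : 0 <= delta by exact: le_trans d1.
  split; last by apply: (le_trans d2); rewrite ler_peMl.
  rewrite /Psi2 /=.
  have -> : z.1 + h *: z.2 - (z'.1 + h *: z'.2) = (z.1 - z'.1) + h *: (z.2 - z'.2).
    by rewrite scalerBr opprD addrACA.
  apply: (le_trans (ler_normD _ _)); rewrite normrZ gtr0_norm// mulrDl mul1r.
  by apply: lerD => //; rewrite ler_pM2l.
pose l := a * ((1 + h) * a).
have l0 : 0 < l by rewrite !mulr_gt0 ?(lt_le_trans ltr01).
exists (l ^+ T); first exact: exprn_gt0.
elim: T => [|n ih] z z' delta d1 d2; first by rewrite expr0 mul1r.
have [e1 e2] := ih _ _ _ d1 d2.
have [e3 e4] := step1 _ _ _ e1 e2.
have [e5 e6] := step2 _ _ _ e3 e4.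
have [e7 e8] := step1 _ _ _ e5 e6.
rewrite exprS (_ : l * l ^+ n * delta = a * ((1 + h) * (a * (l ^+ n * delta)))) //.
by rewrite /l; ring.
Qed.

(** On bounded sets the increase of energy is bounded: [M] and [N] bound the potential at the two
    ends, [d * s^2 / 2] the final kinetic energy, and the initial one is nonnegative. *)
Lemma accept_ge r : exists2 a, 0 < a & forall q p, `|q| <= r -> `|p| <= r ->
  a <= accept U (q, p) (leapfrogT U h T (q, p)).
Proof.
have [L L0 hL] := leapfrogT_lipschitz.
pose Phi := leapfrogT U h T.
(* [s] bounds both components of the endpoint, by comparison with the trajectory from [(0, 0)]. *)
pose s := `|(Phi (0, 0)).1| + `|(Phi (0, 0)).2| + L * r.
have [M hM] := U_bounded r; have [N hN] := U_bounded s.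
exists (Num.min 1 (expR (- (M + N + d%:R * s ^+ 2 / 2)))); first by rewrite lt_min ltr01 expR_gt0.
move=> q p qr pr; rewrite /accept le_min ge_min lexx /= ge_min; apply/orP; right.
rewrite ler_expR /ham /= !enorm_sq.
have [h1 h2] := hL (q, p) (0, 0) r ltac:(by rewrite subr0) ltac:(by rewrite subr0).
have n1 := normr_ge0 (Phi (0, 0)).1; have n2 := normr_ge0 (Phi (0, 0)).2.
have s1 : `|(Phi (q, p)).1| <= s.
  rewrite -(subrK (Phi (0, 0)).1 (Phi (q, p)).1); apply: (le_trans (ler_normD _ _)).
  by rewrite /s; move: h1; rewrite -/Phi; lra.
have s2 : `|(Phi (q, p)).2| <= s.
  rewrite -(subrK (Phi (0, 0)).2 (Phi (q, p)).2); apply: (le_trans (ler_normD _ _)).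
  by rewrite /s; move: h2; rewrite -/Phi; lra.
have := hM _ qr; have := hN _ s1; rewrite !ler_norml => /andP[_ u1] /andP[u2 _].
have p0 := sq_ge0 p.
have : sq (Phi (q, p)).2 <= d%:R * s ^+ 2.
  apply: (le_trans (sq_le_norm _)); rewrite ler_wpM2l// ler_pXn2r ?nnegrE//.
  exact: le_trans s2.
rewrite -/Phi; lra.
Qed.

Lemma gauss_ge r : exists2 a, 0 < a & forall p : V, `|p| <= r -> a <= gauss p.
Proof.
have c0 : 0 < Num.sqrt (2 * pi) ^- d :> R.
  by rewrite invr_gt0 exprn_gt0// sqrtr_gt0 mulr_gt0// pi_gt0.
exists (Num.sqrt (2 * pi) ^- d * expR (- (d%:R * r ^+ 2 / 2))).
  by rewrite mulr_gt0// expR_gt0.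
move=> p pr; rewrite /gauss ler_pM2l// ler_expR lerN2 ler_pM2r// enorm_sq.
apply: (le_trans (sq_le_norm _)); rewrite ler_wpM2l// ler_pXn2r ?nnegrE//.
exact: le_trans pr.
Qed.

End lipschitz.

End growth.

(** * The HMC chain *)

Section minorization.
Context (R : realType) (d : nat).
Local Notation V := 'rV[R]_d.
Local Notation B := (borelV R d).
Local Notation BB := (B * B)%type.
Local Notation leb := (@lebV R d).
Variables (U : V -> R) (h : R) (T : nat).
Hypothesis cU : continuous U.
Hypothesis cgU : continuous (grad U).
Hypothesis lip : exists2 L, 0 < L & forall z z' delta,
  `|z.1 - z'.1| <= delta -> `|z.2 - z'.2| <= delta ->
  `|(leapfrogT U h T z).1 - (leapfrogT U h T z').1| <= L * delta /\
  `|(leapfrogT U h T z).2 - (leapfrogT U h T z').2| <= L * delta.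
Hypothesis surj : forall r, exists rho, forall q y, sq q <= r -> sq y <= r ->
  exists2 p, sq p <= rho & (leapfrogT U h T (q, p)).1 = y.
Hypothesis acc_ge : forall r, exists2 a, 0 < a & forall q p, `|q| <= r -> `|p| <= r ->
  a <= accept U (q, p) (leapfrogT U h T (q, p)).

(** For fixed [q] the end position is a Lipschitz function of the momentum and covers the ball of
    radius [rho] from momenta of norm at most [s']. On the ball of radius [s' + 1] the acceptance
    probability times the Gaussian density is at least [a * g], which gives the constant
    [a * g / L^d]. *)
Lemma hmc_minorization rho : 0 < rho -> exists2 c, 0 < c &
  forall (f : V -> R) q, nnb (f : B -> R) -> `|q| < rho ->
  (c%:E * \int[leb]_(x in ball (0%R : V) rho) (f x)%:E <= (hmc U h T f q)%:E)%E.
Proof.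
move=> rho0; have [L L0 hL] := lip.
have [s hs] := surj (d%:R * rho ^+ 2).
pose s' := Num.sqrt `|s|.
have s'0 : 0 <= s' := sqrtr_ge0 _.
(* [t] bounds [q] as well as all momenta in the ball of radius [s' + 1]. *)
pose t := Num.max rho (s' + 1).
have [a a0 ha] := acc_ge t; have [g g0 hg] := gauss_ge d t.
have c0 : 0 < L ^+ d / (a * g) by rewrite divr_gt0 ?exprn_gt0// mulr_gt0.
exists (L ^+ d / (a * g))^-1; first by rewrite invr_gt0.
move=> f q bf qrho; have [[mf _] f0] := bf.
have mPhi := measurable_leapfrogT h cgU T.
pose Phi p := (leapfrogT U h T (q, p)).1.
have mPhiq : measurable_fun setT (Phi : B -> B).
  have mp : measurable_fun setT ((fun p => (q, p)) : B -> BB) by exact: pair1_measurable.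
  exact: (measurableT_comp measurable_fst (measurableT_comp mPhi mp)).
have Phi_lip p p' : `|Phi p - Phi p'| <= L * `|p - p'|.
  by have [] := hL (q, p) (q, p') `|p - p'| ltac:(by rewrite subrr normr0) (lexx _).
have sq_le (x : V) : `|x| < rho -> sq x <= d%:R * rho ^+ 2.
  move=> xr; apply: (le_trans (sq_le_norm _)). rewrite ler_wpM2l//.
  by rewrite ler_pXn2r ?nnegrE// ltW.
have Phi_surj (x : V) : `|x| < rho -> exists2 p, `|p| <= s' & Phi p = x.
  move=> xr; have [p ps px] := hs _ _ (sq_le _ qrho) (sq_le _ xr); exists p => //.
  by apply: norm_le_sq; rewrite ?sqr_sqrtr// (le_trans ps)// ler_norm.
have mfE : measurable_fun (setT : set B) (fun x => (f x)%:E) by exact/measurable_EFinP.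
have := integral_leb_le_image mPhiq L0 s'0 Phi_lip Phi_surj mfE.
move=> /(_ ltac:(by move=> x; rewrite lee_fin)) h1.
rewrite muleC lee_pdivrMr// muleC; apply: (le_trans h1).
have bs := nnb_section q (nnb_hmc_step h T cU cgU bf).
have [[ms _] s0] := bs.
rewrite hmc_phase// EFinM -muleA; apply: lee_wpmul2l; first by rewrite lee_fin exprn_ge0// ltW.
have ag0 : 0 < a * g by rewrite mulr_gt0.
rewrite muleC lee_pdivlMr//.
have mD := measurable_ball_rV (0 : V) (s' + 1).
have mfPhi : measurable_fun (setT : set B) (fun p => (f (Phi p))%:E).
  by apply/measurable_EFinP; exact: (measurableT_comp mf mPhiq).
have msg : measurable_fun (setT : set B)
    (fun p => (hmc_step U h T f (q, p) * gauss p)%:E).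
  by apply/measurable_EFinP; apply: measurable_funM; [exact: ms|exact: measurable_gauss].
rewrite muleC -ge0_integralZl_EFin//; last 3 first.
- by move=> p _; rewrite lee_fin.
- exact: measurable_funTS.
- exact: ltW.
apply: (@le_trans _ _ (\int[leb]_(p in ball (0%R : V) (s' + 1)%R)
    (hmc_step U h T f (q, p) * gauss p)%:E)%E).
  apply: ge0_le_integral => //.
  - by move=> p _; rewrite -EFinM lee_fin mulr_ge0// ltW.
  - by apply: emeasurable_funM; [exact: measurable_cst|exact: measurable_funTS].
  - exact: measurable_funTS.
  - move=> p; rewrite -ball_normE /= sub0r normrN => ps.
    have pt : `|p| <= t by rewrite le_max (ltW ps) orbT.
    have qt : `|q| <= t by rewrite le_max (ltW qrho).
    rewrite -EFinM lee_fin mulrC.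
    apply: (@le_trans _ _ (f (Phi p) * accept U (q, p) (leapfrogT U h T (q, p)) * gauss p)).
      by rewrite -mulrA ler_wpM2l//; apply: ler_pM; [exact: ltW|exact: ltW|exact: ha|exact: hg].
    rewrite ler_wpM2r ?gauss_ge0// /hmc_step lerDl mulr_ge0//.
    by rewrite subr_ge0 acc_le1.
apply: ge0_subset_integral => //.
by move=> p _; rewrite lee_fin mulr_ge0 ?gauss_ge0//; exact: s0.
Qed.

End minorization.

(** * From the abstract results to the HMC chain *)

Section hmc_chain.
Context (R : realType) (d : nat).
Local Notation V := 'rV[R]_d.
Local Notation B := (borelV R d).
Local Notation leb := (@lebV R d).
Variables (U : V -> R) (h : R) (T : nat) (Z : R).
Hypothesis cU : continuous U.
Hypothesis cgU : continuous (grad U).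
Hypothesis Z0 : 0 < Z.
Hypothesis ZE : leb_int (fun q => (expR (- U q))%:E) = Z%:E.
Hypothesis U_bounded : forall r, exists M, forall x, `|x| <= r -> `|U x| <= M.
Hypothesis hmc_min : forall rho, 0 < rho -> exists2 c, 0 < c &
  forall (f : V -> R) q, nnb (f : B -> R) -> `|q| < rho ->
  (c%:E * \int[leb]_(x in ball (0%R : V) rho) (f x)%:E <= (hmc U h T f q)%:E)%E.

Local Notation Pn := (hmc_kernel_n U h T).
Local Notation p := (hmc U h T).
Local Notation pi_U := (gibbs cU Z0 ZE).
Local Notation e f := (Rintegral pi_U setT f).

Let C (n : nat) : set B := ball (0 : V) n.+1%:R.

Let mC n : measurable (C n). Proof. exact: measurable_ball_rV. Qed.

Let ndC m n : (m <= n)%N -> C m `<=` C n.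
Proof. by move=> mn; apply: le_ball; rewrite ler_nat. Qed.

Let C_norm n x : C n x = (`|x| < n.+1%:R) :> Prop.
Proof. by rewrite /C -ball_normE /= sub0r normrN. Qed.

Let C_cover x : exists n, C n x.
Proof. by exists (Num.truncn `|x|); rewrite C_norm truncnS_gt. Qed.

Let nnb_indic (A : set V) : measurable (A : set B) -> nnb (\1_A : B -> R).
Proof. by move=> mA; split; [exact: bmeas_indic|move=> x; exact: indic_ge0]. Qed.

(** On the ball [C n] the Gibbs density is at most [expR M / Z], so Lebesgue measure there dominates
    [Z * expR (- M)] times the Gibbs measure. *)
Let p_min n : exists2 c, 0 < c &
  forall f x, nnb (f : B -> R) -> C n x -> c * e (fun y => \1_(C n) y * f y) <= p f x.
Proof.
have [c c0 hc] := hmc_min (ltr0Sn R n).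
have [M hM] := U_bounded n.+1%:R.
exists (c * (Z * expR (- M))); first by rewrite !mulr_gt0// expR_gt0.
move=> f x bf; rewrite C_norm => xn.
rewrite -lee_fin; apply: le_trans (hc _ _ bf xn).
have [[mf _] f0] := bf.
rewrite -mulrA EFinM lee_pmul2l// EFinM bexp_gibbs; last first.
  by split=> [|y]; [apply: bmeasM; [exact: bmeas_indic|case: bf]|rewrite mulr_ge0].
have c1 : 0 < Z * expR (- M) by rewrite mulr_gt0// expR_gt0.
have mdens : measurable_fun (setT : set B) (fun q : V => expR (- U q) / Z).
  apply: measurable_funM; last exact: measurable_cst.
  by apply: measurableT_comp => //; apply: measurable_funN; exact: continuous_measurable_rV.
have mIf : measurable_fun (setT : set B) (fun q => \1_(C n) q * f q).
  by apply: measurable_funM => //; exact: measurable_indic.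
rewrite -ge0_integralZl_EFin//; last 3 first.
- by move=> y _; rewrite lee_fin !mulr_ge0 ?expR_ge0// invr_ge0 ltW.
- by apply/measurable_EFinP; exact: measurable_funM.
- exact: ltW.
rewrite [leRHS]integral_mkcond; apply: ge0_le_integral => //.
- by move=> y _; rewrite -EFinM lee_fin !mulr_ge0 ?expR_ge0 ?invr_ge0// ltW.
- apply: emeasurable_funM; first exact: measurable_cst.
  by apply/measurable_EFinP; exact: measurable_funM.
- apply: (measurable_restrictT (fun y => (f y)%:E) (mC n)).1.
  by apply: measurable_funTS; apply/measurable_EFinP; exact: mf.
- move=> y _; rewrite patchE indicE.
  have [/set_mem Cy|Cy] := boolP (y \in C n); last by rewrite mul0r mul0r mule0.
  rewrite mul1r -EFinM lee_fin.
  have -> : Z * expR (- M) * (f y * (expR (- U y) / Z)) = f y * (expR (- M) * expR (- U y)).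
    by field; rewrite gt_eqF.
  rewrite ler_piMr// -expRD -[leRHS]expR0 ler_expR.
  have : `|U y| <= M by apply: hM; move: Cy; rewrite C_norm => /ltW.
  by rewrite ler_norml => /andP[]; lra.
Qed.

Let pn_nnb f : nnb (f : B -> R) -> nnb (p f : B -> R). Proof. exact: hmc_nnb. Qed.
Let pnD f g x : nnb (f : B -> R) -> nnb (g : B -> R) -> p (fun y => f y + g y) x = p f x + p g x.
Proof. exact: hmcD. Qed.
Let pnZ a f x : 0 <= a -> nnb (f : B -> R) -> p (fun y => a * f y) x = a * p f x.
Proof. exact: hmcZ. Qed.
Let pn1 x : p (fun=> 1) x = 1. Proof. exact: hmc1. Qed.
Let pn_sym f g : nnb (f : B -> R) -> nnb (g : B -> R) ->
  e (fun x => p f x * g x) = e (fun x => f x * p g x).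
Proof. exact: hmc_sym. Qed.

Lemma kernel_nE n q (A : set V) : borel_d A -> Pn n q A = (iter n p \1_A q)%:E.
Proof.
move=> mA; rewrite /hmc_kernel_n; elim: n q => [//|n ih] q.
rewrite !iterS -(hmc_opE h T cU cgU q (iter_nnb pn_nnb n (nnb_indic mA))).
by congr hmc_op; apply/funext => y; exact: ih.
Qed.

Lemma gibbs_eq0 (A : set V) : borel_d A -> (pi_U A = 0%E) <-> (leb_d A = 0%E).
Proof.
move=> mA; have mAB : measurable (A : set B) := mA.
have mdens : measurable_fun (A : set B) (fun q : V => (expR (- U q) / Z)%:E).
  apply/measurable_EFinP/measurable_funTS/measurable_funM; last exact: measurable_cst.
  by apply: measurableT_comp => //; apply: measurable_funN; exact: continuous_measurable_rV.
rewrite density_probE; split => [A0|A0]; last exact: (null_set_integral (mu := leb)).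
have : (\int[leb]_(x in A) `|(expR (- U x) / Z)%:E| = 0)%E.
  rewrite -[RHS]A0; apply: eq_integral => x _.
  by rewrite gee0_abs// lee_fin divr_ge0 ?expR_ge0// ltW.
move/(ae_eq_integral_abs leb mAB mdens) => [N [mN N0 hN]].
apply: (@subset_measure0 _ _ _ leb A N) => // x Ax; apply: hN => /= /(_ Ax) [].
by apply/eqP; rewrite gt_eqF// divr_gt0// expR_gt0.
Qed.

Lemma gibbs_gt0 (A : set V) : borel_d A -> (0 < leb_d A)%E = (0 < e (\1_A)).
Proof.
move=> mA; rewrite -lte_fin (bexp_indic pi_U mA).
have l0 : (0 <= leb_d A)%E by exact: (measure_ge0 leb A).
rewrite !lt_def l0 measure_ge0 !andbT; congr negb.
by apply/eqP/eqP => /(gibbs_eq0 mA).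
Qed.

(** From some time on every term of the series is at least a fixed [delta > 0]. *)
Lemma visits_infty (A : set V) x : borel_d A -> (0 < leb_d A)%E -> visits Pn x A = +oo%E.
Proof.
move=> mA; rewrite gibbs_gt0// => A0.
have [delta d0 [N hN]] := op_recurrent pn_nnb pnD pnZ pn1 pn_sym mC ndC C_cover p_min x mA A0.
have bA := nnb_indic mA.
have p0 m : 0 <= iter m p \1_A x by have [_] := iter_nnb pn_nnb m bA; exact.
(* [M.+1] terms of size [delta] exceed [K]; the terms up to index [N] are discarded. *)
apply/eqyP => K K0; pose M := Num.truncn (K / delta).
apply: le_trans (nneseries_lim_ge (N.+1 + M.+1) _); last first.
  by move=> n _ _; rewrite kernel_nE// lee_fin.
under eq_bigr do rewrite kernel_nE//.
rewrite sumEFin lee_fin (@big_cat_nat _ _ _ N.+1)//=; last exact: leq_addr.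
apply: (@le_trans _ _ (\sum_(N.+1 <= i < N.+1 + M.+1) delta)).
  rewrite sumr_const_nat addKn -mulr_natl -ler_pdivrMr//.
  exact/ltW/truncnS_gt.
rewrite addrC -[leLHS]addr0; apply: lerD; last by apply: sumr_ge0 => i _; exact: p0.
by apply: ler_sum_nat => -[//|i] /andP[Ni _]; exact: hN.
Qed.

Lemma measure_borel (m : {measure set B -> \bar R}) : is_measure_borel (m : set V -> \bar R).
Proof.
split; [exact: measure0|by move=> A _; exact: measure_ge0|].
move=> F mF tF; apply/cvg_lim => //; apply: (@measure_semi_sigma_additive _ _ _ m) => //.
by apply: bigcup_measurable => n _; exact: mF.
Qed.

Lemma hmc_irreducibility_measure : irreducibility_measure Pn (@leb_d R d).
Proof. by move=> A mA A0 x; rewrite visits_infty// ltry. Qed.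

Lemma leb_d_gt0 : (0 < @leb_d R d setT)%E.
Proof.
rewrite gibbs_gt0; last exact: (@measurableT _ B).
by rewrite indicT bexp_cst.
Qed.

Lemma hmc_irreducible : irreducible Pn.
Proof.
exists (@leb_d R d); split; [exact: (measure_borel leb)|exact: leb_d_gt0|].
exact: hmc_irreducibility_measure.
Qed.

Lemma hmc_small (K : set V) : compact K -> small_set Pn K.
Proof.
move=> /compact_bounded[M [_ hM]].
pose rho := `|M| + 2.
have rho0 : 0 < rho by rewrite ltr_wpDl.
have K_rho x : K x -> `|x| < rho.
  move=> Kx; apply: (@le_lt_trans _ _ (`|M| + 1)); last by rewrite ltrD2l ltr1n.
  by apply: hM => //; rewrite (le_lt_trans (ler_norm M))// ltrDl.
have [c c0 hc] := hmc_min rho0.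
have mb : measurable (ball (0 : V) rho : set B) := measurable_ball_rV _ _.
pose m := mscale (NngNum (ltW c0)) (mrestr leb mb) : {measure set B -> \bar R}.
exists 1%N; split => //; exists (m : set V -> \bar R); split; first exact: measure_borel.
  rewrite /nontrivial -[m setT]/(c%:E * leb (setT `&` ball (0%R : V) rho))%E.
  by rewrite setTI lebV_ball// -EFinM lte_fin mulr_gt0// exprn_gt0// mulr_gt0.
move=> x A Kx mA; rewrite kernel_nE//=.
rewrite -[m A]/(c%:E * leb (A `&` ball (0%R : V) rho))%E -integral_indic//.
exact: (hc _ _ (nnb_indic mA) (K_rho _ Kx)).
Qed.

(** Some [D i] has positive Lebesgue measure. By [op_positive] one step from a point of [D i]
    returns to [D i] with positive probability, while a cycle would send all the mass into the
    disjoint set [D j]. *)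
Lemma hmc_aperiodic : aperiodic Pn (@leb_d R d).
Proof.
move=> k k2 [D [mD disj D0 cyc]].
have [i [ik Di0]] : exists i, (i < k)%N /\ (0 < leb_d (D i))%E.
  apply: contrapT => hn.
  (* The finite family is padded by [set0] into a sequence, the form taken by
     [negligible_bigcup]. *)
  have nD i : leb.-negligible (if (i < k)%N then D i else set0).
    case: ifPn => [ik|_]; last exact: negligible_set0.
    exists (D i); split => //; first exact: mD.
    apply/eqP; apply: contrapT => /negP h0; apply: hn; exists i; split => //.
    by rewrite lt_def h0 (measure_ge0 leb).
  have mbig : measurable (\bigcup_(i in [set i | (i < k)%N]) D i : set B).
    by apply: bigcup_measurable => i ik; exact: mD.
  have n1 : leb.-negligible (~` \bigcup_(i in [set i | (i < k)%N]) D i).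
    by exists (~` \bigcup_(i in [set i | (i < k)%N]) D i); split => //; exact: measurableC.
  have n2 : leb.-negligible (setT : set B).
    apply: negligibleS (negligibleU n1 (negligible_bigcup nD)) => x _.
    have [Dx|Dx] := pselect ((\bigcup_(i in [set i | (i < k)%N]) D i) x); last by left.
    by right; case: Dx => i /= ik Dix; exists i => //; rewrite ik.
  have := leb_d_gt0; rewrite -[leb_d setT]/(leb setT).
  by rewrite (measure_negligible (@measurableT _ B) n2) ltxx.
have mDi := mD _ ik; set j := (i.+1 %% k)%N.
have jk : (j < k)%N by rewrite ltn_mod; lia.
have ij : i != j.
  rewrite /j; have [ik1|ik1] := ltnP i.+1 k; first by rewrite modn_small//; lia.
  have -> : i.+1 = k by lia.
  by rewrite modnn; lia.
have [x Dx] : D i !=set0.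
  apply/set0P/eqP => Di_eq0; move: Di0.
  by rewrite Di_eq0 -[leb_d set0]/(leb set0) measure0 ltxx.
have := cyc _ _ ik Dx; rewrite -/j kernel_nE//=; last exact: mD.
move=> [pj]; rewrite gibbs_gt0// in Di0.
have pi_pos := op_positive mC ndC C_cover p_min x mDi Di0.
have bi := nnb_indic mDi; have bj := nnb_indic (mD _ jk).
have : p (fun y => \1_(D i) y + \1_(D j) y) x <= 1.
  rewrite -(pn1 x); apply: (op_le pn_nnb pnD) => //.
  - by split=> [|y]; [apply: bmeasD; [case: bi|case: bj]|rewrite addr_ge0].
  - by split=> [|y]; [exact: bmeas_cst|].
  - move=> y; rewrite !indicE.
    have [/set_mem Diy|_] := boolP (y \in D i); have [/set_mem Djy|_] := boolP (y \in D j);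
      rewrite ?addr0 ?add0r//.
    by have : (D i `&` D j) y by []; rewrite disj.
by rewrite pnD// pj; lra.
Qed.

(** An accessible set has positive mass: otherwise invariance makes every [P^m 1_A] vanish almost
    everywhere, and a point outside the countable union of these null sets never reaches [A]. Then
    [visits_infty] applies. *)
Lemma hmc_recurrent : recurrent Pn.
Proof.
move=> A mA acc x _; apply: visits_infty => //; rewrite gibbs_gt0//.
have bA := nnb_indic mA.
rewrite lt_def bexp_ge0 ?andbT; last by move=> y; exact: indic_ge0.
apply/negP => /eqP A0.
have nA m : pi_U.-negligible [set y | iter m p \1_A y <> 0].
  have [bm m0] := iter_nnb pn_nnb m bA.
  by apply: bexp_eq0 => //; rewrite (iter_invariant pn_nnb pn1 pn_sym).
have [N [mN N0 hN]] := negligible_bigcup nA.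
have [y Ny] : exists y, ~ N y.
  apply: contrapT => hy; have NT : N = setT.
    by apply/seteqP; split => // y _; apply: contrapT => Ny; apply: hy; exists y.
  have := probability_setT pi_U; rewrite -NT => N1.
  by move: (oner_neq0 R); rewrite -eqe -N1 N0 eqxx.
have := acc y; rewrite /visits eseries0 ?ltxx// => m _ _.
rewrite kernel_nE//; congr EFin; apply: contrapT => hm; apply: Ny; apply: hN.
by exists m.
Qed.

Lemma hmc_convergence : exists N : set V, [/\ borel_d N, target U N = 0%E &
  forall q, ~ N q -> (fun n => tv_dist (Pn n q) (target U)) @ \oo --> 0%E].
Proof.
have [N [mN N0 hN]] := op_ergodic_TV pn_nnb pnD pnZ pn1 pn_sym mC ndC C_cover p_min.
exists N; split => //; first by rewrite -(gibbsE cU Z0 ZE mN).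
move=> q Nq.
have tv_ge0 n : (0 <= tv_dist (Pn n q) (target U))%E.
  apply: (le_trans (abse_ge0 (Pn n q set0 - target U set0)%E)).
  by apply: ereal_sup_ubound; exists set0 => //; exact: (@measurable0 _ B).
have tv_le eps : 0 < eps -> \forall n \near \oo, (tv_dist (Pn n q) (target U) <= eps%:E)%E.
  move=> eps0; have [n1 hn1] := hN q eps Nq eps0.
  exists n1 => // n /= nn1; apply: ge_ereal_sup => _ [A mA <-].
  rewrite kernel_nE// -(gibbsE cU Z0 ZE mA) -(bexp_indic pi_U mA) -EFinB abse_EFin lee_fin.
  exact: hn1.
have tv_fin n eps : (tv_dist (Pn n q) (target U) <= eps%:E)%E ->
    tv_dist (Pn n q) (target U) \is a fin_num.
  by move=> h1; rewrite ge0_fin_numE// (le_lt_trans h1)// ltry.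
apply/fine_cvgP; split.
  by apply: filterS (tv_le 1 ltr01) => n; exact: tv_fin.
apply/cvgrPdist_le => eps eps0; apply: filterS (tv_le eps eps0) => n hn /=.
have fn := tv_fin _ _ hn; rewrite sub0r normrN ger0_norm ?fine_ge0//.
by rewrite -lee_fin fineK.
Qed.

End hmc_chain.

Section normalisation.
Context (R : realType) (d : nat).
Local Notation V := 'rV[R]_d.
Local Notation B := (borelV R d).
Local Notation leb := (@lebV R d).

(** Positivity comes from the unit ball, where [expR (- U q) >= expR (- M)]. *)
Lemma normalising_constant (U : V -> R) : continuous U ->
  (exists M, forall x, `|x| <= 1 -> `|U x| <= M) ->
  (leb_int (fun q => (expR (- U q))%:E) < +oo)%E ->
  exists2 Z, 0 < Z & leb_int (fun q => (expR (- U q))%:E) = Z%:E.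
Proof.
move=> cU [M hM] Zfin; set I := leb_int _ in Zfin *.
have mexp : measurable_fun (setT : set B) (fun q : V => (expR (- U q))%:E).
  apply/measurable_EFinP; apply: measurableT_comp => //; apply: measurable_funN.
  exact: continuous_measurable_rV.
have IE : I = (\int[leb]_q (expR (- U q))%:E)%E.
  by rewrite (integral_lebV mexp)// => x; rewrite lee_fin expR_ge0.
have mb : measurable (ball (0 : V) 1 : set B) := measurable_ball_rV _ _.
have I0 : (0 < I)%E.
  apply: (@lt_le_trans _ _ ((expR (- M))%:E * leb (ball (0%R : V) 1%R))%E).
    by rewrite lebV_ball// -EFinM lte_fin mulr_gt0 ?expR_gt0// exprn_gt0// mulr1.
  rewrite IE -integral_cst//.
  apply: (@le_trans _ _ (\int[leb]_(q in ball (0%R : V) 1%R) (expR (- U q))%:E)%E).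
    apply: ge0_le_integral => //; last 2 first.
    - exact: measurable_funTS.
    - move=> q; rewrite -ball_normE /= sub0r normrN => q1.
      by rewrite lee_fin ler_expR lerN2 (le_trans (ler_norm _))// hM// ltW.
    - by move=> q _; rewrite lee_fin expR_ge0.
  by apply: ge0_subset_integral => // q _; rewrite lee_fin expR_ge0.
have If : I \is a fin_num by rewrite ge0_fin_numE// ltW.
by exists (fine I); [rewrite fine_gt0// I0|rewrite fineK].
Qed.

End normalisation.

Unset Implicit Arguments.
Theorem theorem3 (R : realType) (d : nat) (U : 'rV[R]_d -> R)
  (beta L1 M1 : R) :
  (forall q, differentiable U q) ->
  continuous (grad U) ->
  (leb_int (fun q => (expR (- U q))%:E) < +oo)%E ->
  0 <= beta <= 1 ->
  0 <= L1 -> 0 <= M1 ->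
  (forall q q', enorm (grad U q - grad U q') <= L1 * enorm (q - q')) ->
  (forall q, enorm (grad U q) <= M1 * (1 + enorm q `^ beta)) ->
  let good (h : R) (T : nat) :=
    let Pn := hmc_kernel_n U h T in
    [/\ irreducible Pn,
        irreducibility_measure Pn (@leb_d R d),
        (forall C : set 'rV[R]_d, compact C -> small_set Pn C) &
      [/\ aperiodic Pn (@leb_d R d),
        recurrent Pn &
        exists N : set 'rV[R]_d, [/\ borel_d N, target U N = 0%E &
          forall q, ~ N q ->
            (fun n => tv_dist (hmc_kernel_n U h T n q) (target U)) @ \oo --> 0%E]]] in
  (beta < 1 -> forall h : R, 0 < h -> forall T : nat, (1 <= T)%N -> good h T) /\
  (beta = 1 -> forall T : nat, (1 <= T)%N ->
     exists hbar : R, 0 < hbar /\ forall h : R, 0 < h <= hbar -> good h T).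
Proof.
move=> dU cgU Zfin beta01 L10 M10 glip ggrow good.
have cU : continuous U by move=> q; exact: differentiable_continuous.
have Ub := U_bounded dU beta01 M10 ggrow.
have [Z Z0 ZE] := normalising_constant cU (Ub 1) Zfin.
(* Both cases reduce to the coercivity bound with the constant that the action needs; they differ
   only in the range of [h] for which it is obtained. *)
have main h T K : 0 < h -> (1 <= T)%N -> 0 <= K ->
    (forall q, h ^+ 2 * U q <= (4 * T%:R * 2 ^+ T)^-1 * sq q + K) -> good h T.
  move=> h0 T0 K0 U_le.
  have surj := leapfrogT_surjective T0 h0 dU U_le K0 (gradU_bounded L10 glip).
  have lip := leapfrogT_lipschitz L10 glip T h0.
  have acc := accept_ge dU beta01 L10 M10 glip ggrow T h0.
  have hmc_min := hmc_minorization cU cgU lip surj acc.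
  split.
  - exact: (hmc_irreducible cU cgU Z0 ZE Ub hmc_min).
  - exact: (hmc_irreducibility_measure cU cgU Z0 ZE Ub hmc_min).
  - by move=> C; exact: (hmc_small cU cgU hmc_min).
  split.
  - exact: (hmc_aperiodic cU cgU Z0 ZE Ub hmc_min).
  - exact: (hmc_recurrent cU cgU Z0 ZE Ub hmc_min).
  - exact: (hmc_convergence cU cgU Z0 ZE Ub hmc_min).
have eps0 T : (1 <= T)%N -> 0 < (4 * T%:R * 2 ^+ T)^-1 :> R.
  by move=> T0; rewrite invr_gt0 !mulr_gt0 ?exprn_gt0// ltr0n.
split=> [b1 h h0 T T0|b1 T T0].
  have [K K0 hK] := U_le_sublinear dU beta01 M10 ggrow h b1 (eps0 T T0).
  exact: main hK.
have [hbar hbar0 hh] := U_le_linear dU beta01 M10 ggrow b1 (eps0 T T0).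
exists hbar; split => // h hle; have [K K0 hK] := hh h hle.
by case/andP: hle => h0 _; exact: main hK.
Qed.
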